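(* Let $m,n\in\mathbb{N}_0$ with $m+n\geq 2$ and let $X$ be a closed subset of $\mathbb{T}^{\binom{m+n}{2}}$. Then the set $$\{\pi^{\Theta}_{(I,\rho)} : I\in\Sigma_{m,n},\ \rho\in\widehat{\mathcal{A}^{|I|}_{\Theta_I}},\ \Theta\in X\}$$ gives all irreducible representations of $C^{m,n}_X$ up to unitary equivalence; that is, each $\pi^{\Theta}_{(I,\rho)}$ in this set, regarded as a representation of $C_X^{m,n}$, is irreducible, and every irreducible representation of $C_X^{m,n}$ is unitarily equivalent to some $\pi^{\Theta}_{(I,\rho)}$ in this set.
   Context: All Hilbert spaces and $C^*$-algebras are separable and over $\mathbb{C}$; $\mathbb{N}_0=\{0,1,2,\dots\}$. For $m+n\ge 2$ and $X\subseteq\mathbb{T}^{\binom{m+n}{2}}$ closed, $C^{m,n}_X$ is the universal $C^*$-algebra generated by $s_1,\dots,s_{m+n}$ and $\{u_{ij}:1\le i<j\le m+n\}$ subject to: $s_i^*s_j=u_{ij}^*s_js_i^*$ for $i<j$; $s_i^*s_i=1$ for $1\le i\le m+n$; $s_is_i^*=1$ for $1\le i\le m$; each $u_{pq}$ is unitary and commutes with every $s_i$ and every $u_{ij}$; and the joint spectrum of $(u_{ij})_{i<j}$ is contained in $X$. A tuple $\Theta=(\theta_{ij})_{1\le i<j\le m+n}$ of real numbers is identified with the point $(e^{2\pi \mathrm{i}\theta_{ij}})_{i<j}$ of the torus; ''$\Theta\in X$'' means $(e^{2\pi \mathrm{i}\theta_{ij}})_{i<j}\in X$. $\Sigma_{m,n}=\{I\subseteq\{1,\dots,m+n\}:\{1,\dots,m\}\subseteq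 I\}$ and $\Theta_I=\{\theta_{ij}: i<j,\ i,j\in I\}$. $\mathcal{A}^{|I|}_{\Theta_I}$ is the noncommutative torus: the universal $C^*$-algebra generated by unitaries $s_i$, $i\in I$, with $s_is_j=e^{2\pi \mathrm{i}\theta_{ij}}s_js_i$ for $i<j$ in $I$ (equal to $\mathbb{C}$ if $I=\emptyset$ and $C(\mathbb{T})$ if $|I|=1$). $\widehat{A}$ denotes the set of unitary equivalence classes of irreducible representations of $A$. Let $\{e_k\}_{k\in\mathbb{N}_0}$ be the standard basis of $\ell^2(\mathbb{N}_0)$, $S^*e_k=e_{k+1}$, and $Ne_k=ke_k$. Let $I=\{i_1<\dots<i_r\}\in\Sigma_{m,n}$, $I^c=\{j_1<\dots<j_s\}$, and let $\rho:\mathcal{A}^{|I|}_{\Theta_I}\to\mathcal{L}(K)$ be a unital representation. Then $\pi^{\Theta}_{(I,\rho)}$ is the representation on $K\otimes\ell^2(\mathbb{N}_0)^{\otimes(m+n-|I|)}$ given by $$s_{j_l}\mapsto 1\otimes1^{\otimes(l-1)}\otimes S^*\otimes e^{2\pi \mathrm{i}\theta_{j_lj_{l+1}}N}\otimes\cdots\otimes e^{2\pi \mathrm{i}\theta_{j_lj_s}N}\quad(1\le l\le s),$$ $$s_{i_l}\mapsto\rho(s_{i_l})\otimes\lambda_{i_l,j_1}\otimes\cdots\otimes\lambda_{i_l,j_s}\quad(1\le l\le r),$$ where $\lambda_{i,j}=e^{2\pi \mathrm{i}\theta_{ij}N}$ if $i<j$ and $\lambda_{i,j}=e^{-2\pi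 \mathrm{i}\theta_{ji}N}$ if $i>j$. It is regarded as a representation of $C^{m,n}_X$ by setting $u_{ij}\mapsto e^{2\pi \mathrm{i}\theta_{ij}}1$. *)

(* Defs.v *)
From HB Require Import structures.
From mathcomp Require Import all_boot all_order all_algebra.
From mathcomp Require Import complex.
From mathcomp Require Import all_classical all_reals all_analysis.
From mathcomp Require Import ring.
Set Implicit Arguments.
Unset Strict Implicit.
Unset Printing Implicit Defensive.
Import Order.TTheory GRing.Theory Num.Theory.
Import numFieldNormedType.Exports.
Local Open Scope classical_set_scope.
Local Open Scope ring_scope.

Section Complex.
Local Open Scope complex_scope.
Variable R : realType.
Implicit Types z w : R[i].

Lemma gt0_RRe z : 0 < z -> (complex.Re z)%:C = z.
Proof. by move=> z0; apply: RRe_real; apply: gtr0_real. Qed.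

Lemma Re_norm_le z w : `|z| <= w -> `|complex.Re z| <= complex.Re w.
Proof.
move=> zw; rewrite -lecR; apply: (le_trans (normc_ge_Re z)).
by rewrite RRe_real // ger0_real // (le_trans _ zw).
Qed.

Lemma Re_norm_lt z w : `|z| < w -> `|complex.Re z| < complex.Re w.
Proof.
move=> zw; rewrite -ltcR; apply: (le_lt_trans (normc_ge_Re z)).
by rewrite RRe_real // gtr0_real // (le_lt_trans _ zw).
Qed.

Lemma Im_norm_lt z w : `|z| < w -> `|complex.Im z| < complex.Re w.
Proof.
move=> zw; rewrite -normrN -ReiNIm; apply: Re_norm_lt.
by rewrite normrM complexiE normCi mulr1.
Qed.

Lemma norm_complex_le (a b : R) : `|a +i* b| <= (`|a| + `|b|)%:C :> R[i].
Proof.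
rewrite normc_def lecR /= -[leRHS]ger0_norm ?addr_ge0 // -sqrtr_sqr.
rewrite ler_wsqrtr // sqrrD !real_normK ?num_real // lerD2r lerDl.
by rewrite mulrn_wge0 // mulr_ge0.
Qed.
End Complex.

(* The library puts the norm topology on the alias R[i]^o only; R[i]^o cannot
   be made complete because the instance for R^o (R : realType) shadows it. *)
HB.instance Definition _ (R : realType) := NormedModule.copy R[i] R[i]^o.

Section ComplexTopology.
Local Open Scope complex_scope.
Variable R : realType.
Local Notation C := R[i].

Lemma cvg_complex (T : Type) (F : set_system T) (FF : Filter F) (f : T -> C)
    (z : C) :
  (complex.Re (f x) @[x --> F] --> complex.Re z) ->
  (complex.Im (f x) @[x --> F] --> complex.Im z) -> f @ F --> z.
Proof.
move=> /cvgrPdist_lt fRe /cvgrPdist_lt fIm; apply/cvgrPdist_lt => e e0.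
have re0 : 0 < complex.Re e by rewrite -ltcR gt0_RRe.
have re20 : 0 < complex.Re e / 2 by rewrite divr_gt0.
near=> x.
have -> : z - f x =
    (complex.Re z - complex.Re (f x)) +i* (complex.Im z - complex.Im (f x)).
  by case: (z) (f x) => [a b] [c d].
apply: le_lt_trans (norm_complex_le _ _) _.
rewrite -[e]gt0_RRe // ltcR [ltRHS]splitr ltrD //.
  by near: x; exact: fRe.
by near: x; exact: fIm.
Unshelve. all: by end_near. Qed.

Lemma complex_complete (F : set_system C) :
  ProperFilter F -> cauchy F -> cvg F.
Proof.
move=> FF Fc.
have cvgp (p : C -> R) :
    (forall z w e, `|z - w| < e -> `|p z - p w| < complex.Re e) ->
    cvg (p @ F).
  move=> pP; apply: cauchy_cvg; apply/cauchy_ballP => e e0.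
  move/cauchy_ballP: Fc => /(_ e%:C); rewrite ltcR => /(_ e0).
  move=> [[A B] /= [FA FB] AB].
  exists (p @` A, p @` B) => /=.
    by split; [apply: filterS FA|apply: filterS FB] => z Az; exists z.
  move=> [_ _] /= [[z Az <-] [w Bw <-]]; rewrite -ball_normE /=.
  apply: (pP z w e%:C); have := AB (z, w) (conj Az Bw).
  by rewrite -ball_normE.
have /cvg_ex[a Fa] : cvg ((@complex.Re R : C -> R) @ F).
  apply: cvgp => z w e /Re_norm_lt.
  by case: z w => [? ?] [? ?].
have /cvg_ex[b Fb] : cvg ((@complex.Im R : C -> R) @ F).
  apply: cvgp => z w e /Im_norm_lt.
  by case: z w => [? ?] [? ?].
by apply/cvg_ex; exists (a +i* b); apply: cvg_complex.
Unshelve. all: by end_near. Qed.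

HB.instance Definition _ := Uniform_isComplete.Build C complex_complete.

Section NonnegSeries.
Variables (u : nat -> C) (M : R[i]).
Hypothesis u0 : forall k, 0 <= u k.
Hypothesis uM : forall n, \sum_(0 <= k < n) u k <= M.
Let v k := complex.Re (u k).

Let uE k : u k = (v k)%:C.
Proof. by rewrite /v RRe_real // ger0_real. Qed.

Let uvE n : \sum_(0 <= k < n) u k = (series v n)%:C.
Proof. by rewrite /series/= raddf_sum; apply: eq_bigr => k _; rewrite uE. Qed.

Let ME : (complex.Re M)%:C = M.
Proof.
by rewrite RRe_real // ger0_real //; apply: le_trans (uM 0%N); rewrite big_nil.
Qed.

Let v_nd : nondecreasing_seq (series v).
Proof. by apply: nondecreasing_series => k _ _; rewrite -ler0c -uE. Qed.

Let vM n : series v n <= complex.Re M.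
Proof. by rewrite -lecR -uvE ME; exact: uM. Qed.

Let v_cvg : cvgn (series v).
Proof.
by apply: nondecreasing_is_cvgn => //; exists (complex.Re M) => _ [n _ <-].
Qed.

Let u_cvg : (series u : nat -> C) @ \oo --> (((limn (series v))%:C) : C).
Proof.
have -> : series u = fun n => (series v n)%:C by apply/funext => n; exact: uvE.
by apply: cvg_complex => //=; exact: cvg_cst.
Qed.

Lemma nonneg_series_cvg : cvgn (series u).
Proof. by apply/cvg_ex; eexists; exact: u_cvg. Qed.

Lemma nonneg_series_le : limn (series u) <= M.
Proof.
rewrite (cvg_lim _ u_cvg) // -ME lecR; apply: limr_le => //.
by near=> n; exact: vM.
Unshelve. all: by end_near. Qed.

Lemma nonneg_series_ge n : \sum_(0 <= k < n) u k <= limn (series u).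
Proof.
by rewrite (cvg_lim _ u_cvg) // uvE lecR; exact: nondecreasing_cvgn_le.
Qed.

End NonnegSeries.

End ComplexTopology.

(* Norms over R[i] take their values in the nonnegative elements of R[i]. *)
HB.mixin Record CompleteNormedModule_isHilbert (R : realType) H
    of CompleteNormedModule R[i] H := {
  inner : H -> H -> R[i];
  inner_scalar : forall y, scalar (inner^~ y);
  inner_conj : forall x y, inner y x = (inner x y)^*;
  inner_norm : forall x, inner x x = `|x| ^+ 2 }.

#[short(type="hilbertType")]
HB.structure Definition Hilbert (R : realType) :=
  {H of CompleteNormedModule R[i] H & CompleteNormedModule_isHilbert R H}.

Section InnerTheory.
Variables (R : realType) (V : lmodType R[i]) (ip : V -> V -> R[i]).
Hypothesis ip_scalar : forall y, scalar (ip^~ y).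
Hypothesis ip_conj : forall x y, ip y x = (ip x y)^*.

Lemma ipDl x y z : ip (x + y) z = ip x z + ip y z.
Proof. by have := ip_scalar z 1 x y; rewrite scale1r mul1r. Qed.
Lemma ip0l z : ip 0 z = 0.
Proof. by apply: (addrI (ip 0 z)); rewrite -ipDl !addr0. Qed.
Lemma ipZl c x z : ip (c *: x) z = c * ip x z.
Proof. by have := ip_scalar z c x 0; rewrite !addr0 ip0l addr0. Qed.
Lemma ipNl x z : ip (- x) z = - ip x z.
Proof. by rewrite -scaleN1r ipZl mulN1r. Qed.
Lemma ipDr x y z : ip z (x + y) = ip z x + ip z y.
Proof. by rewrite ip_conj ipDl rmorphD /= -!ip_conj. Qed.
Lemma ipZr c x z : ip z (c *: x) = c^* * ip z x.
Proof. by rewrite ip_conj ipZl rmorphM /= -!ip_conj. Qed.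
Lemma ipNr x z : ip z (- x) = - ip z x.
Proof. by rewrite ip_conj ipNl rmorphN /= -!ip_conj. Qed.
Lemma ip0r z : ip z 0 = 0.
Proof. by rewrite -(scale0r 0) ipZr rmorph0 mul0r. Qed.

Lemma ip_polarization x y : 4%:R * ip x y =
  ip (x + y) (x + y) - ip (x - y) (x - y) +
  'i * (ip (x + 'i *: y) (x + 'i *: y) - ip (x - 'i *: y) (x - 'i *: y)).
Proof.
have ic : ('i)^* = - 'i :> R[i] by rewrite conjCi.
have ii : 'i * 'i = -1 :> R[i] by rewrite -expr2 sqrCi.
rewrite !(ipDl, ipDr, ipNl, ipNr, ipZl, ipZr) ic.
set a := ip x x; set b := ip x y; set c := ip y x; set d := ip y y.
transitivity (2%:R * b + 2%:R * c - ('i * 'i) * (2%:R * b) +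
  ('i * 'i) * (2%:R * c)); last by ring.
by rewrite ii; ring.
Qed.

Hypothesis ip_ge0 : forall x, 0 <= ip x x.

Lemma ip_parallelogram x y : ip (x + y) (x + y) <= 2 * ip x x + 2 * ip y y.
Proof.
rewrite -subr_ge0; have := ip_ge0 (x - y).
rewrite !(ipDl, ipDr, ipNl, ipNr) => /le_trans; apply.
by rewrite le_eqVlt; apply/orP; left; apply/eqP; ring.
Qed.

Hypothesis ip_eq0 : forall x, ip x x = 0 -> x = 0.

Lemma ip_CauchySchwarz x y : `|ip x y| ^+ 2 <= ip x x * ip y y.
Proof.
have [y0|y0] := eqVneq (ip y y) 0.
  by rewrite (ip_eq0 y0) !ip0r normr0 mulr0 expr0n.
have yp : 0 < ip y y by rewrite lt_def y0 ip_ge0.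
have := ip_ge0 (ip y y *: x - ip x y *: y).
rewrite !(ipDl, ipDr, ipNl, ipNr, ipZl, ipZr) -(ip_conj x y) -(ip_conj y y).
rewrite normCK -(ip_conj x y).
set a := ip x x; set b := ip x y; set d := ip y y; set c := ip y x.
set X := (X in 0 <= X -> _).
have -> : X = d * (a * d - b * c) by rewrite /X; ring.
by rewrite pmulr_rge0 // subr_ge0.
Qed.

Definition ip_norm x := sqrtC (ip x x).

Lemma sqr_ip_norm x : ip_norm x ^+ 2 = ip x x.
Proof. exact: sqrtCK. Qed.

Lemma ip_norm_ge0 x : 0 <= ip_norm x.
Proof. by rewrite sqrtC_ge0. Qed.

Lemma ip_norm_eq0 x : ip_norm x = 0 -> x = 0.
Proof. by move/eqP; rewrite sqrtC_eq0 => /eqP/ip_eq0. Qed.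

Lemma ip_normZ c x : ip_norm (c *: x) = `|c| * ip_norm x.
Proof.
apply/eqP; rewrite -(@eqrXn2 _ 2) ?mulr_ge0 ?ip_norm_ge0 //.
by rewrite exprMn !sqr_ip_norm ipZl ipZr mulrA normCK.
Qed.

Lemma ip_normD x y : ip_norm (x + y) <= ip_norm x + ip_norm y.
Proof.
rewrite -(@ler_pXn2r _ 2) ?nnegrE ?addr_ge0 ?ip_norm_ge0 //.
rewrite sqrrD !sqr_ip_norm !(ipDl, ipDr) addrA lerD2r -!addrA lerD2l.
rewrite [ip y x]ip_conj [(_)^*]/(conjc _) addcJ mulr2n -mulr2n -mulr_natl ler_pM2l ?ltr0n //.
apply: le_trans (_ : `|ip x y| <= _).
  apply: le_trans (normc_ge_Re _).
  by rewrite lecR ler_norm.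
rewrite -(@ler_pXn2r _ 2) ?nnegrE ?mulr_ge0 ?ip_norm_ge0 //.
by rewrite exprMn !sqr_ip_norm ip_CauchySchwarz.
Qed.
End InnerTheory.

Section L2.
Variables (R : realType) (K : hilbertType R).
Local Notation C := R[i].
Implicit Types f g h : nat -> K.

Definition square_summable f :=
  exists M : R[i], forall n, \sum_(0 <= k < n) `|f k| ^+ 2 <= M.

Definition l2_pred : {pred nat -> K} := fun f => `[< square_summable f >].

Lemma l2_predP f : reflect (square_summable f) (f \in l2_pred).
Proof. exact: asboolP. Qed.

Lemma inner_ge0 (x : K) : 0 <= inner x x.
Proof. by rewrite inner_norm exprn_ge0. Qed.

Lemma inner_eq0 (x : K) : inner x x = 0 -> x = 0.
Proof. by rewrite inner_norm => /eqP; rewrite expf_eq0 /= normr_eq0 => /eqP. Qed.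

Lemma l2_submod : submod_closed l2_pred.
Proof.
split.
  apply/l2_predP; exists 0 => n; rewrite big1 // => k _.
  by rewrite normr0 expr0n.
move=> c f g /l2_predP[M fM] /l2_predP[N gN]; apply/l2_predP.
exists (2 * (`|c| ^+ 2 * M) + 2 * N) => n.
apply: le_trans (_ : \sum_(0 <= k < n)
    (2 * (`|c| ^+ 2 * `|f k| ^+ 2) + 2 * `|g k| ^+ 2) <= _).
  apply: ler_sum => k _; rewrite -exprMn -normrZ -!inner_norm.
  exact: (ip_parallelogram (@inner_scalar R K) (@inner_conj R K) inner_ge0).
rewrite big_split /= -!mulr_sumr; apply: lerD.
  by rewrite ler_wpM2l // ler_wpM2l // exprn_ge0.
by rewrite ler_wpM2l.
Qed.

HB.instance Definition _ :=
  GRing.isSubmodClosed.Build R[i] (nat -> K) l2_pred l2_submod.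

Record l2 : Type := MkL2 { l2_fun :> nat -> K; l2_mem : l2_fun \in l2_pred }.
HB.instance Definition _ := [isSub for l2_fun].
HB.instance Definition _ := [Choice of l2 by <:].
HB.instance Definition _ := [SubChoice_isSubLmodule of l2 by <:].

Implicit Types u v w : l2.

(* l2 K, the square-summable sequences in K, is K (x) l2(N_0); see tens,
   inner_tens and tens_total below. In particular l2 R[i] is l2(N_0). *)
Definition l2_inner u v : R[i] :=
  limn (series (fun k => inner (u k) (v k)) : nat -> C).

Lemma l2_self_cvg u : cvgn (series (fun k => inner (u k) (u k)) : nat -> C).
Proof.
have /l2_predP[M uM] := l2_mem u.
apply: (@nonneg_series_cvg R _ M) => [k|n]; first exact: inner_ge0.
by under eq_bigr do rewrite inner_norm.
Qed.

Lemma l2DE u v k : (u + v) k = u k + v k. Proof. by []. Qed.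
Lemma l2NE u k : (- u) k = - u k. Proof. by []. Qed.
Lemma l2ZE c u k : (c *: u) k = c *: u k. Proof. by []. Qed.
Lemma l2_0E k : (0 : l2) k = 0. Proof. by []. Qed.

Let q u : nat -> C := fun k => inner (u k) (u k).
Let p u v : nat -> C := fun k => inner (u k) (v k).

Let pE u v : p u v = (4%:R^-1 : R[i]) *: (q (u + v) - q (u - v) +
  ('i : R[i]) *: (q (u + 'i *: v) - q (u - 'i *: v))).
Proof.
apply/funext => k; apply: (@mulfI _ (4%:R : R[i])); first by rewrite pnatr_eq0.
transitivity (4%:R * (4%:R^-1 * (q (u + v) k - q (u - v) k +
  'i * (q (u + 'i *: v) k - q (u - 'i *: v) k)))); last by [].
rewrite mulVKf ?pnatr_eq0 // /p /q.
exact: (ip_polarization (@inner_scalar R K) (@inner_conj R K)).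
Qed.

Lemma l2_inner_cvg u v : cvgn (series (p u v)).
Proof.
rewrite pE; apply: is_cvg_seriesZ; apply: is_cvg_seriesD.
  by apply: is_cvg_seriesB; exact: l2_self_cvg.
by apply: is_cvg_seriesZ; apply: is_cvg_seriesB; exact: l2_self_cvg.
Qed.

Lemma l2_inner_scalar v : scalar (l2_inner^~ v).
Proof.
move=> c u w; rewrite /l2_inner -/(p _ _) -/(p _ _) -/(p _ _).
have -> : p (c *: u + w) v = c *: p u v + p w v.
  by apply/funext => k; rewrite /p l2DE l2ZE inner_scalar.
have uv := @l2_inner_cvg u v; have wv := @l2_inner_cvg w v.
apply: etrans (lim_seriesD (is_cvg_seriesZ (k := c) uv) wv) _.
by congr (_ + _); apply: (lim_seriesZ c uv).
Qed.

Lemma l2_inner_ge0 u : 0 <= l2_inner u u.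
Proof.
have /l2_predP[M uM] := l2_mem u.
rewrite /l2_inner -/(q u).
apply: le_trans (nonneg_series_ge (u := q u) (M := M) _ _ 0%N).
- by rewrite big_nil.
- by move=> k; exact: inner_ge0.
- by move=> n; under eq_bigr do rewrite /q inner_norm.
Qed.

Lemma l2_partial_le u n : \sum_(0 <= k < n) `|u k| ^+ 2 <= l2_inner u u.
Proof.
have /l2_predP[M uM] := l2_mem u.
under eq_bigr do rewrite -inner_norm.
apply: (nonneg_series_ge (u := q u) (M := M)).
- by move=> k; exact: inner_ge0.
- by move=> m; under eq_bigr do rewrite /q inner_norm.
Qed.

Lemma l2_inner_le u M : (forall n, \sum_(0 <= k < n) `|u k| ^+ 2 <= M) ->
  l2_inner u u <= M.
Proof.
move=> uM; apply: (nonneg_series_le (u := q u) (M := M)).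
- by move=> k; exact: inner_ge0.
- by move=> m; under eq_bigr do rewrite /q inner_norm.
Qed.

Lemma l2_coord_le u k : `|u k| ^+ 2 <= l2_inner u u.
Proof.
apply: le_trans (l2_partial_le u k.+1).
by rewrite big_nat_recr //= lerDr sumr_ge0 // => j _; rewrite exprn_ge0.
Qed.

Lemma l2_inner_eq0 u : l2_inner u u = 0 -> u = 0.
Proof.
move=> u0; apply: val_inj; apply/funext => k /=.
have := l2_coord_le u k; rewrite u0 => uk.
have /eqP : `|u k| ^+ 2 = 0 by apply/eqP; rewrite eq_le uk exprn_ge0.
by rewrite expf_eq0 /= normr_eq0 => /eqP.
Qed.

Lemma conjC_cvg (a : nat -> C) (l : C) : a @ \oo --> l ->
  ((a n)^* : C) @[n --> \oo] --> (l^* : C).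
Proof.
move=> /cvgrPdist_lt al; apply/cvgrPdist_lt => e e0.
near=> n; rewrite -rmorphB norm_conjC; near: n.
exact: al.
Unshelve. all: by end_near. Qed.

Lemma l2_inner_conj u v : l2_inner v u = (l2_inner u v)^*.
Proof.
rewrite /l2_inner -/(p v u) -/(p u v); apply: (@cvg_lim C) => //.
have -> : series (p v u) = fun n => (series (p u v) n)^*.
  apply/funext => n; rewrite /series /= rmorph_sum.
  by apply: eq_bigr => k _; rewrite /p inner_conj.
exact: conjC_cvg (@l2_inner_cvg u v).
Qed.

HB.instance Definition _ := Lmodule_isNormed.Build R[i] l2
  (ip_normD l2_inner_scalar l2_inner_conj l2_inner_ge0 l2_inner_eq0)
  (ip_normZ l2_inner_scalar l2_inner_conj l2_inner_ge0)
  (ip_norm_eq0 l2_inner_eq0).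

Lemma l2_normE u : `|u| ^+ 2 = l2_inner u u.
Proof. exact: sqr_ip_norm. Qed.

End L2.

Lemma cvgC_le (R : realType) (T : Type) (F : set_system T)
    (FF : ProperFilter F) (f : T -> R[i]) (l M : R[i]) :
  f @ F --> (l : R[i]) -> (\forall x \near F, f x <= M) -> l <= M.
Proof.
move=> fl fM; rewrite lecE; apply/andP; split.
  have fI : (complex.Im (f x) @[x --> F] --> complex.Im l).
    move/cvgrPdist_lt : fl => fl; apply/cvgrPdist_lt => e e0.
    have : \forall t \near F, `|l - f t| < e%:C%C by apply: fl; rewrite ltcR.
    apply: filterS => x /Im_norm_lt.
    by case: (l) (f x) => [? ?] [? ?].
  have fI' : (complex.Im (f x) @[x --> F] --> complex.Im M).
    apply: cvg_near_cst; apply: filterS fM => x.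
    by rewrite lecE => /andP[/eqP].
  by apply/eqP; apply: cvg_unique fI' fI.
have fR : (complex.Re (f x) @[x --> F] --> complex.Re l).
  move/cvgrPdist_lt : fl => fl; apply/cvgrPdist_lt => e e0.
  have : \forall t \near F, `|l - f t| < e%:C%C by apply: fl; rewrite ltcR.
  apply: filterS => x /Re_norm_lt.
  by case: (l) (f x) => [? ?] [? ?].
rewrite -(cvg_lim _ fR) //; apply: limr_le; first by apply/cvg_ex; exists (complex.Re l).
by apply: filterS fM => x; rewrite lecE => /andP[_].
Qed.

Section L2Complete.
Variables (R : realType) (K : hilbertType R).
Local Notation C := R[i].
Local Notation l2 := (l2 K).

Lemma l2_norm_coord (u : l2) k : `|u k| <= `|u|.
Proof.
by rewrite -(@ler_pXn2r _ 2) ?nnegrE // l2_normE; exact: l2_coord_le.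
Qed.

Lemma l2_complete (F : set_system l2) : ProperFilter F -> cauchy F -> cvg F.
Proof.
move=> FF /cauchy_ballP Fc.
have coord_cvg k : cvg ((fun u : l2 => u k : K) @ F).
  apply: cauchy_cvg; apply/cauchy_ballP => e e0.
  have [[A B] /= [FA FB] AB] := Fc e e0.
  exists ((fun u : l2 => u k) @` A, (fun u : l2 => u k) @` B) => /=.
    by split; [apply: filterS FA|apply: filterS FB] => z Az; exists z.
  move=> [_ _] /= [[z Az <-] [w Bw <-]]; rewrite -ball_normE /=.
  have := AB (z, w) (conj Az Bw); rewrite -ball_normE /=.
  by apply: le_lt_trans; exact: (l2_norm_coord (z - w) k).
pose g k := lim ((fun u : l2 => u k : K) @ F).
have key e : 0 < e -> exists2 A, F A & forall u : l2, A u -> forall n,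
    \sum_(0 <= k < n) `|u k - g k| ^+ 2 <= e ^+ 2.
  move=> e0; have [[A B] /= [FA FB] AB] := Fc e e0.
  exists A => // u Au n.
  apply: (@cvgC_le _ _ F _
    (fun v : l2 => \sum_(0 <= k < n) `|u k - v k| ^+ 2)).
    have cn k : (`|u k - (v : l2) k| : C) @[v --> F] --> (`|u k - g k| : C).
      apply: cvg_norm; apply: cvgB; first exact: cvg_cst.
      exact: coord_cvg.
    elim: n => [|n IHn].
      by rewrite big_nil; under eq_fun do rewrite big_nil; exact: cvg_cst.
    have sumS (h : nat -> K) : \sum_(0 <= k < n.+1) `|u k - h k| ^+ 2 =
        \sum_(0 <= k < n) `|u k - h k| ^+ 2 + `|u n - h n| * `|u n - h n|.
      by rewrite big_nat_recr // expr2.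
    have -> : (fun v : l2 => \sum_(0 <= k < n.+1) `|u k - v k| ^+ 2) =
        (fun v : l2 => \sum_(0 <= k < n) `|u k - v k| ^+ 2 +
                       `|u n - v n| * `|u n - v n|).
      by apply/funext => v; exact: sumS.
    rewrite sumS.
    apply: cvgD; first exact: IHn.
    exact: cvgM (cn n) (cn n).
  apply: filterS FB => v Bv.
  have := AB (u, v) (conj Au Bv); rewrite -ball_normE /= => uv.
  apply: le_trans (l2_partial_le (u - v) n) _.
  by rewrite -l2_normE ler_pXn2r ?nnegrE // ltW.
have gP : g \in @l2_pred R K.
  have [A FA Ag] := key 1 ltr01.
  have [u Au] := filter_ex FA.
  have ug : (l2_fun u - g : nat -> K) \in @l2_pred R K.
    by apply/l2_predP; exists (1 ^+ 2) => n; exact: Ag.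
  have -> : g = (l2_fun u : nat -> K) - (l2_fun u - g : nat -> K).
    by rewrite opprB addrC subrK.
  by rewrite rpredB //; exact: l2_mem.
apply/cvg_ex; exists (MkL2 gP); apply/cvgrPdist_le => e e0.
have [A FA Ag] := key e e0.
apply: filterS FA => u Au; rewrite distrC.
rewrite -(@ler_pXn2r _ 2) ?nnegrE ?(ltW e0) // l2_normE.
apply: (@l2_inner_le R K (u - MkL2 gP)) => n; exact: (Ag u Au n).
Qed.

HB.instance Definition _ := Uniform_isComplete.Build l2 l2_complete.
HB.instance Definition _ := CompleteNormedModule_isHilbert.Build R l2
  (@l2_inner_scalar R K) (@l2_inner_conj R K) (fun u => esym (l2_normE u)).

End L2Complete.

Section Scalars.
Variable R : realType.
Local Notation C := R[i].
Definition scalar_inner (x y : C) : R[i] := x * y^*.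
Lemma scalar_inner_scalar (y : C) : scalar (scalar_inner^~ y).
Proof. by move=> c x z; rewrite /scalar_inner mulrDl mulrA. Qed.
Lemma scalar_inner_conj (x y : C) : scalar_inner y x = (scalar_inner x y)^*.
Proof. by rewrite /scalar_inner rmorphM /= conjCK mulrC. Qed.
Lemma scalar_inner_norm (x : C) : scalar_inner x x = `|x| ^+ 2.
Proof. by rewrite /scalar_inner normCK. Qed.
HB.instance Definition _ := CompleteNormedModule_isHilbert.Build R C
  scalar_inner_scalar scalar_inner_conj scalar_inner_norm.
End Scalars.

Section Tensor.
Variable R : realType.
Implicit Types K : hilbertType R.

Lemma tens_subproof K (x : K) (xi : l2 R[i]) :
  (fun k => xi k *: x) \in @l2_pred R K.
Proof.
have /l2_predP[M xiM] := l2_mem xi; apply/l2_predP; exists (M * `|x| ^+ 2) => n.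
under eq_bigr do rewrite normrZ exprMn.
by rewrite -mulr_suml ler_wpM2r // exprn_ge0.
Qed.

(* The elementary tensor of x and xi in l2 K = K (x) l2(N_0). *)
Definition tens K (x : K) (xi : l2 R[i]) : l2 K := MkL2 (tens_subproof x xi).

Lemma inner_tens K (x y : K) (xi eta : l2 R[i]) :
  inner (tens x xi) (tens y eta) = inner x y * inner xi eta.
Proof.
change (l2_inner (tens x xi) (tens y eta) = inner x y * l2_inner xi eta).
rewrite /l2_inner.
suff -> : (fun k => inner (tens x xi k) (tens y eta k)) =
    inner x y *: ((fun k => inner (xi k) (eta k)) : nat -> R[i]).
  exact: lim_seriesZ (@l2_inner_cvg R R[i] xi eta).
apply/funext => k; rewrite /= (ipZl (@inner_scalar R K)).
rewrite (ipZr (@inner_scalar R K) (@inner_conj R K)).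
by rewrite mulrA mulrC.
Qed.

Lemma shift_subproof (xi : l2 R[i]) :
  (fun k => if k is k'.+1 then xi k' else 0) \in @l2_pred R R[i].
Proof.
have /l2_predP[M xiM] := l2_mem xi; apply/l2_predP; exists M => -[|n].
  by have := xiM 0%N; rewrite !big_nil.
by rewrite big_nat_recl //= normr0 expr0n add0r.
Qed.

(* The unilateral shift written S^* in the paper: e_k |-> e_(k+1). *)
Definition l2_shift (xi : l2 R[i]) : l2 R[i] := MkL2 (shift_subproof xi).

Definition expi2pi (t : R) : R[i] := (cos (2 * pi * t) +i* sin (2 * pi * t))%C.

Lemma norm_expi2pi t : `|expi2pi t| = 1.
Proof. by rewrite normc_def /= cos2Dsin2 sqrtr1. Qed.

Lemma phase_subproof (t : R) (xi : l2 R[i]) :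
  (fun k => expi2pi (t * k%:R) * xi k) \in @l2_pred R R[i].
Proof.
have /l2_predP[M xiM] := l2_mem xi; apply/l2_predP; exists M => n.
by under eq_bigr do rewrite normrM norm_expi2pi mul1r.
Qed.

(* exp(2 pi i t N), where N e_k = k e_k. *)
Definition l2_phase (t : R) (xi : l2 R[i]) : l2 R[i] := MkL2 (phase_subproof t xi).

Lemma l2_delta_subproof K (x : K) (k : nat) :
  (fun j => if j == k then x else 0) \in @l2_pred R K.
Proof.
apply/l2_predP; exists (`|x| ^+ 2) => n; rewrite big_mkord.
under eq_bigr => j _ do rewrite (fun_if (fun z => `|z| ^+ 2)) normr0 expr0n /=.
rewrite -big_mkcond /=; case: (ltnP k n) => kn.
  by rewrite (big_pred1 (Ordinal kn)).
rewrite big1 ?exprn_ge0 // => j /eqP jk; have := ltn_ord j.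
by rewrite jk ltnNge kn.
Qed.

Definition l2_basis (k : nat) : l2 R[i] := MkL2 (l2_delta_subproof (1 : R[i]) k).

Lemma shift_basis k : l2_shift (l2_basis k) = l2_basis k.+1.
Proof. by apply: val_inj; apply/funext => -[|j]. Qed.

Lemma phase_basis t k :
  l2_phase t (l2_basis k) = expi2pi (t * k%:R) *: l2_basis k.
Proof.
apply: val_inj; apply/funext => j.
transitivity (expi2pi (t * j%:R) * (if j == k then 1 else 0)); first by [].
transitivity (expi2pi (t * k%:R) * (if j == k then 1 else 0)); last by [].
by case: eqP => [->//|_]; rewrite !mulr0.
Qed.

Lemma tens_total K (u : l2 K) :
  (fun n => \sum_(0 <= k < n) tens (u k) (l2_basis k)) @ \oo --> u.
Proof.
have coordE n j : (\sum_(0 <= k < n) tens (u k) (l2_basis k) : l2 K) j =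
    if (j < n)%N then u j else 0.
  elim: n => [|n IHn]; first by rewrite big_nil l2_0E.
  rewrite big_nat_recr // l2DE IHn ltnS [in RHS]leq_eqVlt.
  have -> : tens (u n) (l2_basis n) j = (if j == n then 1 else 0) *: u n by [].
  case: eqP => [->|_] /=; first by rewrite ltnn add0r scale1r.
  by rewrite scale0r addr0.
pose a : nat -> R[i] := fun k => inner (u k) (u k).
have acvg : series a @ \oo --> (l2_inner u u : R[i]) := @l2_self_cvg R K u.
apply/cvgrPdist_le => e e0.
move/cvgrPdist_le : acvg => /(_ (e ^+ 2) (exprn_gt0 _ e0)); apply: filterS => n.
rewrite ger0_norm; last first.
  rewrite subr_ge0 /series /= /a; under eq_bigr do rewrite inner_norm.
  exact: l2_partial_le.
move=> an; rewrite -(@ler_pXn2r _ 2) ?nnegrE ?(ltW e0) // l2_normE.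
apply: le_trans an; apply: l2_inner_le => N.
rewrite lerBrDr; apply: le_trans (l2_partial_le u (maxn N n)).
rewrite /series /= /a; under [X in _ + X]eq_bigr do rewrite inner_norm.
have tE j : (u - \sum_(0 <= k < n) tens (u k) (l2_basis k)) j =
    u j - (if (j < n)%N then u j else 0) by rewrite -coordE.
suff : \sum_(0 <= j < N) `|u j - (if (j < n)%N then u j else 0)| ^+ 2 +
    \sum_(0 <= j < n) `|u j| ^+ 2 <=
    \sum_(0 <= j < maxn N n) `|u j| ^+ 2.
  apply: le_trans; rewrite le_eqVlt; apply/orP; left; apply/eqP.
  congr (_ + _); apply: eq_bigr => j _; congr (`|_| ^+ 2); exact: tE.
have [Nn|nN] := leqP N n.
  rewrite big_nat_cond big1 ?add0r // => j /andP[/andP[_ jN] _].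
  by rewrite (leq_trans jN Nn) subrr normr0 expr0n.
rewrite [leLHS](_ : _ = \sum_(0 <= j < N) `|u j| ^+ 2) //.
rewrite (@big_cat_nat _ _ _ n 0 N) ?(ltnW nN) //=.
rewrite [in RHS](@big_cat_nat _ _ _ n 0 N) ?(ltnW nN) //=.
rewrite [X in X + _ + _]big_nat_cond big1 => [|j /andP[/andP[_ jn] _]]; last first.
  by rewrite jn subrr normr0 expr0n.
rewrite add0r addrC; congr (_ + _).
rewrite big_nat_cond [RHS]big_nat_cond; apply: eq_bigr => j.
by case/andP=> /andP[nj _] _; rewrite ltnNge nj /= subr0.
Qed.

Section Space.
Variable J : Type.

(* For js = [:: j_1; ...; j_s] this is (K (x) l2) (x) ... (x) l2, with one
   factor l2(N_0) for each j in js, in this order, and etensor js x xi is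
   x (x) xi j_1 (x) ... (x) xi j_s. *)
Fixpoint tensor_space (js : seq J) (K : hilbertType R) : hilbertType R :=
  if js is j :: js' then tensor_space js' (l2 K) else K.

Fixpoint etensor (js : seq J) (K : hilbertType R) (x : K)
    (xi : J -> l2 R[i]) : tensor_space js K :=
  if js is j :: js' then etensor js' (tens x (xi j)) xi else x.

Lemma inner_etensor (js : seq J) K (x y : K) (xi eta : J -> l2 R[i]) :
  inner (etensor js x xi) (etensor js y eta) =
  inner x y * \prod_(j <- js) inner (xi j) (eta j).
Proof.
elim: js K x y => [|j js IHjs] K x y /=; first by rewrite big_nil mulr1.
by rewrite IHjs inner_tens big_cons mulrA.
Qed.
End Space.
End Tensor.

(* Unital C*-algebras, the zero algebra included. The product is a field of the
   mixin because no class joining rings and normed modules can be declared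
   below numDomainType; the ring structure is recovered by the instance that
   follows. *)
HB.mixin Record CompleteNormedModule_isCstarAlgebra (R : realType) A
    of CompleteNormedModule R[i] A := {
  cstar_one : A;
  cstar_mul : A -> A -> A;
  star : A -> A;
  cstar_mulA : associative cstar_mul;
  cstar_mul1l : left_id cstar_one cstar_mul;
  cstar_mul1r : right_id cstar_one cstar_mul;
  cstar_mulDl : left_distributive cstar_mul +%R;
  cstar_mulDr : right_distributive cstar_mul +%R;
  cstar_scaleAl : forall (c : R[i]) x y,
    c *: cstar_mul x y = cstar_mul (c *: x) y;
  cstar_scaleAr : forall (c : R[i]) x y,
    c *: cstar_mul x y = cstar_mul x (c *: y);
  starK : involutive star;
  starD : {morph star : x y / x + y};
  starZ : forall (c : R[i]) x, star (c *: x) = c^* *: star x;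
  starM : forall x y, star (cstar_mul x y) = cstar_mul (star y) (star x);
  cstar_normM : forall x y, `|cstar_mul x y| <= `|x| * `|y|;
  cstar_norm : forall x, `|cstar_mul (star x) x| = `|x| ^+ 2 }.

#[short(type="cstarType")]
HB.structure Definition CstarAlgebra (R : realType) :=
  {A of CompleteNormedModule R[i] A & CompleteNormedModule_isCstarAlgebra R A}.

HB.instance Definition _ (R : realType) (A : cstarType R) :=
  GRing.Zmodule_isPzRing.Build (CstarAlgebra.sort A)
    (@cstar_mulA R A) (@cstar_mul1l R A) (@cstar_mul1r R A)
    (@cstar_mulDl R A) (@cstar_mulDr R A).

Section Cstar.
Variable R : realType.
Implicit Types A B : cstarType R.

Definition star_morphism A B (phi : A -> B) : Prop :=
  [/\ linear phi, phi 1 = 1, {morph phi : x y / x * y} &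
      {morph phi : x / star x}].

Definition cstar_subalgebra A (D : set A) : Prop :=
  [/\ D 1, forall (c : R[i]) x y, D x -> D y -> D (c *: x + y),
      forall x y, D x -> D y -> D (x * y), forall x, D x -> D (star x) &
      closed D].

Definition cstar_generated A (S : set A) : set A :=
  smallest (@cstar_subalgebra A) S.

(* Only the values of chi on D matter. *)
Definition character_on A (D : set A) (chi : A -> R[i]) : Prop :=
  [/\ chi 1 = 1,
      forall (c : R[i]) x y, D x -> D y -> chi (c *: x + y) = c * chi x + chi y &
      forall x y, D x -> D y -> chi (x * y) = chi x * chi y].

(* Meaningful for commuting normal families: the characters range over the
   spectrum of the commutative unital C*-algebra generated by the family. *)
Definition joint_spectrum A (I : Type) (a : I -> A) : set (I -> R[i]) :=
  [set l | exists2 chi, character_on (cstar_generated (range a)) chi &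
                        forall i, chi (a i) = l i].

Definition unitary A (x : A) : Prop := star x * x = 1 /\ x * star x = 1.

(* A, with the generators g, is the universal unital C*-algebra generated by G
   subject to the relations rel; the morphism phi is unique since g generates
   A. *)
Definition is_universal (G : Type) (rel : forall A, (G -> A) -> Prop)
    A (g : G -> A) : Prop :=
  [/\ rel A g, cstar_generated (range g) = setT &
      forall B (b : G -> B), rel B b ->
        exists2 phi : A -> B, star_morphism phi & forall x, phi (g x) = b x].

Record universal_cstar (G : Type) (rel : forall A, (G -> A) -> Prop) :=
  UniversalCstar {
    ucarrier :> cstarType R;
    ugen : G -> ucarrier;
    uniP : is_universal rel ugen }.

(* The pairs i < j, with indices starting from 0. *)
Definition pairs N := {p : 'I_N * 'I_N | (p.1 < p.2)%N}.

(* inl i is the generator s_i and inr p the generator u_p. *)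
Definition isometry_relations m n (X : set (pairs (m + n) -> R[i])) A
    (g : 'I_(m + n) + pairs (m + n) -> A) : Prop :=
  let s i := g (inl i) in
  let u p := g (inr p) in
  [/\ forall p : pairs (m + n), let: (i, j) := val p in
        star (s i) * s j = star (u p) * s j * star (s i),
      forall i, star (s i) * s i = 1,
      forall i : 'I_(m + n), (i < m)%N -> s i * star (s i) = 1,
      forall p, [/\ unitary (u p), forall i, u p * s i = s i * u p &
                    forall q, u p * u q = u q * u p] &
      joint_spectrum u `<=` X].

(* theta_ij, used for i < j only. *)
Definition theta N (Theta : pairs N -> R) (i j : 'I_N) : R :=
  oapp Theta 0 (insub (i, j)).

Definition torus_relations N (I : {set 'I_N}) (Theta : pairs N -> R) A
    (t : {i : 'I_N | i \in I} -> A) : Prop :=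
  (forall i, unitary (t i)) /\
  (forall i j : {i : 'I_N | i \in I}, (val i < val j)%N ->
     t i * t j = expi2pi (theta Theta (val i) (val j)) *: (t j * t i)).

Record representation A (H : hilbertType R) := Representation {
  rep_fun :> A -> H -> H;
  rep_linear : forall a, linear (rep_fun a);
  rep_continuous : forall a, continuous (rep_fun a);
  repP : forall (c : R[i]) a b v,
    rep_fun (c *: a + b) v = c *: rep_fun a v + rep_fun b v;
  repM : forall (a b : A) v, rep_fun (a * b) v = rep_fun a (rep_fun b v);
  rep_star : forall a v w, inner (rep_fun (star a) v) w = inner v (rep_fun a w) }.

Definition closed_subspace (H : hilbertType R) (W : set H) : Prop :=
  [/\ W 0, forall (c : R[i]) v w, W v -> W w -> W (c *: v + w) & closed W].

(* The zero representation is not irreducible. As *-morphisms are not asked to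
   be unital in representation, note that irreducibility implies pi 1 = 1. *)
Definition irreducible A (H : hilbertType R) (pi : representation A H) : Prop :=
  (exists a v, pi a v <> 0) /\
  forall W, closed_subspace W -> (forall a v, W v -> W (pi a v)) ->
    W = [set 0] \/ W = setT.

Definition unitarily_equivalent A (H1 H2 : hilbertType R)
    (pi1 : representation A H1) (pi2 : representation A H2) : Prop :=
  exists U : H1 -> H2,
    [/\ linear U, bijective U, forall v w, inner (U v) (U w) = inner v w &
        forall a v, U (pi1 a v) = pi2 a (U v)].

Definition separable (T : topologicalType) : Prop :=
  exists2 D : set T, countable D & dense D.

Definition torus_point N (Theta : pairs N -> R) : pairs N -> R[i] :=
  fun p => expi2pi (Theta p).

Definition Sigma m n (I : {set 'I_(m + n)}) : Prop :=
  forall i : 'I_(m + n), (i < m)%N -> i \in I.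

Definition lambda N (Theta : pairs N -> R) (i j : 'I_N) : l2 R[i] -> l2 R[i] :=
  if (i < j)%N then l2_phase (theta Theta i j) else l2_phase (- theta Theta j i).

(* w is pi^Theta_(I, rho). The operators are given on elementary tensors, whose
   span is dense: a tensor product of bounded operators is the bounded operator
   (T (x) D_1 (x) ...)(x (x) xi_1 (x) ...) = T x (x) D_1 xi_1 (x) ...
   The sequence enum (~: I) lists the complement of I in increasing order. *)
Definition is_pi m n (A : cstarType R) (g : 'I_(m + n) + pairs (m + n) -> A)
    (Theta : pairs (m + n) -> R) (I : {set 'I_(m + n)})
    (T : cstarType R) (t : {i : 'I_(m + n) | i \in I} -> T)
    (K : hilbertType R) (rho : representation T K)
    (w : representation A (tensor_space (enum (~: I)) K)) : Prop :=
  let s i := g (inl i) in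
  let u p := g (inr p) in
  [/\ forall j : 'I_(m + n), j \notin I -> forall x xi,
        w (s j) (etensor (enum (~: I)) x xi) =
        etensor (enum (~: I)) x (fun k =>
          if k == j then l2_shift (xi k)
          else if (j < k)%N then l2_phase (theta Theta j k) (xi k)
          else xi k),
      forall (i : {i : 'I_(m + n) | i \in I}) x xi,
        w (s (val i)) (etensor (enum (~: I)) x xi) =
        etensor (enum (~: I)) (rho (t i) x)
          (fun j => lambda Theta (val i) j (xi j)) &
      forall p v, w (u p) v = expi2pi (Theta p) *: v].
End Cstar.

Arguments ugen {R G rel} u x.
Arguments torus_relations {R N} I Theta A t.
Arguments isometry_relations {R m n} X A g.

(* Main.v *)
Require Import Defs.
From HB Require Import structures.
From mathcomp Require Import all_boot all_order all_algebra.
From mathcomp Require Import complex.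
From mathcomp Require Import all_classical all_reals all_analysis.
From mathcomp Require Import ring lra.
Set Implicit Arguments.
Unset Strict Implicit.
Unset Printing Implicit Defensive.
Import Order.TTheory GRing.Theory Num.Theory.
Import numFieldNormedType.Exports.
Local Open Scope classical_set_scope.
Local Open Scope ring_scope.

(** Every irreducible representation sends the central unitaries [u_ij] to
    scalars, by Schur's lemma ([commutant_scalar]), and these scalars are the
    values of a character, so they form a point [Theta] of [X]
    ([rep_angles_mem]). The relations then say that the isometries [s_i] commute
    with each other and with each other's adjoints up to scalars of modulus 1
    ([isometries_twist]). Hence the projections [s_i^n s_i^{*n}] commute with all
    [s_j] for [j] other than [i], and the subspace on which [s_i] is unitary is
    invariant under the whole representation: by irreducibility each [s_i] is
    either unitary or pure, that is, without unitary part ([rep_pure]). Let [I]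
    be the set of the indices of the unitary ones.

    A pure isometry is a multiple of the unilateral shift, by the Wold
    decomposition. As the other isometries commute with it up to scalars, they
    become tensor products with the diagonal phases of the theorem, so the pure
    isometries can be split off one after the other ([wold_step],
    [wold_decomposition]). What remains on the first tensor factor is the joint
    kernel [K] of the [s_j^*] with [j] outside [I]. There the [s_i] with [i] in
    [I] satisfy the relations of the noncommutative torus, and its universal
    property gives [rho].

    Conversely, the operators of the theorem satisfy the defining relations
    ([induced_relations]), so the universal property gives the representation
    induced from [rho]. A closed subspace that is invariant under it has the form
    [W0 (x) l2(N_0) (x) ... (x) l2(N_0)] ([invariant_tensor_sub]), because the
    vacuum projections of the legs and the backward shifts isolate the
    coefficients of a tensor. Therefore it is trivial if [rho] is irreducible
    ([is_pi_irreducible]); and the same correspondence shows that the [rho] found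
    above is irreducible ([torus_rep_irreducible]).

    Using the universal properties requires the C*-algebra of the bounded
    operators on a Hilbert space, which is built first. Two facts about it rest
    on one square root, obtained by an iteration that converges in norm
    ([sqrt_one_sub]): representations are contractive ([rep_contractive]), which
    is what lets an identity or an invariance pass from the generators to the
    C*-algebra that they generate ([generated_ind]), and an operator in the
    commutant has an absolute value in the commutant, from which Schur's lemma
    follows ([commutant_sign]). *)

(** * Limits and inner products in Hilbert spaces *)

Lemma ge0_RRe (R : realType) (z : R[i]) : 0 <= z -> ((complex.Re z)%:C)%C = z.
Proof. by move=> z0; apply: RRe_real; exact: ger0_real. Qed.

Section Normed.
Variable R : realType.
Implicit Types V W : normedModType R[i].

Lemma cauchy_seq_cvg (V : completeNormedModType R[i]) (u : nat -> V) :
  (forall e : R[i], 0 < e -> exists N, forall n k, (N <= n)%N -> (N <= k)%N ->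
     `|u n - u k| < e) ->
  exists l : V, u @ \oo --> l.
Proof.
move=> uc; suff /cvg_ex[l ul] : cvg (u @ \oo) by exists l.
apply: cauchy_cvg; apply/cauchy_ballP => e e0.
have [N uN] := uc e e0.
exists ([set u n | n in [set n | (N <= n)%N]],
        [set u n | n in [set n | (N <= n)%N]]) => /=.
  by split; exists N => // n /= Nn; exists n.
move=> [_ _] /= [[n Nn <-] [k Nk <-]]; rewrite -ball_normE /=; exact: uN.
Qed.

Lemma lipschitz_continuous V W (f : V -> W) (M : R[i]) :
  (forall x y, `|f x - f y| <= M * `|x - y|) -> continuous f.
Proof.
move=> fM x; apply/cvgrPdist_lt => e e0.
have M0 : 0 < `|M| + 1 by rewrite ltr_pwDr.
have d0 : 0 < e / (`|M| + 1) by rewrite divr_gt0.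
near=> y; apply: le_lt_trans (fM x y) _.
have M1 : M * `|x - y| <= (`|M| + 1) * `|x - y|.
  have := fM x y; have [->|xy] := eqVneq `|x - y| 0; first by rewrite !mulr0.
  have xy0 : 0 < `|x - y| by rewrite lt_def xy normr_ge0.
  move=> /(le_trans (normr_ge0 _)); rewrite pmulr_lge0 // => M00.
  by rewrite ler_pM2r // ger0_norm // lerDl.
(* what is left is that [y] is near [x] *)
by apply: le_lt_trans M1 _; rewrite mulrC -ltr_pdivlMr.
Unshelve. all: by end_near. Qed.

Lemma closed_cvg_seq V (S : set V) (u : nat -> V) (l : V) : closed S ->
  (forall n, S (u n)) -> u @ \oo --> l -> S l.
Proof.
by move=> Sc Su ul; apply: (@closed_cvg _ _ \oo _ u S Sc _ l ul); exact: nearW.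
Qed.

End Normed.

Section HilbertBasics.
Variable R : realType.
Variable H : hilbertType R.
Implicit Types x y z : H.

Definition innerDl := @ipDl R H _ (@inner_scalar R H).
Definition inner0l := @ip0l R H _ (@inner_scalar R H).
Definition innerZl := @ipZl R H _ (@inner_scalar R H).
Definition innerNl := @ipNl R H _ (@inner_scalar R H).
Definition innerDr := @ipDr R H _ (@inner_scalar R H) (@inner_conj R H).
Definition inner0r := @ip0r R H _ (@inner_scalar R H) (@inner_conj R H).
Definition innerZr := @ipZr R H _ (@inner_scalar R H) (@inner_conj R H).
Definition innerNr := @ipNr R H _ (@inner_scalar R H) (@inner_conj R H).
Definition innerE := (innerDl, innerDr, innerZl, innerZr, innerNl, innerNr,
  inner0l, inner0r).

Lemma inner_CauchySchwarz x y : `|inner x y| <= `|x| * `|y|.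
Proof.
rewrite -(@ler_pXn2r _ 2) ?nnegrE ?mulr_ge0 // exprMn -(inner_norm x) -(inner_norm y).
exact: (ip_CauchySchwarz (@inner_scalar R H) (@inner_conj R H) (@inner_ge0 R H)
  (@inner_eq0 R H)).
Qed.

Lemma inner_ext x y : (forall z, inner x z = inner y z) -> x = y.
Proof.
move=> xy; apply/eqP; rewrite -subr_eq0; apply/eqP/inner_eq0.
by rewrite innerDl innerNl xy subrr.
Qed.

Lemma inner_extr x y : (forall z, inner z x = inner z y) -> x = y.
Proof.
by move=> xy; apply: inner_ext => z; rewrite inner_conj xy -inner_conj.
Qed.

Lemma inner_continuousl y : continuous ((fun x => inner x y) : H -> R[i]).
Proof.
apply: (@lipschitz_continuous R _ _ _ `|y|) => x z.
by rewrite -innerNl -innerDl mulrC; exact: inner_CauchySchwarz.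
Qed.

Lemma inner_continuousr x : continuous ((fun y => inner x y) : H -> R[i]).
Proof.
apply: (@lipschitz_continuous R _ _ _ `|x|) => y z.
by rewrite -innerNr -innerDr; exact: inner_CauchySchwarz.
Qed.

Lemma norm_le_sqr x y : inner x x <= inner y y -> `|x| <= `|y|.
Proof. by rewrite !inner_norm ler_pXn2r ?nnegrE. Qed.

End HilbertBasics.

Lemma norm_eq_sqr (R : realType) (H1 H2 : hilbertType R) (x : H1) (y : H2) :
  inner x x = inner y y -> `|x| = `|y|.
Proof. by rewrite !inner_norm => /eqP; rewrite eqrXn2 // => /eqP. Qed.

Lemma closed_equalizer (R : realType) (V W : normedModType R[i]) (f g : V -> W) :
  continuous f -> continuous g -> closed [set x | f x = g x].
Proof.
move=> fc gc.
have -> : [set x | f x = g x] = (fun x => f x - g x) @^-1` [set 0].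
  apply/seteqP; split => x /=; first by move=> ->; rewrite subrr.
  by move=> /eqP; rewrite subr_eq0 => /eqP.
apply: closed_comp => [x _|]; last first.
  by apply: accessible_closed_set1; exact: hausdorff_accessible.
by apply: cvgB; [exact: fc|exact: gc].
Qed.

(** * The C*-algebra of bounded operators on a Hilbert space *)

Section BoundedOperators.
Variables (R : realType) (H : hilbertType R).
Local Notation C := R[i].
Implicit Types (x y : H) (f g : H -> H).

Definition adjoint_of f g := forall x y, inner (f x) y = inner x (g y).

(** The adjoint is asked for together with the bound: all the operators that
    occur below come with an explicit adjoint, and the completeness of the space
    of these operators then rests on no representation theorem for functionals. *)
Definition adjointable f :=
  (exists g, adjoint_of f g) /\ (exists M : R[i], forall x, `|f x| <= M * `|x|).

Definition bop_pred : {pred H -> H} := fun f => `[< adjointable f >].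

Lemma bop_predP f : reflect (adjointable f) (f \in bop_pred).
Proof. exact: asboolP. Qed.

Lemma bop_submod : submod_closed bop_pred.
Proof.
split.
  apply/bop_predP; split; first by exists 0 => x y; rewrite inner0l inner0r.
  by exists 0 => x; rewrite normr0 mul0r.
move=> c f g /bop_predP[[f' ff'] [M fM]] /bop_predP[[g' gg'] [N gN]].
apply/bop_predP; split.
  exists (fun y => c^* *: f' y + g' y) => x y.
  transitivity (inner (c *: f x + g x) y); first by [].
  by rewrite !innerE ff' gg' conjCK.
exists (`|c| * M + N) => x; apply: le_trans (ler_normD _ _) _.
by rewrite normrZ mulrDl lerD // -mulrA ler_wpM2l.
Qed.

HB.instance Definition _ :=
  GRing.isSubmodClosed.Build R[i] (H -> H) bop_pred bop_submod.

Record bop : Type := MkBop { bop_fun :> H -> H; bop_mem : bop_fun \in bop_pred }.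
HB.instance Definition _ := [isSub for bop_fun].
HB.instance Definition _ := [Choice of bop by <:].
HB.instance Definition _ := [SubChoice_isSubLmodule of bop by <:].

Implicit Types S T U : bop.

Lemma bopP S T : (forall x, S x = T x) -> S = T.
Proof. by move=> ST; apply: val_inj; apply/funext. Qed.

Lemma bopDE S T x : (S + T) x = S x + T x. Proof. by []. Qed.
Lemma bopZE (c : C) T x : (c *: T) x = c *: T x. Proof. by []. Qed.
Lemma bopNE T x : (- T) x = - T x. Proof. by []. Qed.
Lemma bop0E x : (0 : bop) x = 0. Proof. by []. Qed.

Lemma bop_adjointable T : exists g, adjoint_of T g.
Proof. by have /bop_predP[] := bop_mem T. Qed.

Definition adj T : H -> H := sval (cid (bop_adjointable T)).

Lemma adjP T : adjoint_of T (adj T).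
Proof. exact: svalP (cid (bop_adjointable T)). Qed.

Lemma bop_linear T : linear T.
Proof.
move=> c x y; apply: inner_ext => z.
by rewrite adjP !innerE !adjP.
Qed.

Lemma bopZr T c x : T (c *: x) = c *: T x.
Proof.
by apply: inner_ext => z; rewrite adjP !innerZl adjP.
Qed.

Lemma bopDr T x y : T (x + y) = T x + T y.
Proof. by have := bop_linear T 1 x y; rewrite !scale1r. Qed.

Lemma bop0r T : T 0 = 0.
Proof. by have := bopZr T 0 0; rewrite !scale0r. Qed.

Lemma bopNr T x : T (- x) = - T x.
Proof. by rewrite -scaleN1r bopZr scaleN1r. Qed.

(** Norms are elements of [R[i]], where infima are not available, so the
    operator norm is an infimum of real bounds that is then embedded. *)
Definition opbounds T : set R :=
  [set r | 0 <= r /\ forall x, `|T x| <= r%:C%C * `|x|].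

Definition opnorm T : R[i] := (inf (opbounds T))%:C%C.

Lemma opbounds_neq0 T : opbounds T !=set0.
Proof.
have /bop_predP[_ [M TM]] := bop_mem T.
exists (complex.Re `|M|); split=> [|x]; first by rewrite -ler0c ge0_RRe.
rewrite ge0_RRe //; have := TM x; have [->|x0] := eqVneq x 0.
  by rewrite bop0r !normr0 !mulr0.
have nx : 0 < `|x| by rewrite normr_gt0.
move=> Mx; apply: (le_trans Mx); rewrite ler_pM2r //.
by have := le_trans (normr_ge0 _) Mx; rewrite pmulr_lge0 // => /ger0_norm->.
Qed.

Lemma opnorm_ge0 T : 0 <= opnorm T.
Proof.
rewrite ler0c; apply: lb_le_inf; first exact: opbounds_neq0.
by move=> r [].
Qed.

Lemma opnormP T x : `|T x| <= opnorm T * `|x|.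
Proof.
have [->|x0] := eqVneq x 0; first by rewrite bop0r !normr0 mulr0.
have nx : 0 < `|x| by rewrite normr_gt0.
rewrite -ler_pdivrMr // -[leLHS]ge0_RRe ?divr_ge0 // lecR.
apply: lb_le_inf; first exact: opbounds_neq0.
move=> r [r0 rT]; rewrite -lecR ge0_RRe ?divr_ge0 // ler_pdivrMr //.
Qed.

Lemma opnorm_le T (M : R[i]) : 0 <= M -> (forall x, `|T x| <= M * `|x|) ->
  opnorm T <= M.
Proof.
move=> M0 TM; rewrite -[leRHS]ge0_RRe // lecR; apply: ge_inf.
  by exists 0 => r [].
by split=> [|x]; rewrite -?ler0c ge0_RRe.
Qed.

Lemma opnormD S T : opnorm (S + T) <= opnorm S + opnorm T.
Proof.
apply: opnorm_le => [|x]; first by rewrite addr_ge0 ?opnorm_ge0.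
rewrite bopDE mulrDl; apply: le_trans (ler_normD _ _) _.
by rewrite lerD ?opnormP.
Qed.

Lemma opnormZ (c : C) T : opnorm (c *: T) = `|c| * opnorm T.
Proof.
have le (d : C) S : opnorm (d *: S) <= `|d| * opnorm S.
  apply: opnorm_le => [|x]; first by rewrite mulr_ge0 ?opnorm_ge0.
  by rewrite bopZE normrZ -mulrA ler_wpM2l ?opnormP.
apply/eqP; rewrite eq_le le /=; have [->|c0] := eqVneq c 0.
  by rewrite normr0 mul0r opnorm_ge0.
have nc : 0 < `|c| by rewrite normr_gt0.
rewrite mulrC -ler_pdivlMr // mulrC -normfV; apply: le_trans (le _ _).
by rewrite scalerA mulVf // scale1r.
Qed.

Lemma opnorm_eq0 T : opnorm T = 0 -> T = 0.
Proof.
move=> T0; apply: bopP => x; apply/eqP; rewrite -normr_le0.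
by have := opnormP T x; rewrite T0 mul0r.
Qed.

HB.instance Definition _ := Lmodule_isNormed.Build R[i] bop
  opnormD opnormZ opnorm_eq0.

Lemma bop_normP T x : `|T x| <= `|T| * `|x|. Proof. exact: opnormP. Qed.

Lemma bop_norm_le T (M : R[i]) : 0 <= M -> (forall x, `|T x| <= M * `|x|) ->
  `|T| <= M.
Proof. exact: opnorm_le. Qed.

Lemma adj_adjoint T : adjoint_of (adj T) T.
Proof. by move=> x y; rewrite inner_conj -adjP -inner_conj. Qed.

Lemma adj_bound T x : `|adj T x| <= `|T| * `|x|.
Proof.
have [->|x0] := eqVneq `|adj T x| 0; first by rewrite mulr_ge0.
have nx : 0 < `|adj T x| by rewrite lt_def x0 normr_ge0.
rewrite -(ler_pM2r nx) -expr2 -inner_norm adj_adjoint.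
rewrite -[leLHS]ger0_norm; last by rewrite -adj_adjoint inner_ge0.
apply: le_trans (inner_CauchySchwarz _ _) _; rewrite mulrC mulrAC.
by rewrite ler_wpM2r // bop_normP.
Qed.

Lemma bop_star_subproof T : adj T \in bop_pred.
Proof.
apply/bop_predP; split; first by exists T; exact: adj_adjoint.
by exists `|T| => x; exact: adj_bound.
Qed.

Lemma bop_one_subproof : (id : H -> H) \in bop_pred.
Proof.
by apply/bop_predP; split; [exists id|exists 1 => x; rewrite mul1r].
Qed.

Lemma bop_mul_subproof S T : S \o T \in bop_pred.
Proof.
apply/bop_predP; split.
  by exists (adj T \o adj S) => x y; rewrite /= !adjP.
exists (`|S| * `|T|) => x /=; apply: le_trans (bop_normP _ _) _.
by rewrite -mulrA ler_wpM2l // bop_normP.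
Qed.

Definition bop_star T : bop := MkBop (bop_star_subproof T).
Definition bop_one : bop := MkBop bop_one_subproof.
Definition bop_mul S T : bop := MkBop (bop_mul_subproof S T).

(** A Cauchy filter of operators converges at each vector, and so do the
    adjoints; the two pointwise limits are adjoint to each other. *)
Lemma bop_complete (F : set_system bop) : ProperFilter F -> cauchy F -> cvg F.
Proof.
move=> FF /cauchy_ballP Fc.
have Fc' (e : C) : 0 < e -> exists2 A, F A & forall S T, A S -> A T ->
    `|S - T| < e.
  move=> e0; have e20 : 0 < e / 2 by rewrite divr_gt0.
  have [[A B] /= [FA FB] AB] := Fc _ e20.
  exists (A `&` B); first exact: filterI.
  move=> S T [AS BS] [AT BT]; rewrite (splitr e).
  have := AB (S, T) (conj AS BT); have := AB (T, T) (conj AT BT).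
  rewrite -!ball_normE /= => _ ST; apply: lt_le_trans ST _.
  by rewrite lerDl ltW.
have cv_cvg x : cvg ((fun T : bop => T x : H) @ F).
  apply: cauchy_cvg; apply/cauchy_ballP => e e0.
  have d0 : 0 < e / (`|x| + 1) by rewrite divr_gt0 // ltr_wpDl.
  have [A FA AA] := Fc' _ d0.
  exists ((fun T : bop => T x) @` A, (fun T : bop => T x) @` A) => /=.
    by split; apply: (@filterS _ F _ _ _ _ FA) => z Az; exists z.
  move=> [_ _] /= [[S AS <-] [T AT <-]]; rewrite -ball_normE /=.
  apply: le_lt_trans (bop_normP (S - T) x) _.
  have [->|x0] := eqVneq `|x| 0; first by rewrite mulr0.
  apply: le_lt_trans (_ : _ <= `|S - T| * (`|x| + 1)) _.
    by rewrite ler_wpM2l // lerDl.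
  by rewrite -ltr_pdivlMr ?AA // ltr_wpDl.
have adj_cvg x : cvg ((fun T : bop => adj T x : H) @ F).
  apply: cauchy_cvg; apply/cauchy_ballP => e e0.
  have d0 : 0 < e / (`|x| + 1) by rewrite divr_gt0 // ltr_wpDl.
  have [A FA AA] := Fc' _ d0.
  exists ((fun T : bop => adj T x) @` A, (fun T : bop => adj T x) @` A) => /=.
    by split; apply: (@filterS _ F _ _ _ _ FA) => z Az; exists z.
  move=> [_ _] /= [[S AS <-] [T AT <-]]; rewrite -ball_normE /=.
  have -> : adj S x - adj T x = adj (S - T) x.
    apply: inner_ext => z.
    by rewrite adj_adjoint bopDE bopNE !innerE !adj_adjoint.
  apply: le_lt_trans (adj_bound (S - T) x) _.
  apply: le_lt_trans (_ : _ <= `|S - T| * (`|x| + 1)) _.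
    by rewrite ler_wpM2l // lerDl.
  by rewrite -ltr_pdivlMr ?AA // ltr_wpDl.
pose f x := lim ((fun T : bop => T x : H) @ F).
pose g x := lim ((fun T : bop => adj T x : H) @ F).
have fg : adjoint_of f g.
  move=> x y; have h1 : (inner ((T : bop) x) y : C) @[T --> F] --> (inner (f x) y : C).
    by apply: (@continuous_cvg _ _ _ F _ _ (inner^~ y : H -> C));
      [exact: inner_continuousl|exact: cv_cvg].
  have h2 : (inner x (adj (T : bop) y) : C) @[T --> F] --> (inner x (g y) : C).
    by apply: (@continuous_cvg _ _ _ F _ _ (inner x : H -> C));
      [exact: inner_continuousr|exact: adj_cvg].
  have hE : (fun T : bop => inner (T x) y : C) = (fun T : bop => inner x (adj T y)).
    by apply/funext => T; exact: adjP.
  by rewrite hE in h1; apply: (cvg_unique _ h1 h2).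
have key (e : C) : 0 < e -> exists2 A, F A & forall S x, A S ->
    `|S x - f x| <= e * `|x|.
  move=> e0; have [A FA AA] := Fc' e e0; exists A => // S x AS.
  apply: (@cvgC_le _ _ F _ (fun T : bop => `|S x - T x|)).
    by apply: cvg_norm; apply: cvgB; [exact: cvg_cst|exact: cv_cvg].
  apply: filterS FA => T AT; apply: le_trans (bop_normP (S - T) x) _.
  by rewrite ler_wpM2r // ltW // AA.
have fP : f \in bop_pred.
  have [A FA Ag] := key 1 ltr01; have [S AS] := filter_ex FA.
  apply/bop_predP; split; first by exists g.
  exists (`|S| + 1) => x; rewrite mulrDl.
  have -> : f x = S x - (S x - f x) by rewrite opprB addrC subrK.
  apply: le_trans (ler_normB _ _) _.
  by rewrite lerD ?bop_normP ?Ag.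
apply/cvg_ex; exists (MkBop fP); apply/cvgrPdist_le => e e0.
have [A FA Ag] := key e e0; apply: filterS FA => S AS; rewrite distrC.
apply: bop_norm_le; first exact: ltW.
by move=> x; exact: (Ag S x AS).
Qed.

HB.instance Definition _ := Uniform_isComplete.Build bop bop_complete.

Let mulA : associative bop_mul. Proof. by move=> S T U; apply: bopP. Qed.
Let mul1l : left_id bop_one bop_mul. Proof. by move=> T; apply: bopP. Qed.
Let mul1r : right_id bop_one bop_mul. Proof. by move=> T; apply: bopP. Qed.
Let mulDl : left_distributive bop_mul +%R.
Proof. by move=> S T U; apply: bopP. Qed.
Let mulDr : right_distributive bop_mul +%R.
Proof. by move=> S T U; apply: bopP => x; rewrite bopDE /= -bopDr. Qed.
Let scaleAl (c : R[i]) S T : c *: bop_mul S T = bop_mul (c *: S) T.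
Proof. by apply: bopP. Qed.
Let scaleAr (c : R[i]) S T : c *: bop_mul S T = bop_mul S (c *: T).
Proof. by apply: bopP => x; rewrite bopZE /= -bopZr. Qed.

Lemma bop_starP T x y : inner (T x) y = inner x (bop_star T y).
Proof. exact: adjP. Qed.

Lemma bop_starPr T x y : inner (bop_star T x) y = inner x (T y).
Proof. exact: adj_adjoint. Qed.

Let starK : involutive bop_star.
Proof.
by move=> T; apply: bopP => x; apply: inner_ext => y; rewrite bop_starPr -bop_starP.
Qed.
Let starD : {morph bop_star : S T / S + T}.
Proof.
move=> S T; apply: bopP => x; apply: inner_ext => y.
by rewrite bop_starPr !bopDE !innerE !bop_starPr.
Qed.
Let starZ (c : R[i]) T : bop_star (c *: T) = c^* *: bop_star T.
Proof.
apply: bopP => x; apply: inner_ext => y.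
by rewrite bop_starPr !bopZE !innerE bop_starPr.
Qed.
Let starM S T : bop_star (bop_mul S T) = bop_mul (bop_star T) (bop_star S).
Proof.
apply: bopP => x; apply: inner_ext => y.
by rewrite bop_starPr /= !bop_starPr.
Qed.
Let normM S T : `|bop_mul S T| <= `|S| * `|T|.
Proof.
apply: bop_norm_le => [|x]; first by rewrite mulr_ge0.
apply: le_trans (bop_normP S (T x)) _.
by rewrite -mulrA ler_wpM2l // bop_normP.
Qed.
(* Both sides are compared through [|T x| ^ 2 = <x, T^* T x>]. *)
Let norm_star T : `|bop_mul (bop_star T) T| = `|T| ^+ 2.
Proof.
have sT : `|bop_star T| <= `|T|.
  by apply: bop_norm_le => // x; exact: adj_bound.
apply/eqP; rewrite eq_le; apply/andP; split.
  by apply: le_trans (normM _ _) _; rewrite expr2 ler_wpM2r.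
rewrite -[X in _ <= X]sqrtCK ler_pXn2r ?nnegrE ?sqrtC_ge0 //.
apply: bop_norm_le => [|x]; first by rewrite sqrtC_ge0.
rewrite -(@ler_pXn2r _ 2) ?nnegrE ?mulr_ge0 ?sqrtC_ge0 // exprMn sqrtCK.
rewrite -(inner_norm (T x)) bop_starP -[leLHS]ger0_norm; last first.
  by rewrite -bop_starP inner_ge0.
apply: le_trans (inner_CauchySchwarz _ _) _; rewrite [leRHS]mulrC expr2 -mulrA.
rewrite ler_wpM2l // mulrC.
exact: (bop_normP (bop_mul (bop_star T) T)).
Qed.

HB.instance Definition _ := CompleteNormedModule_isCstarAlgebra.Build R bop
  mulA mul1l mul1r mulDl mulDr scaleAl scaleAr starK starD starZ starM
  normM norm_star.

HB.instance Definition _ := GRing.PzRing.copy bop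
  (CstarAlgebra.sort (bop : cstarType R)).
End BoundedOperators.

Arguments star {R s} _ : simpl never.

Section BopTheory.
Variables (R : realType) (H : hilbertType R).
Implicit Types S T : bop H.
Lemma bopME S T x : (S * T) x = S (T x). Proof. by []. Qed.
Lemma bop1E x : (1 : bop H) x = x. Proof. by []. Qed.
Lemma starE T x y : inner (star T x) y = inner x (T y).
Proof. exact: bop_starPr. Qed.
Lemma starEr T x y : inner x (star T y) = inner (T x) y.
Proof. by rewrite bop_starP. Qed.

Lemma star_unique S (g : H -> H) :
  (forall x y, inner (S x) y = inner x (g y)) -> forall y, star S y = g y.
Proof. by move=> Sg y; apply: inner_extr => x; rewrite starEr Sg. Qed.

End BopTheory.

(** * Square roots in C*-algebras and contractivity of representations *)

Section CstarTheory.
Variables (R : realType) (A : cstarType R).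
Implicit Types x y z : A.

Lemma cstarZl (c : R[i]) x y : (c *: x) * y = c *: (x * y).
Proof. exact/esym/cstar_scaleAl. Qed.
Lemma cstarZr (c : R[i]) x y : x * (c *: y) = c *: (x * y).
Proof. exact/esym/cstar_scaleAr. Qed.
Lemma cstar_normMr x y : `|x * y| <= `|x| * `|y|.
Proof. exact: cstar_normM. Qed.
Lemma starMr x y : star (x * y) = star y * star x.
Proof. exact: starM. Qed.
Lemma star1 : star 1 = 1 :> A.
Proof. by rewrite -[LHS]mulr1 -{2}(starK 1) -starMr mulr1 starK. Qed.
Lemma star0 : star 0 = 0 :> A.
Proof. by have := starZ 0 (0 : A); rewrite !scale0r rmorph0 scale0r. Qed.
Lemma starN x : star (- x) = - star x.
Proof. by rewrite -scaleN1r starZ rmorphN1 scaleN1r. Qed.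
Lemma starB x y : star (x - y) = star x - star y.
Proof. by rewrite starD starN. Qed.

(* [|y| ^ 2 = |y^* y| <= |y^*| |y|], for [y = x] and for [y = x^*]. *)
Lemma norm_star x : `|star x| = `|x|.
Proof.
have le y : `|y| <= `|star y|.
  have [->|y0] := eqVneq `|y| 0; first exact: normr_ge0.
  have ny : 0 < `|y| by rewrite lt_def y0 normr_ge0.
  by rewrite -(ler_pM2r ny) -expr2 -cstar_norm cstar_normMr.
by apply/eqP; rewrite eq_le le andbT -{2}(starK x) le.
Qed.

Lemma star_continuous : continuous (star : A -> A).
Proof.
apply: (@lipschitz_continuous R _ _ _ 1) => x y.
by rewrite -starB norm_star mul1r.
Qed.

Lemma mulr_continuousl z : continuous ( *%R z : A -> A).
Proof.
apply: (@lipschitz_continuous R _ _ _ `|z|) => x y.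
by rewrite -mulrBr cstar_normMr.
Qed.

Lemma mulr_continuousr z : continuous ( *%R^~ z : A -> A).
Proof.
apply: (@lipschitz_continuous R _ _ _ `|z|) => x y.
by rewrite -mulrBl mulrC cstar_normMr.
Qed.
End CstarTheory.

Section SquareRoot.
Variables (R : realType) (A : cstarType R) (x : A).
Hypotheses (sx : star x = x) (nx : `|x| <= 1).

Fixpoint sqrt_iter n : A :=
  if n is n'.+1 then (2^-1 : R[i]) *: (x + sqrt_iter n' * sqrt_iter n') else 0.

(* The iteration for the number 1, which dominates the one for [x]. *)
Fixpoint sqrt_bound n : R :=
  if n is n'.+1 then 2^-1 * (1 + sqrt_bound n' ^+ 2) else 0.

Local Notation B := sqrt_iter.
Local Notation be := sqrt_bound.

Lemma sqrt_bound_itv n : 0 <= be n <= 1.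
Proof.
elim: n => [|n /andP[b0 b1]] /=; first by rewrite lexx ler01.
have := sqr_ge0 (be n); have : be n ^+ 2 <= 1 by rewrite expr_le1.
by move=> h1 h0; apply/andP; split; lra.
Qed.

Lemma norm_half (y : A) : `|(2^-1 : R[i]) *: y| = 2^-1 * `|y|.
Proof. by rewrite normrZ ger0_norm // invr_ge0. Qed.

Lemma halfC (r : R) : ((2^-1 * r)%:C)%C = 2^-1 * (r%:C)%C :> R[i].
Proof. by rewrite rmorphM /= fmorphV /= rmorph_nat. Qed.

Lemma norm_sqrt_iter n : `|B n| <= (be n)%:C%C.
Proof.
elim: n => [|n IHn] /=; first by rewrite normr0.
rewrite norm_half halfC ler_wpM2l ?invr_ge0 //.
apply: le_trans (ler_normD _ _) _; rewrite rmorphD rmorph1 lerD //.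
apply: le_trans (cstar_normMr _ _) _.
by rewrite rmorphXn /= expr2 ler_pM.
Qed.

Lemma sqrt_iter_step n : `|B n.+1 - B n| <= (be n.+1 - be n)%:C%C.
Proof.
elim: n => [|n IHn].
  rewrite /= !mul0r addr0 !subr0 norm_half expr0n addr0 halfC.
  by rewrite ler_wpM2l ?invr_ge0.
have -> : B n.+2 - B n.+1 =
    (2^-1 : R[i]) *: ((B n.+1 - B n) * B n.+1 + B n * (B n.+1 - B n)).
  transitivity ((2^-1 : R[i]) *: (x + B n.+1 * B n.+1) -
    (2^-1 : R[i]) *: (x + B n * B n)) => //.
  move: (B n.+1) (B n) => b1 b0; rewrite -scalerBr; congr (_ *: _).
  rewrite [in RHS]mulrBr [in RHS]mulrBl opprD addrACA subrr add0r.
  by rewrite [RHS]addrA subrK.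
have -> : be n.+2 - be n.+1 =
    2^-1 * ((be n.+1 - be n) * be n.+1 + be n * (be n.+1 - be n)).
  transitivity (2^-1 * (1 + be n.+1 ^+ 2) - 2^-1 * (1 + be n ^+ 2)) => //.
  by move: (be n.+1) (be n) => b1 b0; ring.
rewrite norm_half halfC ler_wpM2l ?invr_ge0 //.
apply: le_trans (ler_normD _ _) _.
apply: le_trans (_ : _ <= ((be n.+1 - be n)%:C)%C * ((be n.+1)%:C)%C +
    ((be n)%:C)%C * ((be n.+1 - be n)%:C)%C) _; last by rewrite -!rmorphM -rmorphD.
apply: lerD.
  apply: le_trans (cstar_normMr _ _) _.
  by rewrite ler_pM // norm_sqrt_iter.
apply: le_trans (cstar_normMr _ _) _.
by rewrite ler_pM // norm_sqrt_iter.
Qed.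

Lemma sqrt_iter_dist n k : `|B (n + k) - B n| <= (be (n + k) - be n)%:C%C.
Proof.
elim: k => [|k IHk]; first by rewrite addn0 !subrr normr0.
rewrite addnS; have := sqrt_iter_step (n + k).
have -> : B (n + k).+1 - B n = (B (n + k).+1 - B (n + k)) + (B (n + k) - B n).
  by rewrite addrA subrK.
have -> : be (n + k).+1 - be n =
   (be (n + k).+1 - be (n + k)) + (be (n + k) - be n) by rewrite addrA subrK.
move=> h; apply: le_trans (ler_normD _ _) _.
by rewrite rmorphD lerD.
Qed.

Lemma sqrt_bound_mono n k : be n <= be (n + k).
Proof.
by rewrite -subr_ge0 -ler0c; apply: le_trans (sqrt_iter_dist n k).
Qed.

Lemma sqrt_iter_cvg : exists b : A, B @ \oo --> b.
Proof.
have be_nd : nondecreasing_seq be.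
  by move=> n k nk; rewrite -(subnKC nk) sqrt_bound_mono.
have bc : cvgn be.
  apply: nondecreasing_is_cvgn => //.
  by exists 1 => _ [n _ <-]; case/andP: (sqrt_bound_itv n).
apply: cauchy_seq_cvg => e e0.
have e20 : 0 < complex.Re e / 2 by rewrite divr_gt0 // -ltcR gt0_RRe.
have [N _ NP] : \forall n \near \oo, `|limn be - be n| < complex.Re e / 2.
  by move/cvgrPdist_lt: bc => /(_ _ e20).
have key n : (N <= n)%N -> `|B n - B N| < e / 2.
  move=> Nn; rewrite -(subnKC Nn); apply: le_lt_trans (sqrt_iter_dist _ _) _.
  rewrite subnKC //.
  have -> : e / 2 = ((complex.Re e / 2)%:C)%C.
    by rewrite mulrC [in RHS]mulrC halfC gt0_RRe.
  rewrite ltcR; apply: le_lt_trans (NP N (leqnn N)).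
  apply: le_trans (ler_norm _); rewrite lerD2r.
  exact: nondecreasing_cvgn_le.
exists N => n k Nn Nk; rewrite [e]splitr.
have -> : B n - B k = (B n - B N) - (B k - B N) by rewrite opprB addrA subrK.
by apply: le_lt_trans (ler_normB _ _) _; rewrite ltrD ?key.
Qed.

Lemma star_sqrt_iter n : star (B n) = B n.
Proof.
elim: n => [|n IHn] /=; first exact: star0.
by rewrite starZ starD starMr IHn sx fmorphV /= conjC_nat.
Qed.

Lemma comm_sqrt_iter y n : y * x = x * y -> y * B n = B n * y.
Proof.
move=> xy; elim: n => [|n IHn] /=; first by rewrite mulr0 mul0r.
by rewrite cstarZl cstarZr mulrDr mulrDl xy mulrA IHn -mulrA IHn mulrA.
Qed.

(** The iteration [b <- (x + b ^ 2) / 2] has fixed points [b] with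
    [(1 - b) ^ 2 = 1 - x]. Its increments are dominated by those of the same
    iteration run on the number 1, which increases and is bounded by 1, so it
    converges in norm as soon as the norm of [x] is at most 1. *)
Lemma sqrt_one_sub : exists b : A,
  [/\ star b = b, `|b| <= 1, (1 - b) * (1 - b) = 1 - x &
      forall y, y * x = x * y -> y * b = b * y].
Proof.
have [b Bb] := sqrt_iter_cvg.
have lim_closed (S : set A) : closed S -> (forall n, S (B n)) -> S b.
  by move=> Sc SB; exact: closed_cvg_seq Sc SB Bb.
have nB n : `|B n| <= 1.
  by apply: le_trans (norm_sqrt_iter n) _; rewrite lecR; case/andP: (sqrt_bound_itv n).
have nb : `|b| <= 1.
  apply: (@cvgC_le _ _ \oo _ (fun n => `|B n|)); first exact: cvg_norm.
  exact: nearW.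
exists b; split => //.
- apply: (lim_closed [set z | star z = z]); last exact: star_sqrt_iter.
  apply: (@closed_equalizer R A A star id); first exact: star_continuous.
  by move=> y; exact: cvg_id.
- have B1 : (fun n => B n.+1) @ \oo --> b by rewrite (@cvg_shiftS A).
  have B2 : (fun n => B n.+1) @ \oo --> (2^-1 : R[i]) *: (x + b * b).
    apply/cvgrPdist_lt => e e0; move/cvgrPdist_lt: Bb => /(_ e e0).
    apply: filterS => n; apply: le_lt_trans.
    rewrite -[B n.+1]/((2^-1 : R[i]) *: (x + B n * B n)) -scalerBr.
    rewrite opprD addrACA subrr add0r norm_half.
    have -> : b * b - B n * B n = (b - B n) * b + B n * (b - B n).
      by rewrite mulrBl mulrBr addrA subrK.
    rewrite ler_pdivrMl // mulr_natl mulr2n; apply: le_trans (ler_normD _ _) _.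
    by apply: lerD; apply: le_trans (cstar_normMr _ _) _;
      rewrite ?ler_piMr ?ler_piMl.
  have bE : b = (2^-1 : R[i]) *: (x + b * b) := cvg_unique _ B1 B2.
  have b2 : b + b = x + b * b.
    have : (2 : R[i]) *: b = x + b * b.
      transitivity ((2 : R[i]) *: ((2^-1 : R[i]) *: (x + b * b))).
        by rewrite -bE.
      by rewrite scalerA divff ?scale1r ?pnatr_eq0.
    by rewrite scaler_nat mulr2n.
  have -> : x = b + b - b * b by rewrite b2 addrK.
  rewrite mulrBr mulr1 mulrBl mul1r !opprB -addrA; congr (1 + _).
  by rewrite opprD addrCA.
- move=> y xy; apply: (lim_closed [set z | y * z = z * y]).
    by apply: (@closed_equalizer R A A ( *%R y) ( *%R^~ y)); [exact: mulr_continuousl|exact: mulr_continuousr].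
  by move=> n; exact: comm_sqrt_iter.
Qed.
End SquareRoot.

Section Contractive.
Variables (R : realType) (A : cstarType R) (H : hilbertType R).
Variable pi : representation A H.

Lemma repD a b v : pi (a + b) v = pi a v + pi b v.
Proof. by have := repP pi 1 a b v; rewrite !scale1r. Qed.
Lemma rep0 v : pi 0 v = 0.
Proof. by apply: (addrI (pi 0 v)); rewrite -repD !addr0. Qed.
Lemma repZ c a v : pi (c *: a) v = c *: pi a v.
Proof. by have := repP pi c a 0 v; rewrite rep0 !addr0. Qed.
Lemma repN a v : pi (- a) v = - pi a v.
Proof. by rewrite -scaleN1r repZ scaleN1r. Qed.
Lemma repB a b v : pi (a - b) v = pi a v - pi b v.
Proof. by rewrite repD repN. Qed.
Lemma repDr a v w : pi a (v + w) = pi a v + pi a w.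
Proof. by have := rep_linear pi a 1 v w; rewrite !scale1r. Qed.
Lemma rep0r a : pi a 0 = 0.
Proof. by apply: (addrI (pi a 0)); rewrite -repDr !addr0. Qed.
Lemma repZr a c v : pi a (c *: v) = c *: pi a v.
Proof. by have := rep_linear pi a c v 0; rewrite rep0r !addr0. Qed.
Lemma repNr a v : pi a (- v) = - pi a v.
Proof. by rewrite -scaleN1r repZr scaleN1r. Qed.
Lemma repBr a v w : pi a (v - w) = pi a v - pi a w.
Proof. by rewrite repDr repNr. Qed.
Lemma rep_starr a v w : inner v (pi (star a) w) = inner (pi a v) w.
Proof. by rewrite -[in RHS](starK a) rep_star. Qed.

Lemma rep_norm_star a v : inner (pi a v) (pi a v) = inner (pi (star a * a) v) v.
Proof. by rewrite repM rep_star. Qed.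

Lemma rep1_norm v : `|pi 1 v| <= `|v|.
Proof.
have [->|v0] := eqVneq `|pi 1 v| 0; first exact: normr_ge0.
have nv : 0 < `|pi 1 v| by rewrite lt_def v0 normr_ge0.
rewrite -(ler_pM2l nv) -expr2 -inner_norm rep_norm_star star1 mulr1.
rewrite -[leLHS]ger0_norm ?inner_CauchySchwarz //.
by rewrite -{1}(mulr1 1) -{1}(star1 A) -rep_norm_star inner_ge0.
Qed.

(** Continuity of a representation in the algebra variable is automatic: when
    the norm of [a] is at most 1, the element [1 - a^* a] is the square of a
    self-adjoint one, hence is sent to a positive operator. *)
Lemma rep_contractive a v : `|pi a v| <= `|a| * `|v|.
Proof.
have unit_ball b : `|b| <= 1 -> `|pi b v| <= `|v|.
  move=> b1; have sb : star (star b * b) = star b * b by rewrite starMr starK.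
  have nb : `|star b * b| <= 1.
    by apply: le_trans (cstar_normMr _ _) _; rewrite norm_star mulr_ile1.
  have [c [sc _ cE _]] := sqrt_one_sub sb nb.
  apply: le_trans (rep1_norm v); apply: norm_le_sqr.
  rewrite -subr_ge0 !rep_norm_star star1 mulr1 -innerNl -innerDl -repB -cE.
  by rewrite -{1}[1 - c]starK starB star1 sc -rep_norm_star inner_ge0.
have [->|a0] := eqVneq a 0; first by rewrite rep0 !normr0 mul0r.
have na : 0 < `|a| by rewrite normr_gt0.
have := unit_ball (`|a|^-1 *: a); rewrite normrZ normfV normr_id mulVf ?gt_eqF //.
rewrite repZ normrZ normfV normr_id => /(_ (lexx _)).
by rewrite ler_pdivrMl.
Qed.

Lemma rep_continuousl v : continuous ((fun a => pi a v) : A -> H).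
Proof.
apply: (@lipschitz_continuous R _ _ _ `|v|) => a b.
by rewrite -repB mulrC rep_contractive.
Qed.

End Contractive.

(** * Schur's lemma *)

Section RepBop.
Variables (R : realType) (A : cstarType R) (H : hilbertType R).
Variable pi : representation A H.

Lemma rep_bop_subproof a : rep_fun pi a \in @bop_pred R H.
Proof.
apply/bop_predP; split; last by exists `|a| => v; exact: rep_contractive.
by exists (pi (star a)) => v w; rewrite rep_starr.
Qed.

Definition rep_bop a : bop H := MkBop (rep_bop_subproof a).

(** The fixed vectors of the projection [pi 1] form an invariant subspace that
    contains the range of the representation. *)
Lemma irreducible_rep1 : irreducible pi -> forall v, pi 1 v = v.
Proof.
move=> [[a [w aw0]] inv] v.
have cW : closed_subspace [set v | pi 1 v = v].
  split => [|c x y /= hx hy|]; first by rewrite /= rep0r.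
    by rewrite repDr repZr hx hy.
  apply: (@closed_equalizer R H H (pi 1) id); first exact: rep_continuous.
  by move=> y; exact: cvg_id.
have [|W0|/seteqP[_ /(_ v I)//]] := inv _ cW.
  by move=> b x _ /=; rewrite -repM mul1r.
have : [set v | pi 1 v = v] (pi a w) by rewrite /= -repM mul1r.
by rewrite W0.
Qed.

Lemma irreducible_neq0 : irreducible pi -> exists v : H, v != 0.
Proof.
by move=> [[a [w aw0]] _]; exists (pi a w); apply/eqP.
Qed.
End RepBop.

Section Schur.
Variables (R : realType) (A : cstarType R) (H : hilbertType R).
Variable pi : representation A H.
Hypothesis irr : irreducible pi.

Lemma selfadjoint_inner (S : bop H) v w : star S = S ->
  inner (S v) w = inner v (S w).
Proof. by move=> sS; rewrite -[in RHS]sS starEr. Qed.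

Lemma selfadjoint_real (S : bop H) v : star S = S ->
  inner (S v) v \is Num.real.
Proof.
move=> sS; rewrite CrealE; apply/eqP.
by rewrite -[_^*]inner_conj (selfadjoint_inner _ _ sS).
Qed.

Lemma one_sub_ge0 (b : bop H) v : star b = b -> `|b| <= 1 ->
  0 <= inner ((1 - b) v) v.
Proof.
move=> sb nb; rewrite bopDE bopNE bop1E innerDl innerNl subr_ge0.
apply: le_trans (real_ler_norm _) _; first exact: selfadjoint_real.
apply: le_trans (inner_CauchySchwarz _ _) _; rewrite inner_norm expr2.
rewrite ler_wpM2r //; apply: le_trans (bop_normP _ _) _.
by rewrite ler_piMl.
Qed.

(** Let [P] be the positive square root of [S ^ 2], which commutes with [S] and
    with the representation. The kernel of [P - S] is invariant and contains the
    range of [P + S]: if it is everything then [S = P], and if it is zero then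
    [S = - P]. *)
Lemma commutant_sign (S : bop H) : star S = S ->
  (forall a v, S (pi a v) = pi a (S v)) ->
  (forall v, 0 <= inner (S v) v) \/ (forall v, inner (S v) v <= 0).
Proof.
move=> sS0 cS0; have [->|S0] := eqVneq S 0.
  by left => v; rewrite bop0E inner0l.
have nS : 0 < `|S| by rewrite normr_gt0.
pose S' : bop H := `|S|^-1 *: S.
have sS : star S' = S'.
  by rewrite starZ sS0 [(_)^*]geC0_conj // invr_ge0.
have cS a v : S' (pi a v) = pi a (S' v) by rewrite !bopZE cS0 repZr.
suff : (forall v, 0 <= inner (S' v) v) \/ (forall v, inner (S' v) v <= 0).
  by case=> h; [left|right] => v; have := h v; rewrite bopZE innerZl;
    [rewrite pmulr_rge0|rewrite pmulr_rle0]; rewrite // invr_gt0.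
have nS' v : `|S' v| <= `|v|.
  rewrite -[leRHS]mul1r; apply: le_trans (bop_normP _ _) _.
  by rewrite normrZ normfV normr_id mulVf // gt_eqF.
clearbody S'. (* the square root of [S' ^ 2 = 1 - X] exists since [X] is a contraction *)
pose X : bop H := 1 - S' * S'.
have sX : star X = X by rewrite starB star1 starMr sS.
have nX : `|X| <= 1.
  apply: bop_norm_le => // v; rewrite mul1r; apply: norm_le_sqr.
  rewrite bopDE bopNE bop1E bopME !innerE.
  rewrite -(selfadjoint_inner v (S' v) sS) (selfadjoint_inner (S' v) v sS).
  have := nS' (S' v); rewrite -(@ler_pXn2r _ 2) ?nnegrE // -!inner_norm => h.
  rewrite -addrA gerDl opprK; apply: le_trans (_ : inner (S' (S' v)) (S' (S' v)) -
    inner (S' v) (S' v) <= _); last by rewrite subr_le0.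
  by rewrite [leRHS]addrC gerDr oppr_le0 inner_ge0.
have [b [sb nb bE bcomm]] := sqrt_one_sub sX nX.
pose P : bop H := 1 - b.
have PS : P * S' = S' * P.
  rewrite /P mulrBl mulrBr mul1r mulr1 bcomm //.
  by rewrite /X mulrBl mulrBr mul1r mulr1 mulrA.
have PP : P * P = S' * S' by rewrite bE /X opprB addrC subrK.
have Ppi a v : P (pi a v) = pi a (P v).
  have /bcomm bpi : rep_bop pi a * X = X * rep_bop pi a.
    apply: bopP => w; rewrite !bopME !(bopDE, bopNE, bop1E, bopME) /=.
    by rewrite repBr !cS.
  rewrite !(bopDE, bopNE, bop1E) repBr; congr (_ - _).
  by have := congr1 (fun T : bop H => T v) bpi; rewrite !bopME.
have P0 v : 0 <= inner (P v) v by exact: one_sub_ge0.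
clearbody P.
have cW : closed_subspace [set v | P v = S' v].
  split => [|c v w hv hw|]; first by rewrite /mkset !bop0r.
    by rewrite /mkset !bop_linear hv hw.
  by apply: closed_equalizer; apply: (@lipschitz_continuous _ _ _ _ `|_|) => x y;
    rewrite -bopNr -bopDr; exact: bop_normP.
have [|W0|WT] := irr.2 _ cW.
- by move=> a v Wv; rewrite /mkset Ppi cS (Wv : P v = S' v).
- right => v; have : [set v | P v = S' v] (P v + S' v).
    have PPv : P (P v) = S' (S' v) := congr1 (fun T : bop H => T v) PP.
    have PSv : P (S' v) = S' (P v) := congr1 (fun T : bop H => T v) PS.
    by rewrite /mkset !bopDr PPv PSv addrC.
  rewrite W0 /= => /eqP; rewrite addrC addr_eq0 => /eqP ->.
  by rewrite innerNl oppr_le0.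
left => v; have : [set v | P v = S' v] v by rewrite WT.
by rewrite /mkset => <-.
Qed.

(** For each real [r] the operator [S - r] has a sign. The scalar is the supremum
    of the [r] for which this sign is positive: its difference with [S] has a
    vanishing quadratic form, hence vanishes by polarization. *)
Lemma commutant_selfadjoint_scalar (S : bop H) : star S = S ->
  (forall a v, S (pi a v) = pi a (S v)) ->
  exists c : R[i], forall v, S v = c *: v.
Proof.
move=> sS cS; have [e e0] := irreducible_neq0 irr.
pose q (v : H) := complex.Re (inner (S v) v); pose n (v : H) := complex.Re (inner v v).
have nE v : inner v v = ((n v)%:C)%C by rewrite ge0_RRe // inner_ge0.
have n0 v : 0 <= n v by rewrite -ler0c -nE inner_ge0.
have qE v : inner (S v) v = ((q v)%:C)%C by rewrite RRe_real // selfadjoint_real.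
have ne : 0 < n e.
  rewrite lt_def n0 andbT; apply/eqP => ne; have /inner_eq0/eqP : inner e e = 0.
    by rewrite nE ne.
  by rewrite (negbTE e0).
have dich (r : R) : (forall v, r * n v <= q v) \/ (forall v, q v <= r * n v).
  pose T : bop H := S - ((r%:C)%C : R[i]) *: (1 : bop H).
  have TE v : T v = S v - ((r%:C)%C : R[i]) *: v by [].
  have sT : star T = T by rewrite /T starB starZ sS star1 [(_)^*]conjc_real.
  have cT a v : T (pi a v) = pi a (T v) by rewrite !TE repBr repZr cS.
  have inE v : inner (T v) v = ((q v - r * n v)%:C)%C.
    by rewrite TE !innerE qE nE -rmorphM -rmorphB.
  have [h|h] := commutant_sign sT cT; [left|right] => v; have := h v;
    rewrite inE ?ler0c ?lecr0.
    by rewrite subr_ge0.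
  by rewrite -[0](rmorph0 (real_complex R)) lecR subr_le0.
pose E : set R := [set r | forall v, r * n v <= q v].
have qb v : `|q v| <= complex.Re `|S| * n v.
  rewrite -lecR; apply: le_trans (normc_ge_Re _) _.
  apply: le_trans (inner_CauchySchwarz _ _) _; rewrite rmorphM [X in _ <= X * _]ge0_RRe //.
  by rewrite -[X in _ <= _ * X]nE inner_norm expr2 mulrA ler_wpM2r // bop_normP.
have Eub : ubound E (complex.Re `|S|).
  move=> r Er; rewrite -(ler_pM2r ne); apply: le_trans (Er e) _.
  by apply: le_trans (ler_norm _) _.
have supE : has_sup E.
  split; last by exists (complex.Re `|S|).
  exists (- complex.Re `|S|) => v; rewrite mulNr lerNl.
  by apply: le_trans (qb v); rewrite -normrN ler_norm.
pose c := sup E.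
have qc v : q v = c * n v.
  apply/eqP; rewrite eq_le; apply/andP; split; apply/ler_addgt0Pr => d d0.
    (* shifting [c] by [d'] changes [c * n v] by at most [d] *)
    pose d' := d / (n v + 1).
    have d'0 : 0 < d' by rewrite divr_gt0 // ltr_wpDl.
    have [h|h] := dich (c + d').
      by have := sup_upper_bound supE h; rewrite gerDl leNgt d'0.
    apply: le_trans (h v) _; rewrite mulrDl lerD2l.
    by rewrite /d' mulrAC ler_pdivrMr ?ltr_wpDl // ler_wpM2l ?(ltW d0) // lerDl.
  pose d' := d / (n v + 1).
  have d'0 : 0 < d' by rewrite divr_gt0 // ltr_wpDl.
  have [r Er cr] := sup_adherent d'0 supE.
  apply: le_trans (_ : (r + d') * n v <= _).
    by rewrite ler_wpM2r // -lerBlDr ltW.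
  rewrite mulrDl lerD //.
  by rewrite /d' mulrAC ler_pdivrMr ?ltr_wpDl // ler_wpM2l ?(ltW d0) // lerDl.
exists (c%:C)%C => v; apply/eqP; rewrite -subr_eq0; apply/eqP.
pose ip x y := inner (S x - ((c%:C)%C : R[i]) *: x) y.
have ip0 x : ip x x = 0.
  by rewrite /ip innerDl innerNl innerZl qE nE -rmorphM qc subrr.
have ips y : scalar (ip^~ y).
  by move=> a x z; rewrite /ip bop_linear !innerE; ring.
have ipc x y : ip y x = (ip x y)^*.
  rewrite /ip -[(_)^*]inner_conj !innerE (selfadjoint_inner _ _ sS).
  by rewrite [(_)^*]conjc_real.
apply: inner_ext => w; rewrite inner0l.
have := ip_polarization ips ipc v w; rewrite !ip0 !subrr mulr0 addr0 => /eqP.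
by rewrite mulf_eq0 pnatr_eq0 /= => /eqP.
Qed.

(** Schur's lemma, from its self-adjoint case applied to the real and to
    the imaginary part. *)
Lemma commutant_scalar (S : bop H) :
  (forall a v, S (pi a v) = pi a (S v)) -> exists c : R[i], forall v, S v = c *: v.
Proof.
move=> cS.
have cs a v : star S (pi a v) = pi a (star S v).
  by apply: inner_ext => w; rewrite starE -!rep_starr starE cS.
have [c1 h1] : exists c : R[i], forall v, (S + star S) v = c *: v.
  apply: commutant_selfadjoint_scalar; first by rewrite starD starK addrC.
  by move=> a v; rewrite !bopDE repDr cS cs.
have [c2 h2] : exists c : R[i], forall v, ('i *: (S - star S)) v = c *: v.
  apply: commutant_selfadjoint_scalar.
    rewrite starZ starB starK [(_)^*]conjCi scaleNr -scalerN opprB.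
    by [].
  by move=> a v; rewrite !bopZE !bopDE !bopNE repZr repBr cS cs.
exists (2^-1 * (c1 - 'i * c2)) => v.
have -> : S v = (2^-1 : R[i]) *: ((S + star S) v - 'i *: ('i *: (S - star S)) v).
  rewrite bopZE scalerA -expr2 sqrCi scaleN1r opprK !bopDE bopNE addrACA subrr addr0.
  by rewrite -mulr2n -[S v *+ 2]scaler_nat scalerA mulVf ?scale1r ?pnatr_eq0.
by rewrite h1 h2 scalerA -scalerBl scalerA.
Qed.
End Schur.

(** * Closed subspaces as Hilbert spaces *)

Section SubHilbert.
Variables (R : realType) (H : hilbertType R) (W : set H).
Hypothesis cW : closed_subspace W.

(** The closedness proof is an argument of the predicate, hence of the type of
    vectors below, because the completeness instance depends on it. *)
Definition subspace_pred (_ : closed_subspace W) : {pred H} := fun x => `[< W x >].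

Lemma subspace_predP x : reflect (W x) (x \in subspace_pred cW).
Proof. exact: asboolP. Qed.

Lemma subspace_submod : submod_closed (subspace_pred cW).
Proof.
have [W0 WD _] := cW; split; first exact/subspace_predP.
by move=> c x y /subspace_predP Wx /subspace_predP Wy; apply/subspace_predP/WD.
Qed.

HB.instance Definition _ :=
  GRing.isSubmodClosed.Build R[i] H (subspace_pred cW) subspace_submod.

Record hilbert_sub : Type := MkSub {
  sub_val :> H; sub_mem : sub_val \in subspace_pred cW }.
HB.instance Definition _ := [isSub for sub_val].
HB.instance Definition _ := [Choice of hilbert_sub by <:].
HB.instance Definition _ := [SubChoice_isSubLmodule of hilbert_sub by <:].

Implicit Types x y : hilbert_sub.

Lemma sub_valP x : W (sub_val x). Proof. exact/subspace_predP/sub_mem. Qed.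

Definition to_sub (z : H) (Wz : W z) : hilbert_sub :=
  MkSub (introT (subspace_predP z) Wz).

Lemma sub_inj x y : sub_val x = sub_val y -> x = y. Proof. exact: val_inj. Qed.
Lemma sub_valD x y : sub_val (x + y) = sub_val x + sub_val y. Proof. by []. Qed.
Lemma sub_valN x : sub_val (- x) = - sub_val x. Proof. by []. Qed.
Lemma sub_valZ (c : R[i]) x : sub_val (c *: x) = c *: sub_val x. Proof. by []. Qed.

Definition sub_norm x : R[i] := `|sub_val x|.

Lemma sub_normD x y : sub_norm (x + y) <= sub_norm x + sub_norm y.
Proof. exact: ler_normD. Qed.
Lemma sub_normZ (c : R[i]) x : sub_norm (c *: x) = `|c| * sub_norm x.
Proof. exact: normrZ. Qed.
Lemma sub_norm_eq0 x : sub_norm x = 0 -> x = 0.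
Proof. by move=> /eqP; rewrite normr_eq0 => /eqP x0; apply: sub_inj. Qed.

HB.instance Definition _ := Lmodule_isNormed.Build R[i] hilbert_sub
  sub_normD sub_normZ sub_norm_eq0.

Lemma sub_normE x : `|x| = `|sub_val x|. Proof. by []. Qed.

Lemma sub_complete (F : set_system hilbert_sub) : ProperFilter F -> cauchy F -> cvg F.
Proof.
move=> FF /cauchy_ballP Fc.
have /cvg_ex[l Fl] : cvg ((sub_val : hilbert_sub -> H) @ F).
  apply: cauchy_cvg; apply/cauchy_ballP => e e0.
  have [[A B] /= [FA FB] AB] := Fc e e0.
  exists (sub_val @` A, sub_val @` B) => /=.
    by split; [apply: (@filterS _ F _ _ _ _ FA)|apply: (@filterS _ F _ _ _ _ FB)]
      => z Az; exists z.
  move=> [_ _] /= [[z Az <-] [w Bw <-]]; rewrite -ball_normE /=.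
  by have := AB (z, w) (conj Az Bw); rewrite -ball_normE.
have Wl : W l.
  have [_ _ Wc] := cW; apply: (@closed_cvg _ _ F _ sub_val W Wc _ l Fl).
  by apply: nearW => x; exact: sub_valP.
apply/cvg_ex; exists (to_sub Wl); apply/cvgrPdist_lt => e e0.
by move/cvgrPdist_lt: Fl => /(_ e e0).
Qed.

HB.instance Definition _ := Uniform_isComplete.Build hilbert_sub sub_complete.

Definition sub_inner x y : R[i] := inner (sub_val x) (sub_val y).
Let sub_inner_scalar y : scalar (sub_inner^~ y).
Proof. by move=> c x z; rewrite /sub_inner /= innerDl innerZl. Qed.
Let sub_inner_conj x y : sub_inner y x = (sub_inner x y)^*.
Proof. exact: inner_conj. Qed.
Let sub_inner_norm x : sub_inner x x = `|x| ^+ 2.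
Proof. exact: inner_norm. Qed.
HB.instance Definition _ := CompleteNormedModule_isHilbert.Build R hilbert_sub
  sub_inner_scalar sub_inner_conj sub_inner_norm.

Lemma sub_innerE x y : inner x y = inner (sub_val x) (sub_val y).
Proof. by []. Qed.

(** The restriction of an operator has an adjoint because the adjoint of the
    operator restricts as well. *)
Section Restriction.
Variable S : bop H.
Hypotheses (SW : forall x, W x -> W (S x)) (S'W : forall x, W x -> W (star S x)).

Definition restrict_fun x : hilbert_sub := to_sub (SW (sub_valP x)).

Lemma restrict_subproof : restrict_fun \in @bop_pred R hilbert_sub.
Proof.
apply/bop_predP; split; last by exists `|S| => x; exact: bop_normP.
exists (fun x => to_sub (S'W (sub_valP x))) => x y.
by rewrite !sub_innerE /= starEr.
Qed.

Definition restrict_bop : bop hilbert_sub := MkBop restrict_subproof.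

Lemma restrict_bopE x : sub_val (restrict_bop x) = S (sub_val x). Proof. by []. Qed.

Lemma restrict_bop_star x : sub_val (star restrict_bop x) = star S (sub_val x).
Proof.
rewrite -[RHS]/(sub_val (to_sub (S'W (sub_valP x)))); congr sub_val.
by apply: inner_ext => y; rewrite starE !sub_innerE /= starE.
Qed.
End Restriction.
End SubHilbert.

(** * Phases, shifts and amplifications on tensor products *)

Section Phases.
Variable R : realType.

Lemma expi2piD (s t : R) : expi2pi (s + t) = expi2pi s * expi2pi t.
Proof.
rewrite /expi2pi mulrDr cosD sinD; apply/eqP; rewrite eq_complex /=.
by rewrite eqxx /= addrC eqxx.
Qed.

Lemma expi2pi0 : expi2pi (0 : R) = 1.
Proof. by rewrite /expi2pi mulr0 cos0 sin0. Qed.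

Lemma expi2piN (t : R) : expi2pi (- t) = (expi2pi t)^*.
Proof. by rewrite /expi2pi mulrN cosN sinN. Qed.

Lemma expi2piNr (t : R) : expi2pi t * expi2pi (- t) = 1.
Proof. by rewrite -expi2piD subrr expi2pi0. Qed.

Lemma expi2pi_neq0 (t : R) : expi2pi t != 0.
Proof. by rewrite -normr_eq0 norm_expi2pi oner_neq0. Qed.

(* The angle is the arc cosine of the real part, up to the sign of the imaginary
   part. *)
Lemma expi2pi_surj (z : R[i]) : `|z| = 1 -> exists t : R, expi2pi t = z.
Proof.
case: z => a b; rewrite normc_def => /(congr1 (@complex.Re R)) /= ab.
have ab1 : a ^+ 2 + b ^+ 2 = 1.
  rewrite -[LHS]sqr_sqrtr ?ab ?expr1n //.
  by rewrite addr_ge0 ?sqr_ge0.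
have a1 : -1 <= a <= 1.
  rewrite -ler_norml -(@ler_pXn2r _ 2) ?nnegrE // expr1n real_normK ?num_real //.
  by rewrite -ab1 lerDl sqr_ge0.
have sb : Num.sqrt (1 - a ^+ 2) = `|b| by rewrite -ab1 addrAC subrr add0r sqrtr_sqr.
have pi2 : 2 * pi != 0 :> R by rewrite mulf_neq0 ?pnatr_eq0 // gt_eqF ?pi_gt0.
have [b0|b0] := leP 0 b.
  exists (acos a / (2 * pi)); rewrite /expi2pi mulrC divfK //.
  by rewrite acosK // sin_acos // sb ger0_norm.
exists (- acos a / (2 * pi)); rewrite /expi2pi mulrC divfK // cosN sinN.
by rewrite acosK // sin_acos // sb ltr0_norm // opprK.
Qed.
End Phases.

Section L2Operators.
Variables (R : realType) (K : hilbertType R).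
Local Notation C := R[i].
Implicit Types (u v : l2 K) (S T : bop K).

Lemma l2P u v : (forall k, u k = v k) -> u = v.
Proof. by move=> uv; apply: val_inj; apply/funext. Qed.

Lemma l2_innerE u v :
  inner u v = limn (series (fun k => inner (u k) (v k)) : nat -> C).
Proof. by []. Qed.

Lemma l2_normE_le u (M : C) :
  (forall n, \sum_(0 <= k < n) `|u k| ^+ 2 <= M) -> inner u u <= M.
Proof. exact: l2_inner_le. Qed.

Lemma l2_partial u n : \sum_(0 <= k < n) `|u k| ^+ 2 <= `|u| ^+ 2.
Proof. by rewrite -inner_norm; exact: l2_partial_le. Qed.

Lemma base_op_sum T u n :
  \sum_(0 <= k < n) `|T (u k)| ^+ 2 <= (`|T| * `|u|) ^+ 2.
Proof.
apply: le_trans (_ : `|T| ^+ 2 * \sum_(0 <= k < n) `|u k| ^+ 2 <= _).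
  rewrite mulr_sumr; apply: ler_sum => k _.
  by rewrite -exprMn ler_pXn2r ?nnegrE ?mulr_ge0 // bop_normP.
by rewrite exprMn ler_wpM2l ?exprn_ge0 // l2_partial.
Qed.

Lemma base_op_mem T u : (fun k => T (u k)) \in @l2_pred R K.
Proof. by apply/l2_predP; exists ((`|T| * `|u|) ^+ 2); exact: base_op_sum. Qed.

Definition base_op_fun T u : l2 K := MkL2 (base_op_mem T u).

Lemma phase_mem (t : R) u : (fun k => expi2pi (t * k%:R) *: u k) \in @l2_pred R K.
Proof.
apply/l2_predP; exists (`|u| ^+ 2) => n; apply: le_trans (l2_partial u n).
by apply: ler_sum => k _; rewrite normrZ norm_expi2pi mul1r.
Qed.

Definition phase_fun t u : l2 K := MkL2 (phase_mem t u).

Lemma shift_mem u : (fun k => if k is k'.+1 then u k' else 0) \in @l2_pred R K.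
Proof.
apply/l2_predP; exists (`|u| ^+ 2) => -[|n]; first by rewrite big_nil exprn_ge0.
by rewrite big_nat_recl //= normr0 expr0n add0r l2_partial.
Qed.

Definition shift_fun u : l2 K := MkL2 (shift_mem u).

Lemma unshift_mem u : (fun k => u k.+1) \in @l2_pred R K.
Proof.
apply/l2_predP; exists (`|u| ^+ 2) => n; apply: le_trans (l2_partial u n.+1).
by rewrite big_nat_recl //= lerDr exprn_ge0.
Qed.

Definition unshift_fun u : l2 K := MkL2 (unshift_mem u).

Lemma base_op_bop T : base_op_fun T \in @bop_pred R (l2 K).
Proof.
apply/bop_predP; split.
  exists (base_op_fun (star T)) => u v; rewrite !l2_innerE.
  by congr (limn (series _)); apply/funext => k /=; rewrite starEr.
exists `|T| => u; rewrite -(@ler_pXn2r _ 2) ?nnegrE ?mulr_ge0 // -inner_norm.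
by apply: l2_normE_le => n; exact: base_op_sum.
Qed.

Lemma phase_bop t : phase_fun t \in @bop_pred R (l2 K).
Proof.
apply/bop_predP; split.
  exists (phase_fun (- t)) => u v; rewrite !l2_innerE.
  congr (limn (series _)); apply/funext => k /=.
  by rewrite innerZl innerZr mulNr expi2piN conjCK.
exists 1 => u; rewrite mul1r -(@ler_pXn2r _ 2) ?nnegrE // -inner_norm.
apply: l2_normE_le => n; apply: le_trans (l2_partial u n).
by apply: ler_sum => k _; rewrite normrZ norm_expi2pi mul1r.
Qed.

Lemma shift_adjoint u v : inner (shift_fun u) v = inner u (unshift_fun v).
Proof.
apply: (@cvg_lim C) => //; rewrite -(@cvg_shiftS C).
have -> : (fun n => series (fun k => inner (shift_fun u k) (v k) : C) n.+1) =
    series (fun k => inner (u k) (v k.+1) : C).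
  apply/funext => n; rewrite /series /= big_nat_recl //= inner0l.
  by rewrite add0r.
exact: (@l2_inner_cvg R K u (unshift_fun v)).
Qed.

Lemma shift_bop : shift_fun \in @bop_pred R (l2 K).
Proof.
apply/bop_predP; split; first by exists unshift_fun => u v; exact: shift_adjoint.
exists 1 => u; rewrite mul1r -(@ler_pXn2r _ 2) ?nnegrE // -inner_norm.
apply: l2_normE_le => -[|n]; first by rewrite big_nil exprn_ge0.
by rewrite big_nat_recl //= normr0 expr0n add0r l2_partial.
Qed.

Definition base_op T : bop (l2 K) := MkBop (base_op_bop T).
Definition phase t : bop (l2 K) := MkBop (phase_bop t).
Definition ushift : bop (l2 K) := MkBop shift_bop.

Lemma base_opE T u k : base_op T u k = T (u k). Proof. by []. Qed.
Lemma phaseE t u k : phase t u k = expi2pi (t * k%:R) *: u k. Proof. by []. Qed.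
Lemma shift0E u : ushift u 0%N = 0. Proof. by []. Qed.
Lemma shiftSE u k : ushift u k.+1 = u k. Proof. by []. Qed.

Lemma base_op1 : base_op 1 = 1. Proof. by apply: bopP => u; apply: l2P. Qed.
Lemma base_opM S T : base_op (S * T) = base_op S * base_op T.
Proof. by apply: bopP => u; apply: l2P. Qed.
Lemma base_opZ (c : C) T : base_op (c *: T) = c *: base_op T.
Proof. by apply: bopP => u; apply: l2P. Qed.

Lemma star_base_op T : star (base_op T) = base_op (star T).
Proof.
apply: bopP; apply: star_unique => u v; rewrite !l2_innerE.
by congr (limn (series _)); apply/funext => k /=; rewrite starEr.
Qed.

Lemma star_phase t : star (phase t) = phase (- t).
Proof.
apply: bopP; apply: star_unique => u v; rewrite !l2_innerE.
congr (limn (series _)); apply/funext => k /=.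
by rewrite innerZl innerZr mulNr expi2piN conjCK.
Qed.

Lemma star_shiftE u k : star ushift u k = u k.+1.
Proof. by rewrite (star_unique (S := ushift) shift_adjoint). Qed.

Lemma phase0 : phase 0 = 1.
Proof.
by apply: bopP => u; apply: l2P => k; rewrite phaseE mul0r expi2pi0 scale1r.
Qed.

Lemma phaseD s t : phase (s + t) = phase s * phase t.
Proof.
apply: bopP => u; apply: l2P => k.
by rewrite bopME !phaseE scalerA mulrDl expi2piD.
Qed.

Lemma phase_base_op t T : phase t * base_op T = base_op T * phase t.
Proof.
apply: bopP => u; apply: l2P => k.
by rewrite !bopME !(phaseE, base_opE) bopZr.
Qed.

Lemma shift_base_op T : ushift * base_op T = base_op T * ushift.
Proof.
apply: bopP => u; apply: l2P => -[|k].
  by rewrite !bopME shift0E base_opE shift0E bop0r.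
by rewrite !bopME !(shiftSE, base_opE).
Qed.

Lemma shift_isometry : star ushift * ushift = 1.
Proof. by apply: bopP => u; apply: l2P => k; rewrite bopME star_shiftE shiftSE. Qed.

Lemma phase_shift t : phase t * ushift = expi2pi t *: (ushift * phase t).
Proof.
apply: bopP => u; apply: l2P => -[|k].
  rewrite bopZE !bopME phaseE l2ZE shift0E scaler0.
  by rewrite shift0E scaler0.
rewrite bopZE !bopME phaseE l2ZE !shiftSE phaseE scalerA -expi2piD.
by rewrite -natr1 mulrDr mulr1 addrC.
Qed.

(** The operators that occur on one tensor factor [l2(N_0)], acting here on
    [K (x) l2(N_0)]: [None] stands for the shift and [Some t] for the phase of
    angle [t]. *)
Definition leg (o : option R) : bop (l2 K) :=
  if o is Some t then phase t else ushift.

Lemma leg_base_op o T : leg o * base_op T = base_op T * leg o.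
Proof. by case: o => [t|]; [exact: phase_base_op|exact: shift_base_op]. Qed.

Lemma leg_isometry o : star (leg o) * leg o = 1.
Proof.
case: o => [t|] /=; last exact: shift_isometry.
by rewrite star_phase -phaseD addNr phase0.
Qed.

(* The scalar by which the adjoint of one leg commutes with another leg. Two
   shifts do not commute in this way, and the value there is a default. *)
Definition leg_coef (o o' : option R) : C :=
  match o, o' with
  | None, Some t => expi2pi t
  | Some t, None => expi2pi (- t)
  | _, _ => 1
  end.

Lemma leg_twist o o' : ~ (o = None /\ o' = None) ->
  star (leg o) * leg o' = leg_coef o o' *: (leg o' * star (leg o)).
Proof.
case: o o' => [s|] [t|] h /=.
- by rewrite scale1r star_phase -!phaseD addrC.
- by rewrite star_phase phase_shift.
- rewrite -[LHS]starK starMr starK star_phase phase_shift starZ starMr star_phase.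
  by rewrite expi2piN conjCK opprK.
- by case: h.
Qed.

Definition ampl T o : bop (l2 K) := leg o * base_op T.

Lemma ampl_isometry T o : star T * T = 1 -> star (ampl T o) * ampl T o = 1.
Proof.
move=> TT; rewrite /ampl starMr mulrA -[_ * star (leg o) * _]mulrA leg_isometry.
by rewrite mulr1 star_base_op -base_opM TT base_op1.
Qed.

Lemma ampl_coisometry T t : T * star T = 1 ->
  ampl T (Some t) * star (ampl T (Some t)) = 1.
Proof.
move=> TT; rewrite /ampl starMr mulrA -[leg _ * _ * _]mulrA star_base_op -base_opM TT.
by rewrite base_op1 mulr1 /= star_phase -phaseD subrr phase0.
Qed.

Lemma ampl_twist S T (c : C) o o' : ~ (o = None /\ o' = None) ->
  star S * T = c *: (T * star S) ->
  star (ampl S o) * ampl T o' =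
    (c * leg_coef o o') *: (ampl T o' * star (ampl S o)).
Proof.
move=> oo' ST; rewrite /ampl starMr star_base_op.
have LT : star (leg o) * base_op T = base_op T * star (leg o).
  by apply: (can_inj (@starK _ _)); rewrite !starMr starK star_base_op leg_base_op.
have ST' : base_op (star S) * base_op T = c *: (base_op T * base_op (star S)).
  by rewrite -!base_opM ST base_opZ.
have LL := leg_twist oo'; have LS := leg_base_op o' (star S).
move: (star (leg o)) (leg o') (base_op (star S)) (base_op T) (leg_coef o o') => L L' s t k
  in LT ST' LL LS *.
rewrite mulrA -[s * L * L']mulrA LL cstarZr cstarZl mulrA -LS.
rewrite -[_ * L * t]mulrA LT mulrA -[L' * s * t]mulrA ST' cstarZr cstarZl scalerA.
by rewrite mulrC !mulrA.
Qed.

End L2Operators.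

Arguments ushift {R K}.
Arguments phase {R K} t.
Arguments leg {R K} o.

Section TensorOperators.
Variables (R : realType) (J : Type).
Implicit Types (js : seq J) (d : J -> option R).

(** The operator [T (x) leg (d j_1) (x) ... (x) leg (d j_s)], assembled from the
    first factor outwards as [tensor_space] is. *)
Fixpoint tensor_op js (K : hilbertType R) (T : bop K) d : bop (tensor_space js K) :=
  if js is j :: js' then tensor_op js' (ampl T (d j)) d else T.

Definition factor (o : option R) : l2 R[i] -> l2 R[i] :=
  if o is Some t then l2_phase t else @l2_shift R.

Lemma ampl_tens K (T : bop K) o x xi :
  ampl T o (tens x xi) = tens (T x) (factor o xi).
Proof.
apply: l2P => k; rewrite /ampl bopME; case: o => [t|] /=.
  by rewrite bopZr scalerA.
by case: k => [|k]; rewrite ?scale0r //= bopZr.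
Qed.

Lemma tensor_op_etensor js K (T : bop K) d x (xi : J -> l2 R[i]) :
  tensor_op js T d (etensor js x xi) =
  etensor js (T x) (fun j => factor (d j) (xi j)).
Proof. by elim: js K T x => //= j js IH K T x; rewrite IH ampl_tens. Qed.

Lemma tensor_op_isometry js K (T : bop K) d : star T * T = 1 ->
  star (tensor_op js T d) * tensor_op js T d = 1.
Proof.
by elim: js K T => //= j js IH K T TT; apply: IH; exact: ampl_isometry.
Qed.
End TensorOperators.

Section TensorOperatorsEq.
Variables (R : realType) (J : eqType).
Implicit Types (js : seq J) (d : J -> option R).

Lemma tensor_op_coisometry js K (T : bop K) d : T * star T = 1 ->
  (forall j, j \in js -> d j <> None) ->
  tensor_op js T d * star (tensor_op js T d) = 1.
Proof.
elim: js K T => //= j js IH K T TT dN; apply: IH; last first.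
  by move=> k kjs; apply: dN; rewrite inE kjs orbT.
have := dN j (mem_head _ _); case: (d j) => // t _.
exact: ampl_coisometry.
Qed.

(** Each leg contributes its own commutation scalar. *)
Lemma tensor_op_twist js K (S T : bop K) d d' (c : R[i]) :
  (forall j, j \in js -> ~ (d j = None /\ d' j = None)) ->
  star S * T = c *: (T * star S) ->
  star (tensor_op js S d) * tensor_op js T d' =
  (c * \prod_(j <- js) leg_coef (d j) (d' j)) *:
    (tensor_op js T d' * star (tensor_op js S d)).
Proof.
elim: js K S T c => [|j js IH] K S T c /= dN ST; first by rewrite big_nil mulr1.
rewrite big_cons mulrA; apply: IH.
  by move=> k kjs; apply: dN; rewrite inE kjs orbT.
by apply: ampl_twist => //; apply: dN; rewrite mem_head.
Qed.

Lemma etensor_ext js (K : hilbertType R) (x : K) (xi eta : J -> l2 R[i]) :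
  (forall j, j \in js -> xi j = eta j) -> etensor js x xi = etensor js x eta.
Proof.
elim: js K x => //= j js IH K x xe; rewrite xe ?mem_head //; apply: IH.
by move=> k kjs; apply: xe; rewrite inE kjs orbT.
Qed.

End TensorOperatorsEq.

Section TensLinear.
Variables (R : realType) (J : Type).

Lemma tens_linear (K : hilbertType R) (xi : l2 R[i]) c (x y : K) :
  tens (c *: x + y) xi = c *: tens x xi + tens y xi.
Proof.
by apply: l2P => k; rewrite l2DE l2ZE /= scalerDr !scalerA mulrC.
Qed.

Lemma etensor_linear (js : seq J) (K : hilbertType R) xi c (x y : K) :
  etensor js (c *: x + y) xi = c *: etensor js x xi + etensor js y xi.
Proof. by elim: js K x y => //= j js IH K x y; rewrite tens_linear IH. Qed.

Lemma etensor_norm (js : seq J) (K : hilbertType R) xi (x : K) :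
  `|etensor js x xi| = `|x| * \prod_(j <- js) `|xi j|.
Proof.
apply/eqP; rewrite -(@eqrXn2 _ 2) ?mulr_ge0 ?prodr_ge0 //.
rewrite -inner_norm inner_etensor exprMn inner_norm -prodrXl.
by apply/eqP; congr (_ * _); apply: eq_bigr => j _; rewrite inner_norm.
Qed.

Lemma etensor_continuous (js : seq J) (K : hilbertType R) (xi : J -> l2 R[i]) :
  continuous ((fun x => etensor js x xi) : K -> tensor_space js K).
Proof.
apply: (@lipschitz_continuous R _ _ _ (\prod_(j <- js) `|xi j|)) => x y.
have -> : etensor js x xi - etensor js y xi = etensor js (x - y) xi.
  by rewrite addrC -scaleN1r -etensor_linear scaleN1r addrC.
by rewrite etensor_norm mulrC.
Qed.
End TensLinear.

(** * Invariant subspaces of tensor products *)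

Section ClosedSubspace.
Variables (R : realType) (H : hilbertType R) (W : set H).
Hypothesis cW : closed_subspace W.

Lemma csub0 : W 0. Proof. by case: cW. Qed.
Lemma csubD x y : W x -> W y -> W (x + y).
Proof. by have [_ WD _] := cW; move=> Wx Wy; rewrite -[x]scale1r; exact: WD. Qed.
Lemma csubZ (c : R[i]) x : W x -> W (c *: x).
Proof. by have [W0 WD _] := cW; move=> Wx; rewrite -[_ *: _]addr0; exact: WD. Qed.
Lemma csubB x y : W x -> W y -> W (x - y).
Proof. by move=> Wx Wy; apply: csubD => //; rewrite -scaleN1r; exact: csubZ. Qed.
Lemma csub_sum n (u : nat -> H) : (forall k, W (u k)) -> W (\sum_(0 <= k < n) u k).
Proof.
move=> Wu; elim: n => [|n IHn]; first by rewrite big_nil; exact: csub0.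
by rewrite big_nat_recr //; exact: csubD.
Qed.

End ClosedSubspace.

Lemma csub_preimage (R : realType) (H1 H2 : hilbertType R) (f : H1 -> H2) (W : set H2) :
  closed_subspace W -> linear f -> continuous f -> closed_subspace [set x | W (f x)].
Proof.
move=> [W0 WD Wc] fl fc; split => [|c x y Wx Wy|].
- by have := fl (-1) 0 0; rewrite scaler0 add0r scaleN1r addNr /mkset => ->.
- by rewrite /mkset fl; exact: WD.
- by apply: closed_comp Wc => x _; exact: fc.
Qed.

Section Coordinates.
Variables (R : realType) (K : hilbertType R).

Lemma l2_coord_continuous k : continuous ((fun u : l2 K => u k) : l2 K -> K).
Proof.
apply: (@lipschitz_continuous R _ _ _ 1) => u v; rewrite mul1r.
exact: (l2_norm_coord (u - v) k).
Qed.

Definition coords (W : set K) : set (l2 K) := [set u | forall k, W (u k)].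

Lemma coords_closed (W : set K) : closed_subspace W -> closed_subspace (coords W).
Proof.
move=> cW; split => [k|c u v Wu Wv k|]; first exact: csub0.
  by have [_ WD _] := cW; exact: (WD c (u k) (v k) (Wu k) (Wv k)).
have -> : coords W = \bigcap_(k in setT) [set u : l2 K | W (u k)].
  by apply/seteqP; split => [u Wu k _|u Wu k]; [exact: Wu|exact: (Wu k I)].
apply: closed_bigI => k _; have [_ _ Wc] := cW.
by apply: closed_comp Wc => u _; exact: l2_coord_continuous.
Qed.
End Coordinates.

Section Density.
Variables (R : realType) (J : eqType).

Lemma tens_total_csub (K : hilbertType R) (W : set (l2 K)) (u : l2 K) :
  closed_subspace W -> (forall k, W (tens (u k) (l2_basis R k))) -> W u.
Proof.
move=> cW Wu; have [_ _ Wc] := cW; apply: (closed_cvg_seq Wc _ (@tens_total _ _ u)).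
by move=> n; exact: csub_sum.
Qed.

(** The elementary tensors span a dense subspace: a closed subspace that
    contains all of them contains, one leg after the other, all tensors. *)
Lemma etensor_total (js : seq J) (K : hilbertType R) (W : set (tensor_space js K)) :
  uniq js -> closed_subspace W -> (forall x xi, W (etensor js x xi)) ->
  forall u, W u.
Proof.
elim: js K W => [|j js IH] K W /=; first by move=> _ _ Wx u; exact: (Wx u (fun=> 0)).
move=> /andP[jjs ujs] cW Wx u; apply: (IH _ _ ujs cW) => {u} u xi.
have cV : closed_subspace [set v : l2 K | W (etensor js v xi)].
  apply: csub_preimage cW _ _; last exact: etensor_continuous.
  by move=> c x y; exact: etensor_linear.
apply: (tens_total_csub cV) => k /=.
pose xi' i := if i == j then l2_basis R k else xi i.
have -> : etensor js (tens (u k) (l2_basis R k)) xi =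
    etensor js (tens (u k) (xi' j)) xi'.
  rewrite {1}/xi' eqxx; apply: etensor_ext => i ijs; rewrite /xi'.
  by case: eqP => // ij; rewrite -ij ijs in jjs.
exact: Wx.
Qed.

(** The subspace [W (x) l2(N_0) (x) ... (x) l2(N_0)]. *)
Fixpoint tensor_sub (js : seq J) (K : hilbertType R) (W : set K) :
    set (tensor_space js K) :=
  match js return set (tensor_space js K) with
  | [::] => W
  | _ :: js' => @tensor_sub js' (l2 K) (@coords R K W)
  end.
Arguments tensor_sub js {K} W _.

Lemma tensor_sub_closed js (K : hilbertType R) (W : set K) :
  closed_subspace W -> closed_subspace (tensor_sub js W).
Proof. by elim: js K W => //= j js IH K W cW; apply/IH/coords_closed. Qed.

Lemma tensor_sub0 js (K : hilbertType R) : tensor_sub js [set 0 : K] = [set 0].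
Proof.
elim: js K => //= j js IH K; rewrite -(IH (l2 K)); congr tensor_sub.
apply/seteqP; split => [u u0|_ -> k //].
by apply: l2P => k; rewrite (u0 k).
Qed.

Lemma tensor_subT js (K : hilbertType R) : tensor_sub js [set: K] = setT.
Proof.
elim: js K => //= j js IH K; rewrite -(IH (l2 K)); congr tensor_sub.
by apply/seteqP; split.
Qed.

Lemma tensor_sub_etensor js (K : hilbertType R) (W : set K) x xi :
  closed_subspace W -> W x -> tensor_sub js W (etensor js x xi).
Proof.
elim: js K W x => //= j js IH K W x cW Wx; apply: IH; first exact: coords_closed.
by move=> k; exact: csubZ.
Qed.

Lemma tensor_sub_basis js (K : hilbertType R) (W : set K) x :
  tensor_sub js W (etensor js x (fun=> l2_basis R 0)) -> W x.
Proof.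
by elim: js K W x => //= j js IH K W x /IH /(_ 0%N); rewrite /= scale1r.
Qed.

Lemma ampl_coords (K : hilbertType R) (W : set K) (T : bop K) o u :
  closed_subspace W -> (forall x, W x -> W (T x)) -> (coords W) u ->
  (coords W) (ampl T o u).
Proof.
move=> cW TW Wu k; rewrite /ampl bopME; case: o => [t|] /=.
  by apply: csubZ => //; exact: TW.
by case: k => [|k]; [exact: csub0|exact: TW].
Qed.

Lemma ampl_star_coords (K : hilbertType R) (W : set K) (T : bop K) o u :
  closed_subspace W -> (forall x, W x -> W (star T x)) -> (coords W) u ->
  (coords W) (star (ampl T o) u).
Proof.
move=> cW TW Wu k; rewrite /ampl starMr bopME star_base_op base_opE; apply: TW.
case: o => [t|]; last by rewrite /leg star_shiftE.
by rewrite /leg star_phase phaseE; exact: csubZ.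
Qed.

Lemma tensor_op_sub js (K : hilbertType R) (W : set K) (T : bop K) d u :
  closed_subspace W -> (forall x, W x -> W (T x)) ->
  tensor_sub js W u -> tensor_sub js W (tensor_op js T d u).
Proof.
elim: js K W T u => [K W T u _ TW|j js IH K W T u cW TW] /=; first exact: TW.
apply: IH; first exact: coords_closed.
by move=> x; exact: ampl_coords.
Qed.

Lemma tensor_op_star_sub js (K : hilbertType R) (W : set K) (T : bop K) d u :
  closed_subspace W -> (forall x, W x -> W (star T x)) ->
  tensor_sub js W u -> tensor_sub js W (star (tensor_op js T d) u).
Proof.
elim: js K W T u => [K W T u _ TW|j js IH K W T u cW TW] /=; first exact: TW.
apply: IH; first exact: coords_closed.
by move=> x; exact: ampl_star_coords.
Qed.

(** This describes families of operators [tensor_op js (T i) (d i)] in which the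
    one of index [i] in [js] is the identity on the first factor and on the legs
    that precede that of [i], the shift on the leg of [i], and a phase on each of
    the other legs, while the one of any other index has phases on all legs. The identity on the preceding legs is written as the phase of
    angle 0; it is what makes inductions that split off one leg possible. *)
Definition shift_system (js : seq J) (K : hilbertType R) (T : J -> bop K)
    (d : J -> J -> option R) : Prop :=
  [/\ uniq js, forall i, i \in js -> T i = 1,
      forall i j, j \in js -> (d i j = None <-> i = j) &
      pairwise (fun j i => d i j == Some 0) js].

Lemma shift_system_tail j js (K : hilbertType R) (T : J -> bop K) d :
  shift_system (j :: js) T d ->
  shift_system js (fun i => ampl (T i) (d i j)) d.
Proof.
move=> [/= /andP[_ ujs] T1 dN /andP[/allP dj pjs]]; split => //.
  move=> i ijs; rewrite T1 ?inE ?ijs ?orbT //.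
  by rewrite (eqP (dj _ ijs)) /ampl /= base_op1 phase0 mulr1.
by move=> i k kjs; apply: dN; rewrite inE kjs orbT.
Qed.

Lemma shift_system_head j js (K : hilbertType R) (T : J -> bop K) d :
  shift_system (j :: js) T d -> ampl (T j) (d j j) = ushift.
Proof.
move=> [_ T1 dN _]; rewrite T1 ?mem_head //.
by rewrite (iffRL (dN j j (mem_head _ _))) // /ampl base_op1 mulr1.
Qed.

Lemma iter_unshift (K : hilbertType R) (u : l2 K) n k :
  iter n (star ushift : bop (l2 K)) u k = u (n + k)%N.
Proof. by elim: n k => [|n IHn] k //=; rewrite star_shiftE IHn addnS. Qed.

Lemma iter_shift_tens (K : hilbertType R) (x : K) n :
  iter n (ushift : bop (l2 K)) (tens x (l2_basis R 0)) = tens x (l2_basis R n).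
Proof.
elim: n => [//|n /= ->]; apply: l2P => -[|k]; first by rewrite /= scale0r.
by rewrite shiftSE /=.
Qed.

Lemma unshift_tens0 (K : hilbertType R) (u : l2 K) :
  u - (ushift : bop (l2 K)) (star ushift u) = tens (u 0%N) (l2_basis R 0).
Proof.
apply: l2P => -[|k]; rewrite l2DE l2NE.
  by rewrite shift0E subr0 /= scale1r.
by rewrite shiftSE star_shiftE subrr /= scale0r.
Qed.

(** With [S] the shift on one leg, [1 - S S^*] is the projection on the vacuum
    [e_0] of that leg. With a tensor, an invariant closed subspace thus contains
    the product of each of its coefficients along the leg with [e_0], and with
    these products, by shifting back, it contains everything that has such
    coefficients. *)
Lemma invariant_tensor_sub (js : seq J) (K : hilbertType R) (T : J -> bop K) d
    (W : set (tensor_space js K)) :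
  shift_system js T d -> closed_subspace W ->
  (forall i u, W u -> W (tensor_op js (T i) (d i) u)) ->
  (forall i u, W u -> W (star (tensor_op js (T i) (d i)) u)) ->
  exists W0 : set K, [/\ closed_subspace W0, W = tensor_sub js W0,
    forall i x, W0 x -> W0 (T i x) & forall i x, W0 x -> W0 (star (T i) x)].
Proof.
elim: js K T W => [|j js IH] K T W sys cW invW invW'; first by exists W.
have [W1 [cW1 WE inv inv']] := IH _ _ W (shift_system_tail sys) cW invW invW'.
have shW u : W1 u -> W1 (ushift u) by rewrite -(shift_system_head sys); exact: inv.
have ushW u : W1 u -> W1 (star ushift u).
  by rewrite -(shift_system_head sys); exact: inv'.
pose W0 : set K := [set x | W1 (tens x (l2_basis R 0))].
have cW0 : closed_subspace W0.
  apply: csub_preimage cW1 _ _; first by move=> c x y; exact: tens_linear.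
  exact: (@etensor_continuous R J [:: j] K (fun=> l2_basis R 0)).
exists W0; split => //.
- rewrite WE /=; congr tensor_sub; apply/seteqP; split => u Wu.
    move=> k; rewrite /W0 /mkset -[k]addn0 -iter_unshift -unshift_tens0.
    have Wk : W1 (iter k (star ushift : bop (l2 K)) u).
      by elim: k => //= k; exact: ushW.
    by apply: csubB => //; exact/shW/ushW.
  apply: (tens_total_csub cW1) => k; rewrite -iter_shift_tens.
  have Wk : W1 (tens (u k) (l2_basis R 0)) := Wu k.
  move: (tens _ _) Wk => w Ww.
  by elim: k => //= n; exact: shW.
- move=> i x W0x; have [_ T1 dN _] := sys.
  have [->|ij] := eqVneq i j; first by rewrite T1 ?mem_head.
  have := inv i _ W0x; rewrite ampl_tens /W0 /mkset.
  case di : (d i j) => [t|]; last first.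
    by move/dN : di => /(_ (mem_head _ _)) e; rewrite e eqxx in ij.
  by rewrite /= phase_basis mulr0 expi2pi0 scale1r.
- move=> i x W0x; have [_ T1 dN _] := sys.
  have [->|ij] := eqVneq i j.
    by rewrite T1 ?mem_head // star1.
  have := inv' i _ W0x.
  case di : (d i j) => [t|]; last first.
    by move/dN : di => /(_ (mem_head _ _)) e; rewrite e eqxx in ij.
  rewrite /ampl /leg starMr star_base_op star_phase -phase_base_op.
  rewrite -[phase _ * _]/(ampl (star (T i)) (Some (- t))) ampl_tens /=.
  by rewrite phase_basis mulr0 expi2pi0 scale1r.
Qed.
End Density.
Arguments tensor_sub {R J} js {K} W _.

(** * The Wold decomposition of twisted isometries *)

Section Isometry.
Variables (R : realType) (H : hilbertType R).
Implicit Types S : bop H.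

Lemma norm_one_le : `|1 : bop H| <= 1.
Proof. by apply: bop_norm_le => // x; rewrite mul1r. Qed.

Variable S : bop H.
Hypothesis iS : star S * S = 1.

Lemma isometryK x : star S (S x) = x.
Proof. exact: (congr1 (fun T : bop H => T x) iS). Qed.

Lemma isometryX n : star (S ^+ n) * S ^+ n = 1.
Proof.
elim: n => [|n IHn]; first by rewrite expr0 star1 mulr1.
by rewrite exprS starMr mulrA -[_ * star S * S]mulrA iS mulr1.
Qed.

Lemma isometry_norm_le : `|S| <= 1.
Proof.
rewrite -(@ler_pXn2r _ 2) ?nnegrE // -cstar_norm expr1n.
by rewrite -[cstar_mul _ _]/(star S * S) iS norm_one_le.
Qed.

Definition range_proj n : bop H := S ^+ n * star (S ^+ n).

Lemma range_projE m n : (m <= n)%N -> range_proj m * S ^+ n = S ^+ n.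
Proof.
move=> mn; rewrite -(subnKC mn) exprD /range_proj mulrA -[_ * _ * S ^+ m]mulrA.
by rewrite isometryX mulr1.
Qed.

Lemma range_proj_star n : star (range_proj n) = range_proj n.
Proof. by rewrite /range_proj starMr starK. Qed.

Lemma range_projM m n : (m <= n)%N -> range_proj m * range_proj n = range_proj n.
Proof. by move=> mn; rewrite {2}/range_proj mulrA range_projE. Qed.

Lemma range_proj_telescope n :
  \sum_(0 <= k < n) S ^+ k * (1 - S * star S) * star (S ^+ k) = 1 - range_proj n.
Proof.
elim: n => [|n IHn].
  by rewrite big_nil /range_proj expr0 star1 mulr1 subrr.
rewrite big_nat_recr //= IHn mulrBr mulrBl mulr1 addrA addrNK; congr (_ - _).
by rewrite /range_proj exprSr starMr !mulrA.
Qed.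

(** The unitary part of the isometry, which consists of the vectors in the ranges
    of all its powers, is zero. *)
Definition pure : Prop := forall x, (forall n, range_proj n x = x) -> x = 0.

(** The range projections decrease, hence converge strongly, and the limit of
    [range_proj n x] is fixed by all of them. *)
Lemma pure_cvg x : pure -> (fun n => range_proj n x) @ \oo --> (0 : H).
Proof.
move=> pS; pose P n := range_proj n.
pose a n := complex.Re (inner (P n x) x).
have sP n v w : inner (P n v) w = inner v (P n w).
  by apply: selfadjoint_inner; exact: range_proj_star.
have PM m n v : (m <= n)%N -> P m (P n v) = P n v.
  by move=> mn; exact: (congr1 (fun T : bop H => T v) (range_projM mn)).
have PP m n : (m <= n)%N -> inner (P m x) (P n x) = inner (P n x) x.
  by move=> mn; rewrite sP PM // sP.
have aE n : inner (P n x) x = ((a n)%:C)%C.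
  by rewrite ge0_RRe // -(PP n n) // inner_ge0.
have dist m n : (m <= n)%N -> `|P m x - P n x| ^+ 2 = ((a m - a n)%:C)%C.
  move=> mn; rewrite -inner_norm !innerE [inner (P n x) (P m x)]inner_conj.
  by rewrite !PP // !aE [(_)^*]conjc_real opprK rmorphB /=; ring.
have a_ni : nonincreasing_seq a.
  by move=> m n mn; rewrite -subr_ge0 -ler0c -dist // exprn_ge0.
have ac : cvgn a.
  apply: nonincreasing_is_cvgn => //; exists 0 => _ [n _ <-].
  by rewrite -ler0c -aE -(PP n n) // inner_ge0.
have [g Pg] : exists g : H, (fun n => P n x) @ \oo --> g.
  apply: cauchy_seq_cvg => e e0.
  have e2 : 0 < complex.Re (e / 2) by rewrite -ltcR gt0_RRe ?divr_gt0.
  have e20 : 0 < complex.Re (e / 2) ^+ 2 by rewrite exprn_gt0.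
  have [N _ NP] : \forall n \near \oo, `|limn a - a n| < complex.Re (e / 2) ^+ 2.
    by move/cvgrPdist_lt: ac => /(_ _ e20).
  have key n : (N <= n)%N -> `|P N x - P n x| < e / 2.
    move=> Nn; rewrite -(@ltr_pXn2r _ 2) ?nnegrE ?divr_ge0 ?(ltW e0) // dist //.
    rewrite -[e / 2]gt0_RRe ?divr_gt0 // -rmorphXn ltcR.
    apply: le_lt_trans (NP N (leqnn N)); rewrite distrC.
    apply: le_trans (ler_norm _); rewrite lerD2l lerN2.
    exact: nonincreasing_cvgn_ge.
  exists N => n k Nn Nk; rewrite [e]splitr.
  have -> : P n x - P k x = (P N x - P k x) - (P N x - P n x).
    by rewrite opprB [RHS]addrC [RHS]addrA subrK.
  by apply: le_lt_trans (ler_normB _ _) _; rewrite ltrD ?key.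
suff -> : 0 = g by [].
apply/esym/pS => m.
have Pmg : (fun n => P m (P n x)) @ \oo --> P m g.
  apply: (@continuous_cvg _ _ _ \oo _ _ (P m : H -> H) g _ Pg).
  apply: (@lipschitz_continuous R _ _ _ `|P m|) => u v.
  by rewrite -bopNr -bopDr bop_normP.
have Pg' : (fun n => P m (P n x)) @ \oo --> g.
  apply: cvg_trans Pg; apply: near_eq_cvg.
  by exists m => // n mn; exact/esym/PM.
exact: cvg_unique Pmg Pg'.
Qed.
End Isometry.

Section TwistedIsometries.
Variables (R : realType) (H : hilbertType R) (J : eqType).
Variables (s : J -> bop H) (th : J -> J -> R).
Hypothesis s_isometry : forall i, star (s i) * s i = 1.
Hypothesis thN : forall i j, th j i = - th i j.
Hypothesis s_twist : forall i j, i != j ->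
  star (s i) * s j = expi2pi (- th i j) *: (s j * star (s i)).

(** Twisted commutation of the isometries themselves follows from that of each
    one with the adjoint of the other: the difference [x] of the two sides
    satisfies [x^* x = 0]. *)
Lemma isometries_twist i j : i != j ->
  s i * s j = expi2pi (th i j) *: (s j * s i).
Proof.
move=> ij; apply/eqP; rewrite -subr_eq0 -normr_eq0.
set x := _ - _; suff x0 : star x * x = 0.
  by rewrite -sqrf_eq0 -cstar_norm -[cstar_mul _ _]/(star x * x) x0 normr0.
have ji : j != i by rewrite eq_sym.
rewrite /x starB starZ !starMr -expi2piN mulrBl !mulrBr !cstarZl !cstarZr.
have -> : star (s j) * star (s i) * (s i * s j) = 1.
  by rewrite mulrA -[_ * _ * s i]mulrA s_isometry mulr1.
have -> : star (s i) * star (s j) * (s j * s i) = 1.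
  by rewrite mulrA -[_ * _ * s j]mulrA s_isometry mulr1.
have -> : star (s j) * star (s i) * (s j * s i) = expi2pi (- th i j) *: (1 : bop H) :> bop H.
  rewrite mulrA -[_ * _ * s j]mulrA s_twist // cstarZr cstarZl; congr (_ *: _).
  by rewrite mulrA s_isometry mul1r.
have -> : star (s i) * star (s j) * (s i * s j) = expi2pi (th i j) *: (1 : bop H) :> bop H.
  rewrite mulrA -[_ * _ * s i]mulrA s_twist // cstarZr cstarZl thN opprK.
  by congr (_ *: _); rewrite mulrA s_isometry mul1r.
have e1 : expi2pi (th i j) * expi2pi (- th i j) = 1 := expi2piNr _.
by rewrite !scalerA e1 [_ * expi2pi (th i j)]mulrC e1 !scale1r !subrr.
Qed.

Definition defect j : bop H := 1 - s j * star (s j).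

Lemma defect_star j : star (defect j) = defect j.
Proof. by rewrite /defect starB star1 starMr starK. Qed.

Lemma defect_s j : defect j * s j = 0.
Proof. by rewrite /defect mulrBl mul1r -mulrA s_isometry mulr1 subrr. Qed.

Lemma defectM j : defect j * defect j = defect j.
Proof. by rewrite {2}/defect mulrBr mulr1 mulrA defect_s mul0r subr0. Qed.

Lemma defect_comm i j : i != j -> defect j * s i = s i * defect j.
Proof.
move=> ij; have ji : j != i by rewrite eq_sym.
rewrite /defect mulrBl mulrBr mul1r mulr1; congr (_ - _).
rewrite -mulrA s_twist // cstarZr mulrA isometries_twist // cstarZl scalerA.
by rewrite mulrC expi2piNr scale1r mulrA.
Qed.

Lemma defect_comm_star i j : i != j ->
  defect j * star (s i) = star (s i) * defect j.
Proof.
move=> ij; apply: (can_inj (@starK _ _)).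
by rewrite !starMr starK defect_star defect_comm.
Qed.

(* The projection on the joint kernel of the adjoints of the [s j]. *)
Fixpoint vacuum (js : seq J) : bop H :=
  if js is j :: js' then defect j * vacuum js' else 1.

Lemma vacuum_comm i js : i \notin js -> vacuum js * s i = s i * vacuum js.
Proof.
elim: js => [|j js IH] /=; first by rewrite mul1r mulr1.
rewrite inE negb_or => /andP[ij ijs].
by rewrite -mulrA IH // mulrA defect_comm // mulrA.
Qed.

Lemma vacuum_comm_star i js : i \notin js ->
  vacuum js * star (s i) = star (s i) * vacuum js.
Proof.
elim: js => [|j js IH] /=; first by rewrite mul1r mulr1.
rewrite inE negb_or => /andP[ij ijs].
by rewrite -mulrA IH // mulrA defect_comm_star // mulrA.
Qed.

Lemma vacuum_defect i js : i \notin js -> vacuum js * defect i = defect i * vacuum js.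
Proof.
move=> ijs; rewrite /defect mulrBr mulrBl mul1r mulr1 mulrA vacuum_comm //.
by rewrite -mulrA vacuum_comm_star // mulrA.
Qed.

Lemma vacuum_star js : uniq js -> star (vacuum js) = vacuum js.
Proof.
elim: js => [|j js IH] /=; first by rewrite star1.
by move=> /andP[jjs ujs]; rewrite starMr IH // defect_star vacuum_defect.
Qed.

Lemma vacuumM js : uniq js -> vacuum js * vacuum js = vacuum js.
Proof.
elim: js => [|j js IH] /=; first by rewrite mulr1.
move=> /andP[jjs ujs]; rewrite mulrA -[_ * _ * defect j]mulrA vacuum_defect //.
by rewrite mulrA defectM -mulrA IH.
Qed.

Lemma vacuum_s j js : uniq js -> j \in js -> vacuum js * s j = 0.
Proof.
elim: js => [//|i js IH] /= /andP[ijs ujs]; rewrite inE.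
have [->|ji] /= := eqVneq j i => jjs.
  by rewrite -mulrA vacuum_comm // mulrA defect_s mul0r.
by rewrite -mulrA IH // mulr0.
Qed.

Lemma star_power_twist i j k : i != j ->
  star (s j ^+ k) * s i = expi2pi (th i j * k%:R) *: (s i * star (s j ^+ k)).
Proof.
move=> ij; elim: k => [|k IHk].
  by rewrite expr0 star1 mul1r mulr1 mulr0 expi2pi0 scale1r.
rewrite exprSr starMr -mulrA IHk cstarZr mulrA s_twist 1?eq_sym // cstarZl.
by rewrite scalerA mulrA (thN i j) opprK -expi2piD -natr1 mulrDr mulr1.
Qed.

(* The legs to be used when the indices of [js] are split off one after the
   other, in this order. *)
Fixpoint wold_legs (js : seq J) (d : J -> J -> option R) : Prop :=
  if js is j :: js' then
    (forall i, i \notin j :: js' -> d i j = Some (th i j)) /\ wold_legs js' d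
  else True.

(** A partial decomposition, in which the legs of the indices of [js] are still
    to be split off: [a] is a coisometry with initial projection [vacuum js] that
    intertwines the other isometries with their models on [K]. *)
Definition wold_map (js : seq J) (K : hilbertType R) (a : H -> K)
    (T : J -> bop K) : Prop :=
  [/\ linear a, forall h h', inner (a h) (a h') = inner (vacuum js h) h',
      forall x, exists h, a h = x &
      forall i, i \notin js -> forall h, a (s i h) = T i (a h)].

Section Step.
Variables (j : J) (js : seq J) (K : hilbertType R) (a : H -> K) (T : J -> bop K).
Variable d : J -> J -> option R.
Hypotheses (sys : shift_system (j :: js) T d) (dj : wold_legs (j :: js) d).
Hypothesis wa : wold_map (j :: js) a T.
Hypothesis pj : pure (s j).

Let P := range_proj (s j).

Let jjs : j \notin js. Proof. by have [/= /andP[]] := sys. Qed.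
Let ujs : uniq js. Proof. by have [/= /andP[]] := sys. Qed.
Let uj : uniq (j :: js). Proof. by have [] := sys. Qed.

Let aD h h' : a (h + h') = a h + a h'.
Proof. by have [al _ _ _] := wa; rewrite -[h]scale1r al !scale1r. Qed.
Let a0 : a 0 = 0.
Proof. by apply: (addrI (a 0)); rewrite -aD !addr0. Qed.
Let aZ (c : R[i]) h : a (c *: h) = c *: a h.
Proof. by have [al _ _ _] := wa; rewrite -[c *: h]addr0 al a0 addr0. Qed.

Let vacuum_pow n : vacuum js * s j ^+ n = s j ^+ n * vacuum js.
Proof.
elim: n => [|n IHn]; first by rewrite expr0 mulr1 mul1r.
by rewrite exprSr mulrA IHn -mulrA vacuum_comm // mulrA.
Qed.

(* The defect of [s j] is [P 0 - P 1], so the sum telescopes. *)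
Let partial_sum h h' n :
  \sum_(0 <= k < n) inner (a (star (s j ^+ k) h)) (a (star (s j ^+ k) h')) =
  inner (vacuum js (h - P n h)) h'.
Proof.
have [_ ai _ _] := wa.
transitivity (inner ((vacuum js * (1 - P n)) h) h'); last by [].
rewrite -range_proj_telescope // mulr_sumr.
elim: n => [|n IHn]; first by rewrite !big_nil bop0E inner0l.
rewrite !big_nat_recr // bopDE innerDl IHn; congr (_ + _).
rewrite ai starEr.
transitivity (inner ((s j ^+ n * (defect j * vacuum js * star (s j ^+ n))) h) h') => //.
rewrite -vacuum_defect // !mulrA vacuum_pow.
by [].
Qed.

Let proj_cvg h h' :
  (fun n => inner (vacuum js (h - P n h)) h' : R[i]) @ \oo -->
  (inner (vacuum js h) h' : R[i]).
Proof.
have fc : continuous ((fun g => inner (vacuum js (h - g)) h') : H -> R[i]).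
  apply: (@lipschitz_continuous R _ _ _ (`|vacuum js| * `|h'|)) => x y.
  rewrite -innerNl -innerDl -bopNr -bopDr.
  have -> : h - x + - (h - y) = - (x - y) by rewrite !opprB addrC addrA subrK.
  rewrite bopNr innerNl normrN; apply: le_trans (inner_CauchySchwarz _ _) _.
  by rewrite mulrAC ler_wpM2r // bop_normP.
have -> : inner (vacuum js h) h' = inner (vacuum js (h - 0)) h' by rewrite subr0.
exact: (@continuous_cvg _ _ _ \oo _ (fun n => P n h) _ 0 (fc 0)
  (pure_cvg (s_isometry j) h pj)).
Qed.

Let split_mem h : (fun k => a (star (s j ^+ k) h)) \in @l2_pred R K.
Proof.
apply/l2_predP; exists (`|vacuum js| * (`|h| + `|h|) * `|h|) => n.
under eq_bigr do rewrite -inner_norm.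
rewrite partial_sum -[leLHS]ger0_norm; last first.
  by rewrite -partial_sum sumr_ge0 // => k _; exact: inner_ge0.
apply: le_trans (inner_CauchySchwarz _ _) _; rewrite ler_wpM2r //.
apply: le_trans (bop_normP _ _) _; rewrite ler_wpM2l //.
apply: le_trans (ler_normB _ _) _; rewrite lerD2l /P /range_proj bopME.
have nS := isometry_norm_le (isometryX (s_isometry j) n).
apply: le_trans (bop_normP _ _) _; apply: le_trans (ler_piMl _ nS) _ => //.
by apply: le_trans (bop_normP _ _) _; rewrite norm_star ler_piMl.
Qed.

(** Under the model to be found, [s_j^{*k}] brings the [k]-th coefficient along
    the leg of [j] to the vacuum of that leg, where [a] reads it off. *)
Definition split_leg h : l2 K := MkL2 (split_mem h).

Let split_legE h k : split_leg h k = a (star (s j ^+ k) h).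
Proof. by []. Qed.

Let split_inner h h' :
  inner (split_leg h) (split_leg h') = inner (vacuum js h) h'.
Proof.
rewrite l2_innerE; apply: (@cvg_lim R[i]) => //.
have -> : series (fun k => inner (split_leg h k) (split_leg h' k) : R[i]) =
    (fun n => inner (vacuum js (h - P n h)) h').
  by apply/funext => n; rewrite -partial_sum.
exact: proj_cvg.
Qed.

Let split_linear : linear split_leg.
Proof.
move=> c h h'; apply: l2P => k; rewrite l2DE l2ZE !split_legE.
by rewrite bop_linear aD aZ.
Qed.

Let a_s h : a (s j h) = 0.
Proof.
have [_ ai _ _] := wa; apply: inner_eq0.
by rewrite ai -bopME vacuum_s ?mem_head // bop0E inner0l.
Qed.

Let a_vacuum h : a (vacuum (j :: js) h) = a h.
Proof.
have [_ ai _ _] := wa; apply/eqP; rewrite -subr_eq0; apply/eqP/inner_eq0.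
rewrite -scaleN1r -aZ -aD ai bopDr -bopME vacuumM // scaleN1r bopNr subrr.
by rewrite inner0l.
Qed.

Let split_twist i : i \notin js -> forall h,
  split_leg (s i h) = ampl (T i) (d i j) (split_leg h).
Proof.
move=> ijs h; have [_ _ _ aT] := wa; have [->|ij] := eqVneq i j.
  rewrite (shift_system_head sys); apply: l2P => -[|k].
    by rewrite split_legE expr0 star1 bop1E a_s shift0E.
  by rewrite shiftSE !split_legE exprS starMr bopME isometryK.
have ijjs : i \notin j :: js by rewrite inE negb_or ij.
have [-> // _] := dj; apply: l2P => k.
rewrite /ampl bopME phaseE base_opE !split_legE -bopME star_power_twist // bopZE aZ.
by rewrite bopME aT.
Qed.

Let split_basis k h : split_leg ((s j ^+ k) (vacuum (j :: js) h)) =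
  tens (a h) (l2_basis R k).
Proof.
have [_ ai _ _] := wa; apply: l2P => m; rewrite split_legE -bopME.
have -> : tens (a h) (l2_basis R k) m = if m == k then a h else 0.
  by rewrite /=; case: eqP => _; rewrite ?scale1r ?scale0r.
have [mk|km|->] := ltngtP m k; last first.
- by rewrite isometryX // bop1E a_vacuum.
- rewrite -(subnKC (ltnW km)) exprD starMr -mulrA isometryX // mulr1.
  case: (m - k)%N (subn_gt0 k m) => [|r _]; first by rewrite km.
  have z : star (s j) * vacuum (j :: js) = 0.
    apply: (can_inj (@starK _ _)).
    by rewrite starMr starK vacuum_star // vacuum_s ?mem_head // star0.
  have zh : star (s j) (vacuum (j :: js) h) = 0 by rewrite -bopME z bop0E.
  by rewrite exprS starMr bopME zh bop0r a0.
- rewrite -(subnKC (ltnW mk)) exprD mulrA isometryX // mul1r.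
  case: (k - m)%N (subn_gt0 m k) => [|r _]; first by rewrite mk.
  by rewrite exprS bopME a_s.
Qed.

(* The partial sums of [u] are images of vectors in the initial space, on which
   the map is isometric; so these vectors converge, and their limit is sent to
   [u]. *)
Let split_surj u : exists h, split_leg h = u.
Proof.
have [_ _ asurj _] := wa.
have L0 : split_leg 0 = 0.
  by have := split_linear (-1) 0 0; rewrite scaler0 add0r scaleN1r addNr.
have LD h h' : split_leg (h + h') = split_leg h + split_leg h'.
  by have := split_linear 1 h h'; rewrite !scale1r.
have LN h : split_leg (- h) = - split_leg h.
  by have := split_linear (-1) h 0; rewrite L0 !addr0 !scaleN1r.
have Lnorm h : `|split_leg h| = `|vacuum js h|.
  apply: norm_eq_sqr; rewrite split_inner -{1}(vacuumM ujs) bopME.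
  by rewrite -{1}(vacuum_star ujs) starE.
have Lvac h : split_leg (vacuum js h) = split_leg h.
  apply/eqP; rewrite -subr_eq0 -LN -LD -normr_eq0 Lnorm.
  by rewrite bopDr bopNr -bopME vacuumM // subrr normr0.
pose h k := sval (cid (asurj (u k))).
have hE k : a (h k) = u k by rewrite /h; case: cid.
pose g n := \sum_(0 <= k < n) (s j ^+ k) (vacuum (j :: js) (h k)).
pose v n := \sum_(0 <= k < n) tens (u k) (l2_basis R k).
have gE n : split_leg (g n) = v n.
  rewrite /g /v; elim: n => [|n IHn]; first by rewrite !big_nil.
  by rewrite !big_nat_recr //= LD IHn split_basis hE.
have vu : v @ \oo --> u by exact: tens_total.
have [h' gh'] : exists h', (fun n => vacuum js (g n)) @ \oo --> (h' : H).
  apply: cauchy_seq_cvg => e e0; have e20 : 0 < e / 2 by rewrite divr_gt0.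
  have [N _ NP] : \forall n \near \oo, `|u - v n| < e / 2.
    by move/cvgrPdist_lt: vu => /(_ _ e20).
  exists N => n k Nn Nk; rewrite -bopNr -bopDr -Lnorm LD LN !gE [e]splitr.
  have -> : v n - v k = (u - v k) - (u - v n) by rewrite opprB [RHS]addrC [RHS]addrA subrK.
  by apply: le_lt_trans (ler_normB _ _) _; rewrite ltrD ?NP.
exists h'.
have c1 : (fun n => split_leg (vacuum js (g n))) @ \oo --> split_leg h'.
  apply: (@continuous_cvg _ _ _ \oo _ _ (split_leg : H -> l2 K) h' _ gh').
  apply: (@lipschitz_continuous R _ _ _ `|vacuum js|) => x y.
  by rewrite -LN -LD Lnorm bop_normP.
have c2 : (fun n => split_leg (vacuum js (g n))) @ \oo --> u.
  have -> : (fun n => split_leg (vacuum js (g n))) = v by apply/funext => n; rewrite Lvac gE.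
  exact: vu.
exact: cvg_unique c1 c2.
Qed.

Lemma wold_step : wold_map js split_leg (fun i => ampl (T i) (d i j)).
Proof.
split; [exact: split_linear|exact: split_inner|exact: split_surj|].
exact: split_twist.
Qed.
End Step.

(** The legs are split off one after the other. At the end the initial
    projection is [vacuum [::] = 1] and the coisometry is a unitary. *)
Lemma wold_decomposition (js : seq J) (K : hilbertType R) (a : H -> K)
    (T : J -> bop K) (d : J -> J -> option R) :
  shift_system js T d -> wold_legs js d -> (forall j, j \in js -> pure (s j)) ->
  wold_map js a T ->
  exists U : H -> tensor_space js K, [/\ linear U,
    forall h h', inner (U h) (U h') = inner h h', forall u, exists h, U h = u &
    forall i h, U (s i h) = tensor_op js (T i) (d i) (U h)].
Proof.
elim: js K a T => [|j js IH] K a T sys dj pj wa.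
  have [al ai asurj aT] := wa; exists a; split => //.
  by move=> i h; exact: aT.
have := wold_step sys dj wa (pj j (mem_head _ _)).
apply: IH; first exact: shift_system_tail.
  by have [] := dj.
by move=> i ijs; apply: pj; rewrite inE ijs orbT.
Qed.
End TwistedIsometries.

Lemma etensor_basis_eq0 (R : realType) (J : Type) (js : seq J) (K : hilbertType R)
  (x : K) : etensor js x (fun=> l2_basis R 0) = 0 -> x = 0.
Proof.
have b0 : `|l2_basis R 0| != 0.
  rewrite gt_eqF //; apply: lt_le_trans (l2_norm_coord (l2_basis R 0) 0).
  by rewrite /= normr1.
elim: js K x => //= j js IH K x /IH/eqP.
rewrite -normr_eq0; have := @etensor_norm R unit [:: tt] K (fun=> l2_basis R 0) x.
rewrite big_seq1 /= => ->; rewrite mulf_eq0 (negbTE b0) orbF normr_eq0.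
by move/eqP.
Qed.

(** * Representations given by the images of generators *)

Section Generation.
Variables (R : realType) (A : cstarType R) (G : Type) (g : G -> A).

(** Induction over the C*-algebra generated by [g], for a property that need not
    be preserved by the adjoint. *)
Lemma generated_ind (P : set A) :
  P 1 -> (forall (c : R[i]) x y, P x -> P y -> P (c *: x + y)) ->
  (forall x y, P x -> P y -> P (x * y)) -> closed P ->
  (forall x, P (g x)) -> (forall x, P (star (g x))) ->
  cstar_generated (range g) `<=` P.
Proof.
move=> P1 Plin PM Pc Pg Pg'.
apply: (@subset_trans _ (P `&` star @^-1` P)); last by move=> x [].
apply: smallest_sub; last by move=> _ [x _ <-]; split; [exact: Pg|exact: Pg'].
split.
- by split => //; rewrite /preimage /mkset star1.
- move=> c x y [Px Px'] [Py Py']; split; first exact: Plin.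
  by rewrite /preimage /mkset starD starZ; exact: Plin.
- move=> x y [Px Px'] [Py Py']; split; first exact: PM.
  by rewrite /preimage /mkset starMr; exact: PM.
- by move=> x [Px Px']; split => //; rewrite /preimage /mkset starK.
- apply: closedI => //; apply: closed_comp => // x _; exact: star_continuous.
Qed.

Hypothesis gen : cstar_generated (range g) = setT.

Lemma invariant_generators (H : hilbertType R) (pi : representation A H) (W : set H) :
  closed_subspace W -> (forall v, W v -> W (pi 1 v)) ->
  (forall x v, W v -> W (pi (g x) v)) -> (forall x v, W v -> W (pi (star (g x)) v)) ->
  forall a v, W v -> W (pi a v).
Proof.
move=> cW W1 Wg Wg' a; suff : [set a | forall v, W v -> W (pi a v)] a by [].
apply: (@generated_ind [set a | forall v, W v -> W (pi a v)]) => //.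
- by move=> c x y Wx Wy v Wv; rewrite repD repZ; apply: csubD => //;
    [apply: csubZ => //; exact: Wx|exact: Wy].
- by move=> x y Wx Wy v Wv; rewrite repM; apply/Wx/Wy.
- have [_ _ Wc] := cW.
  have -> : [set a | forall v, W v -> W (pi a v)] =
      \bigcap_(v in W) [set a | W (pi a v)].
    by apply/seteqP; split => x Wx v; exact: Wx.
  apply: closed_bigI => v Wv; apply: closed_comp Wc => x _.
  exact: rep_continuousl.
- by rewrite gen.
Qed.

(** An isometry onto the second space that intertwines the generators intertwines
    their adjoints too. *)
Lemma intertwiner_generators (H1 H2 : hilbertType R) (pi1 : representation A H1)
    (pi2 : representation A H2) (U : H1 -> H2) :
  linear U -> (forall v w, inner (U v) (U w) = inner v w) ->
  (forall u, exists v, U v = u) ->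
  (forall v, pi1 1 v = v) -> (forall v, pi2 1 v = v) ->
  (forall x v, U (pi1 (g x) v) = pi2 (g x) (U v)) ->
  forall a v, U (pi1 a v) = pi2 a (U v).
Proof.
move=> Ul Ui Us one1 one2 Ug a.
suff : [set a | forall v, U (pi1 a v) = pi2 a (U v)] a by [].
have U0 : U 0 = 0 by have := Ul (-1) 0 0; rewrite scaler0 add0r scaleN1r addNr.
have UB x y : U (x - y) = U x - U y.
  by rewrite addrC -scaleN1r Ul scaleN1r addrC.
have Uc : continuous U.
  apply: (@lipschitz_continuous R _ _ _ 1) => x y.
  by rewrite mul1r -UB (norm_eq_sqr (Ui (x - y) (x - y))).
apply: (@generated_ind [set a | forall v, U (pi1 a v) = pi2 a (U v)]).
- by move=> v; rewrite one1 one2.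
- by move=> c x y hx hy v; rewrite !repD !repZ Ul hx hy.
- by move=> x y hx hy v; rewrite !repM hx hy.
- have -> : [set a | forall v, U (pi1 a v) = pi2 a (U v)] =
      \bigcap_(v in setT) [set a | U (pi1 a v) = pi2 a (U v)].
    by apply/seteqP; split => [x hx v _|x hx v]; [exact: hx|exact: (hx v I)].
  apply: closed_bigI => v _; apply: closed_equalizer; last exact: rep_continuousl.
  move=> x; apply: continuous_comp; first exact: rep_continuousl.
  exact: Uc.
- exact: Ug.
- move=> x v; apply: inner_ext => u; have [w <-] := Us u.
  by rewrite Ui !rep_star -Ug Ui.
- by rewrite gen.
Qed.
End Generation.

Section MorphismRep.
Variables (R : realType) (A : cstarType R) (H : hilbertType R) (phi : A -> bop H).
Hypothesis phiP : star_morphism phi.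

Let phi_linear a : linear (phi a : H -> H). Proof. exact: bop_linear. Qed.
Let phi_continuous a : continuous (phi a : H -> H).
Proof.
apply: (@lipschitz_continuous R _ _ _ `|phi a|) => x y.
by rewrite -bopNr -bopDr bop_normP.
Qed.
Let phi_lin (c : R[i]) a b v : phi (c *: a + b) v = c *: phi a v + phi b v.
Proof. by have [l _ _ _] := phiP; rewrite l. Qed.
Let phi_mul a b v : phi (a * b) v = phi a (phi b v).
Proof. by have [_ _ m _] := phiP; rewrite m. Qed.
Let phi_star a v w : inner (phi (star a) v) w = inner v (phi a w).
Proof. by have [_ _ _ st] := phiP; rewrite st starE. Qed.

Definition morphism_rep : representation A H :=
  Representation phi_linear phi_continuous phi_lin phi_mul phi_star.

Lemma morphism_repE a v : morphism_rep a v = phi a v. Proof. by []. Qed.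

Lemma morphism_rep1 v : morphism_rep 1 v = v.
Proof. by rewrite morphism_repE; have [_ -> _ _] := phiP. Qed.
End MorphismRep.

Section RepBopMorphism.
Variables (R : realType) (A : cstarType R) (H : hilbertType R).
Variable pi : representation A H.

Lemma rep_bopM a b : rep_bop pi (a * b) = rep_bop pi a * rep_bop pi b.
Proof. by apply: bopP => v; rewrite bopME /= repM. Qed.
Lemma rep_bop_star a : star (rep_bop pi a) = rep_bop pi (star a).
Proof. by apply: bopP; apply: star_unique => v w; rewrite /= rep_starr. Qed.
Lemma rep_bopE a v : rep_bop pi a v = pi a v. Proof. by []. Qed.
Lemma rep_bopZ (c : R[i]) a : rep_bop pi (c *: a) = c *: rep_bop pi a.
Proof. by apply: bopP => v; rewrite bopZE /= repZ. Qed.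
Hypothesis pi1 : forall v, pi 1 v = v.
Lemma rep_bop1 : rep_bop pi 1 = 1.
Proof. by apply: bopP => v; rewrite /= pi1. Qed.
End RepBopMorphism.

Section ScalarOperators.
Variables (R : realType) (H : hilbertType R).
Implicit Types (c : R[i]) (S : bop H).

Definition scalar_bop c : bop H := c *: (1 : bop H).

Lemma scalar_bopl c S : scalar_bop c * S = c *: S.
Proof. by rewrite /scalar_bop cstarZl mul1r. Qed.
Lemma scalar_bopr c S : S * scalar_bop c = c *: S.
Proof. by rewrite /scalar_bop cstarZr mulr1. Qed.
Lemma scalar_bop_star c : star (scalar_bop c) = scalar_bop c^*.
Proof. by rewrite /scalar_bop starZ star1. Qed.
End ScalarOperators.

(** * The representations induced from noncommutative tori *)

Section Legs.
Variables (R : realType) (N : nat) (Theta : pairs N -> R) (I : {set 'I_N}).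

(* The skew-symmetric extension of the angles. *)
Definition angle (i j : 'I_N) : R :=
  if (i < j)%N then theta Theta i j else - theta Theta j i.

Lemma theta_geq (i j : 'I_N) : (j <= i)%N -> theta Theta i j = 0.
Proof. by move=> ji; rewrite /theta insubF //= ltnNge ji. Qed.

Lemma theta_pair (p : pairs N) (i j : 'I_N) : val p = (i, j) ->
  theta Theta i j = Theta p.
Proof. by move=> pij; rewrite /theta -pij valK. Qed.

Lemma angleN i j : angle j i = - angle i j.
Proof.
rewrite /angle; case: (ltngtP i j) => [//|_|/val_inj ->]; first by rewrite opprK.
by rewrite !theta_geq // !oppr0.
Qed.

(** The legs of the operators of the theorem. The identity on a leg is the phase of
    angle 0. *)
Definition legs (i j : 'I_N) : option R :=
  if i \in I then Some (angle i j) else if i == j then None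
  else if (i < j)%N then Some (angle i j) else Some 0.

Lemma enum_pairwise : pairwise (fun i j : 'I_N => (i < j)%N) (enum (~: I)).
Proof.
rewrite -sorted_pairwise; last by move=> i j k; exact: ltn_trans.
rewrite /enum_mem; apply: sorted_filter; first by move=> i j k; exact: ltn_trans.
by have := iota_ltn_sorted 0 N; rewrite -val_enum_ord sorted_map enumT.
Qed.

Lemma shift_system_legs (K : hilbertType R) (S : 'I_N -> bop K) :
  (forall i, i \notin I -> S i = 1) -> shift_system (enum (~: I)) S legs.
Proof.
move=> S1; have njs i : (i \in enum (~: I)) = (i \notin I).
  by rewrite mem_enum inE.
split; first exact: enum_uniq.
- by move=> i; rewrite njs => /S1.
- move=> i j; rewrite njs /legs => jI; case: ifP => iI.
    by split => // ij; rewrite ij (negbTE jI) in iI.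
  by case: eqP => // ij; split => //; case: ifP.
- have sub : {in enum (~: I) &, subrel (fun i j : 'I_N => (i < j)%N)
      (fun j i => legs i j == Some 0)}.
    move=> j i; rewrite !njs => jI iI ji; rewrite /legs (negbTE iI).
    by rewrite -(inj_eq val_inj) gtn_eqF // ltnNge ltnW.
  exact: (sub_in_pairwise sub (allss _) enum_pairwise).
Qed.

Lemma wold_legs_legs : wold_legs angle (enum (~: I)) legs.
Proof.
have := enum_pairwise; have : forall i, i \notin I -> i \notin enum (~: I) ->
  all (fun j : 'I_N => (i < j)%N) (enum (~: I)).
  by move=> i iI; rewrite mem_enum inE iI.
have : all (fun j => j \notin I) (enum (~: I)).
  by apply/allP => j; rewrite mem_enum inE.
elim: (enum (~: I)) => //= j js IH /andP[jI jsI] hI /andP[jjs pjs]; split.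
  move=> i ijs; rewrite /legs; case: ifP => // /negbT iI.
  by have /andP[ij _] := hI i iI ijs; rewrite ij -(inj_eq val_inj) ltn_eqF.
apply: IH => // i iI ijs; have [->//|ij] := eqVneq i j.
by have := hI i iI; rewrite inE negb_or ij => /(_ ijs)/andP[].
Qed.

(** Only one factor is nontrivial: the one of the leg of [j] if [j] has a leg, and
    the one of the leg of [i] otherwise. *)
Lemma leg_coef_legs (i j : 'I_N) : (i < j)%N -> ~~ ((i \in I) && (j \in I)) ->
  \prod_(k <- enum (~: I)) leg_coef (legs i k) (legs j k) = expi2pi (- angle i j).
Proof.
move=> ij nij; have nji : (i == j) = false by rewrite -(inj_eq val_inj) ltn_eqF.
have nji' : (j == i) = false by rewrite eq_sym.
have ji : (j < i)%N = false by rewrite ltnNge ltnW.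
rewrite big_enum /=; have [jI|jI] := boolP (j \in I).
  have iI : i \notin I by move: nij; rewrite jI andbT.
  rewrite (bigD1 i) ?inE //= big1 ?mulr1 => [|k].
    by rewrite /legs (negbTE iI) eqxx jI /= angleN.
  rewrite inE => /andP[kI ki]; rewrite /legs (negbTE iI) jI eq_sym (negbTE ki).
  by case: ifP.
rewrite (bigD1 j) ?inE //= big1 ?mulr1 => [|k].
  rewrite {2}/legs (negbTE jI) eqxx /legs.
  by case: ifP => // iI; rewrite nji ij.
rewrite inE => /andP[kI kj].
rewrite /legs (negbTE jI) [j == k]eq_sym (negbTE kj); case: ifP => [iI|/negbT iI].
  by case: ifP.
have [<-|ik] := eqVneq i k; last by do 2 case: ifP.
by rewrite ji /= expi2pi0.
Qed.
End Legs.

Section Induced.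
Variables (R : realType) (m n : nat) (X : set (pairs (m + n) -> R[i])).
Variables (A : universal_cstar (isometry_relations X)).
Variables (I : {set 'I_(m + n)}) (Theta : pairs (m + n) -> R).
Variable (T : universal_cstar (torus_relations I Theta)).
Variables (K : hilbertType R) (rho : representation T K).
Hypothesis SI : Sigma I.
Hypothesis rho1 : forall v, rho 1 v = v.

Let js := enum (~: I).

(** The operators on the first factor: the torus generators for the indices in
    [I], and the identity for those that have a leg. *)
Definition base (i : 'I_(m + n)) : bop K :=
  oapp (fun x => rep_bop rho (ugen T x)) 1 (insub i).

Lemma base_in (i : {i | i \in I}) : base (val i) = rep_bop rho (ugen T i).
Proof. by rewrite /base valK. Qed.

Lemma base_out i : i \notin I -> base i = 1.
Proof. by move=> iI; rewrite /base insubN. Qed.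

Lemma base_isometry i : star (base i) * base i = 1.
Proof.
rewrite /base; case: insubP => [x _ _|_] /=; last by rewrite star1 mulr1.
have [[ut _] _ _] := uniP T.
by rewrite rep_bop_star -rep_bopM; have [-> _] := ut x; exact: rep_bop1.
Qed.

Lemma base_coisometry i : base i * star (base i) = 1.
Proof.
rewrite /base; case: insubP => [x _ _|_] /=; last by rewrite star1 mulr1.
have [[ut _] _ _] := uniP T.
by rewrite rep_bop_star -rep_bopM; have [_ ->] := ut x; exact: rep_bop1.
Qed.

Lemma base_twist i j : i \in I -> j \in I -> (i < j)%N ->
  star (base i) * base j =
  expi2pi (- angle Theta i j) *: (base j * star (base i)).
Proof.
move=> iI jI ij.
have E : base i * base j = expi2pi (angle Theta i j) *: (base j * base i).
  have := base_in (Sub i iI); have := base_in (Sub j jI).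
  rewrite !SubK => -> ->; rewrite -!rep_bopM -rep_bopZ /angle ij; congr rep_bop.
  by have [[_ tt] _ _] := uniP T; exact: (tt (Sub i iI) (Sub j jI)).
have -> : base j * star (base i) = star (base i) * (base i * base j) * star (base i).
  by rewrite mulrA base_isometry mul1r.
rewrite E cstarZr cstarZl scalerA mulrC expi2piNr scale1r.
by rewrite -!mulrA base_coisometry mulr1.
Qed.

Definition op (i : 'I_(m + n)) : bop (tensor_space js K) :=
  tensor_op js (base i) (legs Theta I i).

Lemma legs_None i k : i != k \/ i \in I -> legs Theta I i k <> None.
Proof.
rewrite /legs; case: ifP => // iI; case: eqP => _; last by case: ifP.
by case.
Qed.

Lemma op_isometry i : star (op i) * op i = 1.
Proof. exact/tensor_op_isometry/base_isometry. Qed.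

Lemma op_coisometry i : i \in I -> op i * star (op i) = 1.
Proof.
move=> iI; apply: tensor_op_coisometry; first exact: base_coisometry.
by move=> k _; apply: legs_None; right.
Qed.

(** The scalar comes from the torus if both indices are in [I], and from a single
    leg otherwise. *)
Lemma op_twist (i j : 'I_(m + n)) : (i < j)%N ->
  star (op i) * op j = expi2pi (- angle Theta i j) *: (op j * star (op i)).
Proof.
move=> ij.
have dN k : k \in js -> ~ (legs Theta I i k = None /\ legs Theta I j k = None).
  move=> _ [hi hj]; have [ik|ik] := eqVneq i k; last by case: (legs_None (or_introl ik)).
  have [jk|jk] := eqVneq j k; last by case: (legs_None (or_introl jk)).
  by rewrite ik jk ltnn in ij.
have [/andP[iI jI]|nij] := boolP ((i \in I) && (j \in I)).
  rewrite /op (tensor_op_twist dN (base_twist iI jI ij)) big1 ?mulr1 // => k _.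
  by rewrite /legs iI jI.
have triv : star (base i) * base j = 1 *: (base j * star (base i)).
  rewrite scale1r; move: nij; rewrite negb_and => /orP[/base_out->|/base_out->].
    by rewrite star1 mulr1 mul1r.
  by rewrite mulr1 mul1r.
by rewrite /op (tensor_op_twist dN triv) mul1r leg_coef_legs.
Qed.

Definition induced_gen (x : 'I_(m + n) + pairs (m + n)) : bop (tensor_space js K) :=
  match x with
  | inl i => op i
  | inr p => scalar_bop _ (expi2pi (Theta p))
  end.

Hypothesis XTheta : X (torus_point Theta).

(** The central generators act by scalars, so a character of the algebra they
    generate can only send them to these scalars, which form a point of [X]. *)
Lemma induced_relations : isometry_relations X (bop (tensor_space js K)) induced_gen.
Proof.
split => /=.
- move=> p; case pE : (val p) => [i j].
  have ij : (i < j)%N by have := valP p; rewrite pE.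
  rewrite op_twist // /angle ij (theta_pair Theta pE) scalar_bop_star expi2piN.
  by rewrite scalar_bopl cstarZl.
- exact: op_isometry.
- by move=> i im; apply: op_coisometry; exact: SI.
- move=> p; split => [|i|q]; try by rewrite scalar_bopl scalar_bopr.
  rewrite /unitary scalar_bop_star scalar_bopl scalar_bopr !scalerA.
  by rewrite -expi2piN [_ * expi2pi _]mulrC expi2piNr scale1r.
- move=> l [chi [chi1 chiL chiM] lE].
  suff -> : l = torus_point Theta by [].
  apply/funext => p; rewrite -lE /torus_point.
  have [D1 DL _ _ _] : cstar_subalgebra
      (cstar_generated (range (fun p : pairs (m + n) => induced_gen (inr p)))).
    split.
    + by move=> B [[]].
    + by move=> c x y Dx Dy B BP; have [[_ BL _ _ _] _] := BP; apply: BL; [exact: Dx|exact: Dy].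
    + by move=> x y Dx Dy B BP; have [[_ _ BM _ _] _] := BP; apply: BM; [exact: Dx|exact: Dy].
    + by move=> x Dx B BP; have [[_ _ _ BS _] _] := BP; apply: BS; exact: Dx.
    + apply: closed_bigI => B [[_ _ _ _ Bc] _]; exact: Bc.
  have D0 : cstar_generated (range (fun p : pairs (m + n) => induced_gen (inr p))) 0.
    by have := DL (-1) 1 1 D1 D1; rewrite scaleN1r addNr.
  have chi0 : chi 0 = 0.
    by have := chiL (-1) 1 1 D1 D1; rewrite scaleN1r addNr mulN1r addNr.
  by have := chiL (expi2pi (Theta p)) 1 0 D1 D0; rewrite addr0 chi1 mulr1 chi0 addr0.
Qed.

Lemma l2_phase0 (xi : l2 R[i]) : l2_phase 0 xi = xi.
Proof. by apply: l2P => k; rewrite /= mul0r expi2pi0 mul1r. Qed.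

Lemma op_etensor_out (j : 'I_(m + n)) x (xi : 'I_(m + n) -> l2 R[i]) : j \notin I ->
  op j (etensor js x xi) = etensor js x (fun k =>
    if k == j then l2_shift (xi k)
    else if (j < k)%N then l2_phase (theta Theta j k) (xi k) else xi k).
Proof.
move=> jI; rewrite /op tensor_op_etensor base_out //; apply: etensor_ext => k _.
rewrite /legs (negbTE jI) eq_sym; case: ifP => // _.
by case: ifP => jk /=; rewrite ?l2_phase0 // /angle jk.
Qed.

Lemma op_etensor_in (i : {i | i \in I}) x (xi : 'I_(m + n) -> l2 R[i]) :
  op (val i) (etensor js x xi) =
  etensor js (rho (ugen T i) x) (fun j => lambda Theta (val i) j (xi j)).
Proof.
rewrite /op tensor_op_etensor base_in; apply: etensor_ext => k _.
by rewrite /legs (valP i) /lambda /angle; case: ifP.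
Qed.

Lemma induced_exists : exists w : representation A (tensor_space js K),
  is_pi (ugen A) Theta (ugen T) rho w /\ forall v, w 1 v = v.
Proof.
have [_ _ univ] := uniP A; have [phi phiP phig] := univ _ _ induced_relations.
exists (morphism_rep phiP); split; last exact: morphism_rep1.
split => [j jI x xi|i x xi|p v].
- by rewrite morphism_repE phig; exact: op_etensor_out.
- by rewrite morphism_repE phig; exact: op_etensor_in.
- by rewrite morphism_repE phig.
Qed.

Section IsPi.
Variable w : representation A (tensor_space js K).
Hypothesis wP : is_pi (ugen A) Theta (ugen T) rho w.

(** The values on elementary tensors determine the operators. *)
Lemma is_pi_op i : rep_bop w (ugen A (inl i)) = op i.
Proof.
apply: bopP => u; suff : [set u | rep_bop w (ugen A (inl i)) u = op i u] u by [].
apply: (@etensor_total R _ js K); first exact: enum_uniq.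
  split; first by rewrite /mkset !bop0r.
    by move=> c x y hx hy; rewrite /mkset !bop_linear hx hy.
  by apply: closed_equalizer; apply: (@lipschitz_continuous _ _ _ _ `|_|) => x y;
    rewrite -bopNr -bopDr; exact: bop_normP.
move=> x xi; rewrite /mkset rep_bopE; have [w1 w2 _] := wP.
have [iI|iI] := boolP (i \in I); last by rewrite w1 // op_etensor_out.
by have := w2 (Sub i iI) x xi; rewrite -op_etensor_in SubK.
Qed.

Lemma is_pi_invariant (W : set (tensor_space js K)) :
  closed_subspace W -> (forall v, w 1 v = v) ->
  (forall i u, W u -> W (op i u)) -> (forall i u, W u -> W (star (op i) u)) ->
  forall a v, W v -> W (w a v).
Proof.
move=> cW w1 Wop Wop'; have [_ gen _] := uniP A; have [_ _ wu] := wP.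
apply: (invariant_generators gen) => //.
- by move=> v; rewrite w1.
- move=> [i|p] v Wv; first by rewrite -rep_bopE is_pi_op; exact: Wop.
  by rewrite wu; exact: csubZ.
- move=> [i|p] v Wv.
    by rewrite -rep_bopE -rep_bop_star is_pi_op; exact: Wop'.
  have -> : w (star (ugen A (inr p))) v = (expi2pi (Theta p))^* *: v.
    by apply: inner_ext => u; rewrite rep_star wu innerZl innerZr.
  exact: csubZ.
Qed.

Lemma is_pi_neq0 (p : pairs (m + n)) : irreducible rho ->
  exists a v, w a v <> 0.
Proof.
move=> /irreducible_neq0[x x0]; have [_ _ wu] := wP.
exists (ugen A (inr p)), (etensor js x (fun=> l2_basis R 0)).
rewrite wu => /eqP; rewrite scaler_eq0 (negbTE (expi2pi_neq0 _)) /=.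
by move=> /eqP/etensor_basis_eq0 x00; rewrite x00 eqxx in x0.
Qed.

(** An invariant subspace has the form [W0 (x) l2(N_0) (x) ... (x) l2(N_0)] with
    [W0] invariant under the generators of the torus, hence under [rho]. *)
Lemma is_pi_irreducible (p : pairs (m + n)) : irreducible rho -> irreducible w.
Proof.
move=> irr; split; first exact: is_pi_neq0.
move=> W cW Winv.
have Wop i u : W u -> W (op i u) by rewrite -is_pi_op; exact: Winv.
have Wop' i u : W u -> W (star (op i) u).
  by rewrite -is_pi_op rep_bop_star; exact: Winv.
have sys := shift_system_legs Theta base_out.
have [W0 [cW0 WE inv inv']] := invariant_tensor_sub sys cW Wop Wop'.
have [_ gen _] := uniP T.
have W0inv a x : W0 x -> W0 (rho a x).
  apply: (invariant_generators gen) => //.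
  - by move=> v; rewrite rho1.
  - by move=> y v; rewrite -rep_bopE -base_in; exact: inv.
  - by move=> y v; rewrite -rep_bopE -rep_bop_star -base_in; exact: inv'.
have [_ /(_ W0 cW0 W0inv)] := irr.
case=> W0E; [left|right]; rewrite WE W0E; first exact: tensor_sub0.
exact: tensor_subT.
Qed.
End IsPi.
End Induced.

(** * The irreducible representations *)

Lemma unitary_comm_star (R : realType) (A : cstarType R) (u y : A) :
  unitary u -> u * y = y * u -> u * star y = star y * u.
Proof.
move=> [uu uu'] uy; apply: (can_inj (@starK _ _)); rewrite !starMr starK.
by rewrite -[LHS]mul1r -uu -mulrA [u * (y * _)]mulrA uy -mulrA uu' mulr1.
Qed.

Section RangeProjections.
Variables (R : realType) (H : hilbertType R) (J : eqType).
Variables (s : J -> bop H) (th : J -> J -> R).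
Hypothesis s_isometry : forall i, star (s i) * s i = 1.
Hypothesis thN : forall i j, th j i = - th i j.
Hypothesis s_twist : forall i j, i != j ->
  star (s i) * s j = expi2pi (- th i j) *: (s j * star (s i)).

Lemma range_projS j n : range_proj (s j) n.+1 = s j * range_proj (s j) n * star (s j).
Proof. by rewrite /range_proj exprS starMr !mulrA. Qed.

Lemma range_proj_comm i j n : i != j ->
  range_proj (s j) n * s i = s i * range_proj (s j) n.
Proof.
move=> ij; have ji : j != i by rewrite eq_sym.
elim: n => [|n IHn]; first by rewrite /range_proj expr0 star1 !mulr1 mul1r.
rewrite range_projS -mulrA s_twist // cstarZr.
set P := range_proj (s j) n in IHn *.
have -> : s j * P * (s i * star (s j)) = s j * (P * s i) * star (s j).
  by rewrite !mulrA.
rewrite IHn mulrA (isometries_twist s_isometry thN s_twist ji) !cstarZl scalerA.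
by rewrite mulrC expi2piNr scale1r !mulrA.
Qed.

Lemma range_proj_comm_star i j n : i != j ->
  range_proj (s j) n * star (s i) = star (s i) * range_proj (s j) n.
Proof.
move=> ij; apply: (can_inj (@starK _ _)).
by rewrite [LHS]starMr [RHS]starMr starK range_proj_star range_proj_comm.
Qed.

(** The range projections of the powers of [s j] commute with the other isometries,
    as the two phases cancel. *)
Lemma unitary_part_invariant i j x : (forall n, range_proj (s j) n x = x) ->
  (forall n, range_proj (s j) n (s i x) = s i x) /\
  (forall n, range_proj (s j) n (star (s i) x) = star (s i) x).
Proof.
move=> Px; have [->|ij] := eqVneq i j.
  split=> [[|n]|n].
  - by rewrite /range_proj expr0 star1 mulr1.
  - by rewrite range_projS bopME bopME isometryK // Px.
  - rewrite -[in RHS](Px n.+1) range_projS bopME bopME isometryK //.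
split=> n; rewrite -bopME.
  by rewrite range_proj_comm // bopME Px.
by rewrite range_proj_comm_star // bopME Px.
Qed.

Lemma unitary_part_closed j :
  closed_subspace [set x | forall n, range_proj (s j) n x = x].
Proof.
split => [n|c x y hx hy n|]; first by rewrite bop0r.
  by rewrite bop_linear hx hy.
have -> : [set x | forall n, range_proj (s j) n x = x] =
    \bigcap_(n in setT) [set x | range_proj (s j) n x = x].
  by apply/seteqP; split => [x hx n _|x hx n]; [exact: hx|exact: (hx n I)].
apply: closed_bigI => n _; apply: (@closed_equalizer R H H (range_proj (s j) n) id).
  apply: (@lipschitz_continuous _ _ _ _ `|range_proj (s j) n|) => x y.
  by rewrite -bopNr -bopDr; exact: bop_normP.
by move=> x; exact: cvg_id.
Qed.
End RangeProjections.

Section Scalars.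
Variables (R : realType) (m n : nat) (X : set (pairs (m + n) -> R[i])).
Variables (A : universal_cstar (isometry_relations X)).
Variables (H : hilbertType R) (v : representation A H).
Hypothesis irr : irreducible v.

Let v1 := irreducible_rep1 irr.
Let u (p : pairs (m + n)) : A := ugen A (inr p).

Lemma u_central p a : u p * a = a * u p.
Proof.
have [[_ _ _ cen _] gen _] := uniP A; have [uu us up] := cen p.
suff : cstar_generated (range (ugen A)) `<=` [set a | u p * a = a * u p].
  by rewrite gen => /(_ a I).
have ug x : u p * ugen A x = ugen A x * u p by case: x.
apply: generated_ind.
- by rewrite /mkset mul1r mulr1.
- move=> c x y hx hy.
  by rewrite /mkset mulrDr mulrDl cstarZl cstarZr hx hy.
- by move=> x y hx hy; rewrite /mkset mulrA hx -mulrA hy mulrA.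
- by apply: closed_equalizer; [exact: mulr_continuousl|exact: mulr_continuousr].
- exact: ug.
- by move=> x; exact/unitary_comm_star/ug.
Qed.

(** Schur's lemma applied to the central unitaries. *)
Lemma u_scalar p : exists t : R, forall x, v (u p) x = expi2pi t *: x.
Proof.
have cS a x : rep_bop v (u p) (v a x) = v a (rep_bop v (u p) x).
  by rewrite !rep_bopE -!repM u_central.
have [c hc] := commutant_scalar irr cS.
have [[_ _ _ cen _] _ _] := uniP A; have [[uu _] _ _] := cen p.
have [e e0] := irreducible_neq0 irr.
have c1 : `|c| = 1.
  have := rep_norm_star v (u p) e; rewrite uu v1 -rep_bopE hc innerZl innerZr.
  rewrite mulrA -normCK -[RHS]mul1r => /mulIf h.
  apply/eqP; rewrite -(@eqrXn2 _ 2) // expr1n; apply/eqP/h.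
  by apply: contra_neq e0; exact: inner_eq0.
have [t tc] := expi2pi_surj c1.
by exists t => x; rewrite tc -hc.
Qed.

Definition rep_angles (p : pairs (m + n)) : R := sval (cid (u_scalar p)).

Lemma rep_anglesP p x : v (u p) x = expi2pi (rep_angles p) *: x.
Proof. by rewrite /rep_angles; case: cid. Qed.

Lemma rep_angles_star p x :
  v (star (u p)) x = expi2pi (- rep_angles p) *: x.
Proof.
apply: inner_ext => y.
by rewrite rep_star rep_anglesP innerZl innerZr expi2piN.
Qed.

(** On the algebra that the central unitaries generate, every element acts as a
    scalar, and this scalar is a character. *)
Lemma rep_angles_mem : X (torus_point rep_angles).
Proof.
have [[_ _ _ cen spec] _ _] := uniP A; apply: spec.
have [e e0] := irreducible_neq0 irr.
have ee : inner e e != 0 by apply: contra_neq e0; exact: inner_eq0.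
pose chi a := inner (v a e) e / inner e e.
have chiE a c : v a e = c *: e -> chi a = c.
  by move=> ae; rewrite /chi ae innerZl mulfK.
have chi_cont : continuous (chi : A -> R[i]).
  apply: (@lipschitz_continuous R A R[i] chi (`|e| * `|e| / `|inner e e|)) => a b.
  rewrite /chi -mulrBl -innerNl -innerDl -repB normrM normfV [leRHS]mulrAC.
  rewrite ler_wpM2r ?invr_ge0 //; apply: le_trans (inner_CauchySchwarz _ _) _.
  by rewrite [leRHS]mulrAC ler_wpM2r // mulrC rep_contractive.
pose D := [set a | forall x, v a x = chi a *: x].
have sub : cstar_generated (range u) `<=` D.
  apply: generated_ind.
  - by move=> x; rewrite (chiE 1 1) ?v1 ?scale1r.
  - move=> c a b ha hb x; rewrite (chiE _ (c * chi a + chi b)).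
      by rewrite repD repZ ha hb scalerDl scalerA.
    by rewrite repD repZ ha hb scalerDl scalerA.
  - move=> a b ha hb x; rewrite (chiE _ (chi a * chi b)).
      by rewrite repM ha hb scalerA.
    by rewrite repM ha hb scalerA.
  - have -> : D = \bigcap_(x in setT) [set a | v a x = chi a *: x].
      by apply/seteqP; split => [a ha x _|a ha x]; [exact: ha|exact: (ha x I)].
    apply: closed_bigI => x _; apply: closed_equalizer; first exact: rep_continuousl.
    by move=> a; apply: cvgZl; exact: chi_cont.
  - by move=> p x; rewrite (chiE _ (expi2pi (rep_angles p))) ?rep_anglesP.
  - by move=> p x; rewrite (chiE _ (expi2pi (- rep_angles p))) ?rep_angles_star.
exists chi; last by move=> p; apply: chiE; exact: rep_anglesP.
split.
- by apply: chiE; rewrite v1 scale1r.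
- move=> c a b /sub ha /sub hb; apply: chiE.
  by rewrite repD repZ ha hb scalerDl scalerA.
- move=> a b /sub ha /sub hb; apply: chiE.
  by rewrite repM ha hb scalerA.
Qed.

Let s i := rep_bop v (ugen A (inl i)).
Let Theta := rep_angles.

Lemma rep_isometry i : star (s i) * s i = 1.
Proof.
have [[_ iso _ _ _] _ _] := uniP A.
by rewrite /s rep_bop_star -rep_bopM iso rep_bop1.
Qed.

Lemma rep_twist i j : i != j ->
  star (s i) * s j = expi2pi (- angle Theta i j) *: (s j * star (s i)).
Proof.
have [[tw _ _ _ _] _ _] := uniP A.
have lt (a b : 'I_(m + n)) : (a < b)%N ->
    star (s a) * s b = expi2pi (- angle Theta a b) *: (s b * star (s a)).
  move=> ab; have [p pE] : exists p : pairs (m + n), val p = (a, b).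
    by exists (Sub (a, b) ab).
  have := tw p; rewrite pE => twp.
  rewrite /s !rep_bop_star -!rep_bopM twp; apply: bopP => x.
  rewrite bopZE !rep_bopE -mulrA repM rep_angles_star; congr (expi2pi (- _) *: _).
  by rewrite /angle ab (theta_pair _ pE).
(* for [j < i] the relation is the adjoint of the one for the pair [(j, i)] *)
move=> ij; have [/lt //|ji|/val_inj ij'] := ltngtP i j; last by rewrite ij' eqxx in ij.
apply: (can_inj (@starK _ _)).
by rewrite starZ !starMr starK lt // -[(_)^*]expi2piN opprK (angleN Theta j i).
Qed.

Lemma rep_invariant (W : set H) : closed_subspace W ->
  (forall i x, W x -> W (s i x)) -> (forall i x, W x -> W (star (s i) x)) ->
  forall a x, W x -> W (v a x).
Proof.
move=> cW Ws Ws'; have [_ gen _] := uniP A.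
apply: (invariant_generators gen) => //.
- by move=> x; rewrite v1.
- move=> [i|p] x Wx; first exact: Ws.
  by rewrite rep_anglesP; exact: csubZ.
- move=> [i|p] x Wx; last by rewrite rep_angles_star; exact: csubZ.
  by rewrite -rep_bopE -rep_bop_star; exact: Ws'.
Qed.

Let sN := @angleN R (m + n) Theta.

Definition unitary_indices : {set 'I_(m + n)} :=
  [set i | `[< s i * star (s i) = 1 >]].

Let I := unitary_indices.
Let js := enum (~: I).

Lemma unitary_indices_Sigma : Sigma I.
Proof.
have [[_ _ co _ _] _ _] := uniP A.
move=> i im; rewrite inE; apply/asboolP.
by rewrite /s rep_bop_star -rep_bopM co ?rep_bop1.
Qed.

(** The part on which one of the isometries is unitary reduces the whole
    representation, so by irreducibility it is everything or nothing. *)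
Lemma rep_pure j : j \notin I -> pure (s j).
Proof.
move=> jI; pose W := [set x | forall n, range_proj (s j) n x = x].
have cW : closed_subspace W := unitary_part_closed _ j.
have Winv := rep_invariant cW
  (fun i x Wx => (unitary_part_invariant rep_isometry sN rep_twist i Wx).1)
  (fun i x Wx => (unitary_part_invariant rep_isometry sN rep_twist i Wx).2).
have [W0|WT] := irr.2 W cW Winv.
  by move=> x Px; have : W x by []; rewrite W0.
case/negP: jI; rewrite inE; apply/asboolP/bopP => x.
have : W x by rewrite WT.
by move=> /(_ 1%N); rewrite /range_proj expr1.
Qed.

Let Q := vacuum s js.

Let Q_star : star Q = Q.
Proof. exact: (vacuum_star rep_isometry sN rep_twist (enum_uniq _)). Qed.

Let QM : Q * Q = Q.
Proof. exact: (vacuumM rep_isometry sN rep_twist (enum_uniq _)). Qed.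

Let WK := [set x : H | Q x = x].

Lemma vacuum_space_closed : closed_subspace [set x : H | vacuum s js x = x].
Proof.
split => [|c x y hx hy|]; first by rewrite /mkset bop0r.
  by rewrite /mkset bop_linear hx hy.
apply: (@closed_equalizer R H H Q id); last by move=> x; exact: cvg_id.
apply: (@lipschitz_continuous _ _ _ _ `|Q|) => x y.
by rewrite -bopNr -bopDr; exact: bop_normP.
Qed.

Let K : hilbertType R := @hilbert_sub R H _ vacuum_space_closed.

Let njs i : i \in I -> i \notin js. Proof. by rewrite mem_enum finset.in_setC negbK. Qed.

Let WK_s i : i \in I -> forall x, WK x -> WK (s i x).
Proof.
move=> iI x Wx; rewrite /WK /mkset -bopME /Q.
by rewrite (vacuum_comm rep_isometry sN rep_twist) ?njs // bopME -/Q Wx.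
Qed.

Let WK_star i : i \in I -> forall x, WK x -> WK (star (s i) x).
Proof.
move=> iI x Wx; rewrite /WK /mkset -bopME /Q.
by rewrite (vacuum_comm_star rep_isometry sN rep_twist) ?njs // bopME -/Q Wx.
Qed.

Definition torus_gen (i : {i | i \in unitary_indices}) : bop K :=
  restrict_bop (cW := vacuum_space_closed) (WK_s (valP i)) (WK_star (valP i)).

Lemma torus_genE i x : sub_val (torus_gen i x) = s (val i) (sub_val x).
Proof. by []. Qed.

Lemma torus_gen_relations : torus_relations unitary_indices rep_angles (bop K) torus_gen.
Proof.
split=> [i|i j ij].
  split; apply: bopP => x; apply: sub_inj; rewrite bopME.
    by rewrite restrict_bop_star restrict_bopE isometryK // rep_isometry.
  rewrite restrict_bopE restrict_bop_star -bopME.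
  by have /asboolP -> : `[< s (val i) * star (s (val i)) = 1 >]
    by have := valP i; rewrite inE.
apply: bopP => x; apply: sub_inj; rewrite bopME !torus_genE bopZE sub_valZ bopME.
rewrite !torus_genE -!bopME.
have ij' : val i != val j by rewrite -(inj_eq val_inj) ltn_eqF.
rewrite (isometries_twist rep_isometry sN rep_twist ij') bopZE /angle ij.
by [].
Qed.

Definition to_vacuum (h : H) : K :=
  @to_sub R H _ vacuum_space_closed (Q h) (congr1 (fun S : bop H => S h) QM).

Lemma to_vacuumE h : sub_val (to_vacuum h) = Q h. Proof. by []. Qed.

Lemma to_vacuum_linear : linear to_vacuum.
Proof.
by move=> c x y; apply: sub_inj; rewrite sub_valD sub_valZ !to_vacuumE bop_linear.
Qed.

Lemma to_vacuum_surj x : exists h, to_vacuum h = x.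
Proof.
by exists (sub_val x); apply: sub_inj; rewrite to_vacuumE; exact: (sub_valP x).
Qed.

Lemma to_vacuum_inner h h' : inner (to_vacuum h) (to_vacuum h') = inner (Q h) h'.
Proof.
by rewrite sub_innerE !to_vacuumE -{2}Q_star starEr -bopME QM.
Qed.

(* A continuous surjection sends a dense set to a dense set. *)
Lemma vacuum_separable : separable H -> separable K.
Proof.
move=> [D Dc Dd]; exists (to_vacuum @` D).
  exact: (card_le_trans (card_image_le _ _)).
have tc : continuous to_vacuum.
  apply: (@lipschitz_continuous _ _ _ _ `|Q|) => x y.
  by rewrite sub_normE sub_valD sub_valN !to_vacuumE -bopNr -bopDr bop_normP.
move=> O [x Ox] Oo; have [h hx] := to_vacuum_surj x.
have [y [Oy Dy]] := Dd (to_vacuum @^-1` O)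
  (ex_intro _ h (eq_ind_r O Ox hx)) (open_comp (fun z _ => tc z) Oo).
by exists (to_vacuum y); split => //; exists y.
Qed.

Section Induction.
Variable T : universal_cstar (torus_relations unitary_indices rep_angles).
Variable rho : representation T K.
Hypothesis rhoE : forall i x, rho (ugen T i) x = torus_gen i x.
Hypothesis rho1 : forall x, rho 1 x = x.

Lemma wold_unitary : exists U : H -> tensor_space js K,
  [/\ linear U, forall h h', inner (U h) (U h') = inner h h',
      forall u, exists h, U h = u & forall i h, U (s i h) = op rho i (U h)].
Proof.
apply: (wold_decomposition rep_isometry sN rep_twist (a := to_vacuum) (T := base rho)
  (d := legs Theta I)).
- exact: (shift_system_legs _ (base_out rho)).
- exact: wold_legs_legs.
- by move=> j; rewrite mem_enum finset.in_setC => /rep_pure.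
- split; [exact: to_vacuum_linear|exact: to_vacuum_inner|exact: to_vacuum_surj|].
  move=> i; rewrite mem_enum finset.in_setC negbK => iI h; apply: sub_inj.
  have -> : base rho i = rep_bop rho (ugen T (Sub i iI)).
    by rewrite -base_in SubK.
  rewrite rep_bopE rhoE torus_genE SubK !to_vacuumE -!bopME.
  by rewrite /Q (vacuum_comm rep_isometry sN rep_twist) // njs.
Qed.

Lemma rep_equivalent (w : representation A (tensor_space js K)) :
  is_pi (ugen A) rep_angles (ugen T) rho w -> (forall x, w 1 x = x) ->
  exists U : H -> tensor_space js K,
    [/\ linear U, forall h h', inner (U h) (U h') = inner h h',
        forall u, exists h, U h = u & forall a h, U (v a h) = w a (U h)].
Proof.
move=> wP w1; have [U [Ul Ui Us Uop]] := wold_unitary; exists U; split => //.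
have [_ gen _] := uniP A; apply: (intertwiner_generators gen) => //.
move=> [i|p] h; first by rewrite -rep_bopE Uop -(is_pi_op wP).
have [_ _ wu] := wP; rewrite wu rep_anglesP.
have U0 : U 0 = 0 by have := Ul (-1) 0 0; rewrite scaler0 add0r scaleN1r addNr.
by have := Ul (expi2pi (rep_angles p)) h 0; rewrite U0 !addr0.
Qed.

(** An invariant subspace [W] of the vacuum space gives the invariant subspace
    [W (x) l2(N_0) (x) ... (x) l2(N_0)] of the whole, from which it is recovered by
    testing on products with vacuum vectors. *)
Lemma torus_rep_irreducible (w : representation A (tensor_space js K)) :
  is_pi (ugen A) rep_angles (ugen T) rho w -> (forall x, w 1 x = x) ->
  irreducible rho.
Proof.
move=> wP w1; have [U [Ul Ui Us Uw]] := rep_equivalent wP w1.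
have U0 : U 0 = 0 by have := Ul (-1) 0 0; rewrite scaler0 add0r scaleN1r addNr.
have Unorm h : `|U h| = `|h| := norm_eq_sqr (Ui h h).
have Uc : continuous U.
  apply: (@lipschitz_continuous R _ _ _ 1) => x y.
  have -> : U x - U y = U (x - y) by rewrite addrC -scaleN1r -Ul scaleN1r addrC.
  by rewrite mul1r Unorm.
split.
  have [e e0] := irreducible_neq0 irr.
  have [[x x0]|K0] := pselect (exists x : K, x <> 0).
    by exists 1, x; rewrite rho1.
  have KE : [set 0 : K] = setT.
    apply/seteqP; split => // x _; apply: contrapT => x0; apply: K0; by exists x.
  have : tensor_sub js [set 0 : K] (U e) by rewrite KE tensor_subT.
  rewrite tensor_sub0 => /= Ue; have := Unorm e; rewrite Ue normr0 => /esym/eqP.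
  by rewrite normr_eq0 (negbTE e0).
move=> W cW Winv; pose W' := [set h | tensor_sub js W (U h)].
have cW' : closed_subspace W'.
  by apply: csub_preimage Ul Uc; exact: tensor_sub_closed.
have base_inv i x : W x -> W (base rho i x).
  by rewrite /base; case: insubP => [y _ _|_] //= Wx; exact: Winv.
have base_inv' i x : W x -> W (star (base rho i) x).
  rewrite /base; case: insubP => [y _ _|_]; last by rewrite /oapp star1.
  by rewrite /oapp rep_bop_star => Wx; exact: Winv.
have W'inv a h : W' h -> W' (v a h).
  move=> W'h; rewrite /W' /mkset Uw.
  apply: (is_pi_invariant wP (tensor_sub_closed _ cW) w1) => //.
    by move=> i z; apply: tensor_op_sub => // x; exact: base_inv.
  by move=> i z; apply: tensor_op_star_sub => // x; exact: base_inv'.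
have [W'0|W'T] := irr.2 W' cW' W'inv.
  left; apply/seteqP; split => [x Wx|_ ->]; last exact: csub0.
  have [h hx] := Us (etensor js x (fun=> l2_basis R 0)).
  have : W' h by rewrite /W' /mkset hx; exact: tensor_sub_etensor.
  rewrite W'0 => /= h0; rewrite h0 U0 in hx.
  exact/(etensor_basis_eq0 (esym hx)).
right; apply/seteqP; split => // x _.
have [h hx] := Us (etensor js x (fun=> l2_basis R 0)).
have : W' h by rewrite W'T.
by rewrite /W' /mkset hx; exact: tensor_sub_basis.
Qed.
End Induction.
End Scalars.

Theorem theorem3p3 (R : realType) (m n : nat) (hmn : (2 <= m + n)%N)
    (X : set (pairs (m + n) -> R[i]))
    (XT : forall x, X x -> forall p, `|x p| = 1)
    (Xclosed : closed (X : set {ptws pairs (m + n) -> R[i]}))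
    (A : universal_cstar (isometry_relations X))
    (T : forall (I : {set 'I_(m + n)}) (Theta : pairs (m + n) -> R),
       universal_cstar (torus_relations I Theta)) :
  (forall (I : {set 'I_(m + n)}) (Theta : pairs (m + n) -> R)
      (K : hilbertType R) (rho : representation (T I Theta) K),
      Sigma I -> X (torus_point Theta) -> separable K -> irreducible rho ->
      (exists w : representation A (tensor_space (enum (~: I)) K),
         is_pi (ugen A) Theta (ugen (T I Theta)) rho w) /\
      (forall w : representation A (tensor_space (enum (~: I)) K),
         is_pi (ugen A) Theta (ugen (T I Theta)) rho w -> irreducible w)) /\
  (forall (H : hilbertType R) (v : representation A H),
      separable H -> irreducible v ->
      exists (I : {set 'I_(m + n)}) (Theta : pairs (m + n) -> R)
        (K : hilbertType R) (rho : representation (T I Theta) K)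
        (w : representation A (tensor_space (enum (~: I)) K)),
        [/\ Sigma I, X (torus_point Theta), separable K /\ irreducible rho,
            is_pi (ugen A) Theta (ugen (T I Theta)) rho w &
            unitarily_equivalent v w]).
Proof.
have p0 : pairs (m + n).
  have h0 : (0 < m + n)%N by apply: leq_trans hmn.
  by exists (Ordinal h0, Ordinal hmn).
split.
  move=> I Theta K rho SI XTheta _ irr; have rho1 := irreducible_rep1 irr.
  split; last by move=> w wP; exact: (is_pi_irreducible rho1 wP p0 irr).
  by have [w [wP _]] := induced_exists A SI rho1 XTheta; exists w.
move=> H v sepH irr.
pose I := unitary_indices v; pose Theta := rep_angles irr.
have [_ _ univ] := uniP (T I Theta).
have [phi phiP phig] := univ _ _ (torus_gen_relations irr).
pose rho := morphism_rep phiP.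
have rhoE i x : rho (ugen (T I Theta) i) x = torus_gen irr i x.
  by rewrite morphism_repE phig.
have rho1 x : rho 1 x = x := morphism_rep1 phiP x.
have SI : Sigma I := unitary_indices_Sigma irr.
have XTheta : X (torus_point Theta) := rep_angles_mem irr.
have [w [wP w1]] := induced_exists A SI rho1 XTheta.
exists I, Theta, _, rho, w; split => //.
  split; first exact: vacuum_separable.
  exact: (torus_rep_irreducible rhoE rho1 wP w1).
have [U [Ul Ui Us Uw]] := rep_equivalent rhoE wP w1.
exists U; split => //; exists (fun u => sval (cid (Us u))) => h; last by case: cid.
case: cid => h' /= Uh; apply/eqP; rewrite -subr_eq0; apply/eqP/inner_eq0.
have UB : U (h' - h) = 0 by rewrite addrC -scaleN1r Ul Uh scaleN1r addNr.
by rewrite -Ui UB inner0l.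
Qed.
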